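(* Consider the closed-loop sampled-data system described in the context: exosystem, encoder–decoder pair (with integer $N$ and sampling interval $T>0$), plant, and regulator (with parameters $\kappa>0$ and $k>0$), i.e. \[ \begin{array}{rcl} \dot w&=&s(w),\\ \dot w_{\rm d}&=&s(w_{\rm d}),\qquad w_{\rm d}(jT)=w_{\rm d}(jT^-)+w_{\rm q}(j)\,\dfrac{L(j)}{N},\quad j=0,1,2,\dots\\ \dot z&=&f(z,y,\mu),\\ \dot y&=&q(z,y,\mu)+\Gamma\xi-k\,(y-y_{\rm r}(w_{\rm d})),\\ \dot\xi&=&\Phi_{\rm c}(\xi)-Gk\,(y-y_{\rm r}(w_{\rm d})). \end{array} \] Suppose assumptions (A0), (A1), (A2), (A3) of the context hold. Then there exists $\kappa^\ast>0$ such that for every $\kappa\ge\kappa^\ast$ the following holds: there exist $T^\ast>0$ and $k^\ast>0$ such that, for every sampling interval $T>T^\ast$ satisfying $N>\sqrt r\,M(T)$ and every $k\ge k^\ast$, all trajectories of the closed-loop system with $\mu\in P$, $w(0)\in W_0$, $w_{\rm d}(0^-)\in W_0$, $z(0)\in Z$, $y(0)\in Y$, $\xi(0)\in\Xi$ are bounded in positive time.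
   Context: **Exosystem and sets.** $s:\mathbb R^r\to\mathbb R^r$, $y_{\rm r}:\mathbb R^r\to\mathbb R$; the exosystem is $\dot w=s(w)$. $|\cdot|$ is the Euclidean norm, and $|x|_S=\min_{y\in S}|x-y|$ for a compact set $S$. (A0) $s$ is locally Lipschitz and the initial conditions $w(0)$ of the exosystem lie in a fixed compact set $W_0\subset\mathbb R^r$ invariant for $\dot w=s(w)$. Let $L_0=\max_{1\le i\le r}\max_{(x,y)\in W_0\times W_0}|x_i-y_i|$. Given the number of bits $N_b$ of the channel, $N$ is the largest positive integer with $N_b\ge r\lceil\log_2N\rceil$. (A1) There is a compact set $W\supset W_0$, invariant for $\dot w=s(w)$, such that $\bar w\notin W$ implies $|\bar w|_{W_0}>\sqrt r\,\frac{L_0}{2N}$. $M:\mathbb R_{\ge0}\to\mathbb R_{>0}$ is a fixed nondecreasing function with $M(0)=1$ such that for any two solutions $w_1,w_2$ of $\dot w=s(w)$ with $w_1(0),w_2(0)\in W$, $|w_1(t)-w_2(t)|\le M(t)|w_1(0)-w_2(0)|$ for all $t\ge0$. **Encoder–decoder.** Encoder and decoder have the same state $w_{\rm d}=w_{\rm e}$, with $w_{\rm d}(0^-)\in W_0$. Between sampling times, $\dot w_{\rm d}=s(w_{\rm d})$; at each $jT$, $j=0,1,2,\dots$, $w_{\rm d}$ is reset by $w_{\rm d}(jT)=w_{\rm d}(jT^-)+w_{\rm q}(j)L(j)/N$, where $L(0)=L_0$, $L(j+1)=\sqrt r\,\frac{M(T)}{N}L(j)$, and for $i=1,\dots,r$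 \[ w_{{\rm q},i}(j)=\mathrm{sgn}\big(w_i(jT)-w_{{\rm d},i}(jT^-)\big)\cdot \begin{cases}\left\lceil \frac{N|w_i(jT)-w_{{\rm d},i}(jT^-)|}{L(j)}\right\rceil-\frac12,& N\text{ even},\\[1mm] \left\lceil \frac{N|w_i(jT)-w_{{\rm d},i}(jT^-)|}{L(j)}-\frac12\right\rceil,& N\text{ odd}.\end{cases} \] The variables $z,y,\xi$ are continuous in time. **Plant.** $\dot z=f(z,y,\mu)$, $z\in\mathbb R^n$; $\dot y=q(z,y,\mu)+u$, $y\in\mathbb R$; $\mu$ is a constant unknown parameter vector in a compact set $P$. $Z\subset\mathbb R^n$ and $Y\subset\mathbb R$ are compact sets of initial conditions. The functions $f,q,s,y_{\rm r}$ are differentiable sufficiently many times for the map $\tau$ below to be well defined and $C^1$. **Zero-error system.** Let ${\bf z}=(\mu,w,z)$ and write $\dot{\bf z}={\bf f}_0({\bf z})$ for the system $\dot\mu=0$, $\dot w=s(w)$, $\dot z=f(z,y_{\rm r}(w),\mu)$ on $P\times W\times\mathbb R^n$. Let ${\bf q}_0({\bf z})=L_sy_{\rm r}(w)-q(z,y_{\rm r}(w),\mu)$, where $L_sy_{\rm r}$ is the derivative of $y_{\rm r}$ along $s$. Let ${\bf Z}=P\times W\times Z$. The $\omega$-limit set $\omega(X)$ of a set $X$ is the set of all limits of sequences $\phi(t_i,x_i)$ with $x_i\in X$, $t_i\to\infty$, $\phi$ being the flow. (A2) There is a compact subset of $P\times W\times\mathbb R^n$ containing the positive orbit of ${\bf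 Z}$ under $\dot{\bf z}={\bf f}_0({\bf z})$, and $\mathcal A_0:=\omega({\bf Z})$ is a differentiable submanifold (with boundary) of $P\times W\times\mathbb R^n$. There is $d_1>0$ such that ${\bf z}\in P\times W\times\mathbb R^n$, $|{\bf z}|_{\mathcal A_0}\le d_1$ imply ${\bf z}\in{\bf Z}$. There are $m\ge1$, $a>0$, $0<d_2\le d_1$ such that every solution with ${\bf z}(0)\in P\times W\times\mathbb R^n$, $|{\bf z}(0)|_{\mathcal A_0}\le d_2$ satisfies $|{\bf z}(t)|_{\mathcal A_0}\le me^{-at}|{\bf z}(0)|_{\mathcal A_0}$ for $t\ge0$. (A3) There are an integer $d>0$ and a locally Lipschitz $\varphi:\mathbb R^d\to\mathbb R$ such that, for every solution ${\bf z}(t)$ of $\dot{\bf z}={\bf f}_0({\bf z})$ with ${\bf z}(0)\in\mathcal A_0$, the function $u(t)={\bf q}_0({\bf z}(t))$ satisfies $u^{(d)}(t)+\varphi(u(t),u^{(1)}(t),\dots,u^{(d-1)}(t))=0$. **Regulator.** Let $\tau_1={\bf q}_0$, $\tau_{i+1}=\frac{\partial\tau_i}{\partial{\bf z}}{\bf f}_0$ for $i=1,\dots,d-1$, and $\tau=(\tau_1,\dots,\tau_d)$. Let $\varphi_{\rm c}:\mathbb R^d\to\mathbb R$ be any locally Lipschitz function with compact support that agrees with $\varphi$ on $\tau(\mathcal A_0)$. Set $\Phi_{\rm c}(\xi)=(\xi_2,\dots,\xi_d,-\varphi_{\rm c}(\xi_1,\dots,\xi_d))^{\rm T}$, $G=(\kappa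 c_{d-1},\kappa^2c_{d-2},\dots,\kappa^dc_0)^{\rm T}$, $\Gamma=(1,0,\dots,0)$, where $c_0,\dots,c_{d-1}$ are fixed with $\lambda^d+c_{d-1}\lambda^{d-1}+\dots+c_0$ Hurwitz. The control is $u=\Gamma\xi-k(y-y_{\rm r}(w_{\rm d}))$. $\Xi\subset\mathbb R^d$ is a given, arbitrarily large, compact set of initial conditions for $\xi$. *)

(* Defs.v *)
(* Vectors of R^n are row vectors 'rV[R]_n. *)
From HB Require Import structures.
From mathcomp Require Import all_boot all_order all_algebra.
From mathcomp Require Import complex.
From mathcomp Require Import all_classical all_reals all_analysis.

Set Implicit Arguments.
Unset Strict Implicit.
Unset Printing Implicit Defensive.
Import Order.TTheory GRing.Theory Num.Theory.
Import numFieldNormedType.Exports.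
Local Open Scope classical_set_scope.
Local Open Scope ring_scope.

(* The library norm `|x| on 'rV[R]_n is the sup norm. *)
Definition enorm (R : realType) (n : nat) (x : 'rV[R]_n) : R :=
  Num.sqrt (\sum_(i < n) x ord0 i ^+ 2).

(* The infimum is attained when S is compact and nonempty. *)
Definition edist (R : realType) (n : nat) (S : set 'rV[R]_n) (x : 'rV[R]_n) : R :=
  inf [set enorm (x - y) | y in S].

Definition locally_lipschitz (R : realType) (U V : normedModType R)
    (F : U -> V) : Prop :=
  forall x : U, exists (A : set U) (k : R), nbhs x A /\ k.-lipschitz_A F.

(* In finite dimension, continuity of x |-> 'd F x for every fixed direction is
   continuity of the differential. *)
Definition C1_on (R : realType) (U V : normedModType R)
    (A : set U) (F : U -> V) : Prop :=
  forall x, A x -> differentiable F x /\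
    forall v : U, {for x, continuous (fun x' => 'd F x' v)}.

Definition C1 (R : realType) (U V : normedModType R) (F : U -> V) : Prop :=
  C1_on setT F.

Definition upto (R : realType) (b : \bar R) : set R :=
  [set t | 0 <= t /\ (t%:E < b)%E].

(* Solution of x' = F(x) on [0, b[.  When F is continuous this includes the
   one-sided derivative at 0. *)
Definition solution (R : realType) (V : normedModType R)
    (F : V -> V) (b : \bar R) (x : R -> V) : Prop :=
  {within upto b, continuous x} /\
  (forall t : R, 0 < t -> (t%:E < b)%E -> is_derive t (1 : R) x (F (x t))).

(* Invariance in both time directions.  When F is locally Lipschitz, x is the
   solution through x0. *)
Definition invariant_set (R : realType) (V : normedModType R)
    (F : V -> V) (S : set V) : Prop :=
  forall x0, S x0 -> exists x : R -> V, [/\ x 0 = x0,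
    (forall t : R, is_derive t (1 : R) x (F (x t))) & (forall t, S (x t))].

Definition omega_limit (R : realType) (V : normedModType R)
    (F : V -> V) (X : set V) : set V :=
  [set p | exists (x : nat -> R -> V) (t : nat -> R),
    [/\ (forall i, solution F +oo%E (x i) /\ X (x i 0)),
        (forall i, 0 <= t i),
        t i @[i --> \oo] --> +oo &
        x i (t i) @[i --> \oo] --> p]].

(* The half space v_0 >= 0 of R^k x {0} in R^dimV; for k = 0 it is {0}. *)
Definition half_space (R : realType) (dimV k : nat) : set 'rV[R]_dimV :=
  [set v | forall i : 'I_dimV,
    ((k <= i)%N -> v ord0 i = 0) /\ ((i : nat) = 0%N -> 0 <= v ord0 i)].

(* Embedded submanifold, where dimV is the dimension of V: h is a local
   diffeomorphism straightening S, with inverse g. *)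
Definition C1_submanifold_with_boundary (R : realType) (V : normedModType R)
    (dimV : nat) (S : set V) : Prop :=
  exists2 k : nat, (k <= dimV)%N &
  forall x, S x -> exists (A : set V) (B : set 'rV[R]_dimV)
                          (h : V -> 'rV[R]_dimV) (g : 'rV[R]_dimV -> V),
    [/\ open A /\ A x, open B, C1_on A h /\ C1_on B g,
        (forall a, A a -> B (h a) /\ g (h a) = a) /\
        (forall v, B v -> A (g v) /\ h (g v) = v) &
        forall a, A a -> (S a <-> half_space k (h a))].

(* up_log 2 N is the ceiling of log_2 N. *)
Definition channel_levels (r Nb N : nat) : Prop :=
  [/\ (0 < N)%N, (r * up_log 2 N <= Nb)%N &
      forall N' : nat, (0 < N')%N -> (r * up_log 2 N' <= Nb)%N -> (N' <= N)%N].

(* The supremum is a maximum when W0 is compact and nonempty (and r > 0). *)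
Definition initial_range (R : realType) (r : nat) (W0 : set 'rV[R]_r) : R :=
  sup [set l | exists (i : 'I_r) (x y : 'rV[R]_r),
         [/\ W0 x, W0 y & l = `|x ord0 i - y ord0 i|]].

Fixpoint chan_range (R : realType) (r N : nat) (MT L0 : R) (j : nat) : R :=
  if j is j'.+1 then Num.sqrt r%:R * (MT / N%:R) * chan_range r N MT L0 j' else L0.

Definition quantize (R : realType) (N : nat) (l e : R) : R :=
  Num.sg e * (if odd N then (Num.ceil (N%:R * `|e| / l - 1 / 2))%:~R
              else (Num.ceil (N%:R * `|e| / l))%:~R - 1 / 2).

Definition zstate (R : realType) (p r n : nat) : normedModType R :=
  ('rV[R]_p * 'rV[R]_r * 'rV[R]_n)%type.

(* The library norm on a product is the maximum of the norms; the Euclidean norm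
   on R^p x R^r x R^n is that of the concatenated vector. *)
Definition stack (R : realType) (p r n : nat) (x : zstate R p r n) :
    'rV[R]_(p + r + n) := row_mx (row_mx x.1.1 x.1.2) x.2.

Definition xdist (R : realType) (p r n : nat)
    (S : set (zstate R p r n)) (x : zstate R p r n) : R :=
  edist (@stack R p r n @` S) (stack x).

Definition zero_field (R : realType) (p r n : nat)
    (s : 'rV[R]_r -> 'rV[R]_r) (yr : 'rV[R]_r -> R)
    (f : 'rV[R]_n -> R -> 'rV[R]_p -> 'rV[R]_n)
    (x : zstate R p r n) : zstate R p r n :=
  let: (mu, w, z) := x in (0, s w, f z (yr w) mu).

Definition zero_input (R : realType) (p r n : nat)
    (s : 'rV[R]_r -> 'rV[R]_r) (yr : 'rV[R]_r -> R)
    (q : 'rV[R]_n -> R -> 'rV[R]_p -> R)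
    (x : zstate R p r n) : R :=
  let: (mu, w, z) := x in 'd yr w (s w) - q z (yr w) mu.

(* tau_comp i is the component number i + 1 of tau. *)
Fixpoint tau_comp (R : realType) (p r n : nat)
    (s : 'rV[R]_r -> 'rV[R]_r) (yr : 'rV[R]_r -> R)
    (f : 'rV[R]_n -> R -> 'rV[R]_p -> 'rV[R]_n)
    (q : 'rV[R]_n -> R -> 'rV[R]_p -> R)
    (i : nat) : zstate R p r n -> R :=
  if i is i'.+1 then fun x => 'd (tau_comp s yr f q i') x (zero_field s yr f x)
  else zero_input s yr q.

Definition tau (R : realType) (p r n d : nat)
    (s : 'rV[R]_r -> 'rV[R]_r) (yr : 'rV[R]_r -> R)
    (f : 'rV[R]_n -> R -> 'rV[R]_p -> 'rV[R]_n)
    (q : 'rV[R]_n -> R -> 'rV[R]_p -> R) (x : zstate R p r n) : 'rV[R]_d :=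
  \row_(i < d) tau_comp s yr f q i x.

Definition assumption_A0 (R : realType) (r : nat)
    (s : 'rV[R]_r -> 'rV[R]_r) (W0 : set 'rV[R]_r) : Prop :=
  [/\ locally_lipschitz s, compact W0 & invariant_set s W0].

Definition assumption_A1 (R : realType) (r : nat)
    (s : 'rV[R]_r -> 'rV[R]_r) (W0 W : set 'rV[R]_r) (N : nat) : Prop :=
  [/\ compact W, W0 `<=` W, invariant_set s W &
      forall w, ~ W w ->
        Num.sqrt r%:R * (initial_range W0 / (2 * N%:R)) < edist W0 w].

Definition divergence_bound (R : realType) (r : nat)
    (s : 'rV[R]_r -> 'rV[R]_r) (W : set 'rV[R]_r) (M : R -> R) : Prop :=
  [/\ (forall t, 0 <= t -> 0 < M t),
      (forall t t', 0 <= t -> t <= t' -> M t <= M t'),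
      M 0 = 1 &
      forall w1 w2, solution s +oo%E w1 -> solution s +oo%E w2 ->
        W (w1 0) -> W (w2 0) -> forall t, 0 <= t ->
        enorm (w1 t - w2 t) <= M t * enorm (w1 0 - w2 0)].

Definition assumption_A2 (R : realType) (p r n : nat)
    (s : 'rV[R]_r -> 'rV[R]_r) (yr : 'rV[R]_r -> R)
    (f : 'rV[R]_n -> R -> 'rV[R]_p -> 'rV[R]_n)
    (P : set 'rV[R]_p) (W : set 'rV[R]_r) (Z : set 'rV[R]_n) : Prop :=
  let f0 : zstate R p r n -> zstate R p r n := zero_field s yr f in
  let states : set (zstate R p r n) := P `*` W `*` setT in
  let Z0 : set (zstate R p r n) := P `*` W `*` Z in
  let A0 := omega_limit f0 Z0 in
  [/\ exists C, [/\ compact C, C `<=` states &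
        forall x0, Z0 x0 -> exists x, [/\ solution f0 +oo%E x, x 0 = x0 &
          forall t, 0 <= t -> C (x t)]],
      C1_submanifold_with_boundary (p + r + n) A0 /\ A0 `<=` states &
      exists2 d1 : R, 0 < d1 &
        (forall x, states x -> xdist A0 x <= d1 -> Z0 x) /\
        exists m a d2 : R, [/\ 1 <= m, 0 < a, 0 < d2 /\ d2 <= d1 &
          forall x, solution f0 +oo%E x -> states (x 0) ->
            xdist A0 (x 0) <= d2 -> forall t, 0 <= t ->
            xdist A0 (x t) <= m * expR (- a * t) * xdist A0 (x 0)]].

(* Solutions are only given on [0, +oo[, hence t > 0 for the two-sided
   derivatives u^(i)(t). *)
Definition assumption_A3 (R : realType) (p r n d : nat)
    (s : 'rV[R]_r -> 'rV[R]_r) (yr : 'rV[R]_r -> R)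
    (f : 'rV[R]_n -> R -> 'rV[R]_p -> 'rV[R]_n)
    (q : 'rV[R]_n -> R -> 'rV[R]_p -> R)
    (A0 : set (zstate R p r n)) (phi : 'rV[R]_d -> R) : Prop :=
  [/\ (0 < d)%N, locally_lipschitz phi &
      forall x, solution (zero_field s yr f : zstate R p r n -> _) +oo%E x ->
        A0 (x 0) ->
        let u : R -> R := fun t => zero_input s yr q (x t) in
        forall t, 0 < t -> derive1n d u t + phi (\row_(i < d) derive1n i u t) = 0].

Definition compact_support (R : realType) (V : normedModType R)
    (F : V -> R) : Prop :=
  compact (closure [set x | F x <> 0]).

Definition Hurwitz (R : realType) (pol : {poly R}) : Prop :=
  forall l : complex R,
    root (map_poly (real_complex R) pol) l -> complex.Re l < 0.

Definition char_poly_of (R : realType) (d : nat) (c : 'I_d -> R) : {poly R} :=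
  'X^d + \sum_(i < d) c i *: 'X^i.

(* With indices starting from 0: the last component is - phic(xi). *)
Definition PhiC (R : realType) (d : nat) (phic : 'rV[R]_d -> R)
    (xi : 'rV[R]_d) : 'rV[R]_d :=
  \row_(i < d) (if insub i.+1 is Some j then xi ord0 j else - phic xi).

Definition gainG (R : realType) (d : nat) (c : 'I_d -> R) (kappa : R) :
    'rV[R]_d := \row_(i < d) (kappa ^+ i.+1 * c (rev_ord i)).

Definition Gamma (R : realType) (d : nat) : 'rV[R]_d :=
  \row_(i < d) ((i : nat) == 0%N)%:R.

(* wdm j is the left limit w_d(jT^-); in particular wdm 0 is the initial
   condition w_d(0^-). *)
Record signals (R : realType) (r n d : nat) := Signals {
  w_ : R -> 'rV[R]_r ;
  wd_ : R -> 'rV[R]_r ;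
  wdm_ : nat -> 'rV[R]_r ;
  z_ : R -> 'rV[R]_n ;
  y_ : R -> R ;
  xi_ : R -> 'rV[R]_d }.

(* Trajectory on [0, b[ with sampling interval T and parameter mu; lev j is
   the range L(j). *)
Record trajectory (R : realType) (p r n d : nat)
    (s : 'rV[R]_r -> 'rV[R]_r) (yr : 'rV[R]_r -> R)
    (f : 'rV[R]_n -> R -> 'rV[R]_p -> 'rV[R]_n)
    (q : 'rV[R]_n -> R -> 'rV[R]_p -> R)
    (phic : 'rV[R]_d -> R) (c : 'I_d -> R)
    (N : nat) (lev : nat -> R) (T kappa k : R)
    (mu : 'rV[R]_p) (b : \bar R) (X : signals R r n d) : Prop := Trajectory {
  traj_dom : (0 < b)%E ;
  traj_w : solution s b (w_ X) ;
  traj_wd_left : forall j : nat, (0 < j)%N -> ((j%:R * T)%:E < b)%E ->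
    wd_ X t @[t --> (j%:R * T)^'-] --> wdm_ X j ;
  traj_wd_reset : forall j : nat, ((j%:R * T)%:E < b)%E ->
    wd_ X (j%:R * T) = wdm_ X j + (lev j / N%:R) *:
      \row_(i < r) quantize N (lev j)
                     (w_ X (j%:R * T) ord0 i - wdm_ X j ord0 i) ;
  traj_wd_right : forall j : nat, ((j%:R * T)%:E < b)%E ->
    wd_ X t @[t --> (j%:R * T)^'+] --> wd_ X (j%:R * T) ;
  traj_cont : [/\ {within upto b, continuous (z_ X)},
                  {within upto b, continuous (y_ X)} &
                  {within upto b, continuous (xi_ X)}] ;
  traj_flow : forall t : R, 0 < t -> (t%:E < b)%E ->
    (forall j : nat, t <> j%:R * T) ->
    [/\ is_derive t (1 : R) (wd_ X) (s (wd_ X t)),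
        is_derive t (1 : R) (z_ X) (f (z_ X t) (y_ X t) mu),
        is_derive t (1 : R) (y_ X)
          (q (z_ X t) (y_ X t) mu + (Gamma R d *m (xi_ X t)^T) ord0 ord0
             - k * (y_ X t - yr (wd_ X t))) &
        is_derive t (1 : R) (xi_ X)
          (PhiC phic (xi_ X t)
             - (k * (y_ X t - yr (wd_ X t))) *: gainG c kappa)] }.

Definition starts_in (R : realType) (r n d : nat) (W0 : set 'rV[R]_r)
    (Z : set 'rV[R]_n) (Y : set R) (Xi : set 'rV[R]_d)
    (X : signals R r n d) : Prop :=
  [/\ W0 (w_ X 0), W0 (wdm_ X 0%N), Z (z_ X 0), Y (y_ X 0) & Xi (xi_ X 0)].

Definition bounded_upto (R : realType) (r n d : nat) (b : \bar R)
    (X : signals R r n d) : Prop :=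
  exists B : R, forall t, upto b t ->
    [/\ enorm (w_ X t) <= B, enorm (wd_ X t) <= B, enorm (z_ X t) <= B,
        `|y_ X t| <= B & enorm (xi_ X t) <= B].

Definition agree_upto (R : realType) (r n d : nat) (b : \bar R)
    (X X' : signals R r n d) : Prop :=
  wdm_ X' 0%N = wdm_ X 0%N /\
  forall t, upto b t ->
    [/\ w_ X' t = w_ X t, wd_ X' t = wd_ X t, z_ X' t = z_ X t,
        y_ X' t = y_ X t & xi_ X' t = xi_ X t].

Definition maximal_traj (R : realType) (r n d : nat)
    (traj : \bar R -> signals R r n d -> Prop)
    (b : \bar R) (X : signals R r n d) : Prop :=
  traj b X /\
  forall b' X', traj b' X' -> agree_upto b X X' -> (b' <= b)%E.

(* Main.v *)
(* Between samples w_d is an exact solution of the exosystem staying in W, so with the tracking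
   error e = y - yr(w_d) the loop behaves like a continuous-time regulator driven by w_d.  The
   e-equation is e' = - k e + (bounded terms).  The variable eta = xi - e G satisfies
   eta' = eta F + (bounded terms) with F Hurwitz, because phic is bounded; hence eta has an
   ultimate bound independent of its initial value and of k.  For k large, e is small in the
   mean and z is compared, over windows of fixed length, with the zero-error flow having the same
   w_d; that flow enters a neighbourhood of the omega-limit set A0 contained in P x W x Z.
   Thus, if T exceeds a fixed time, at the next sample z is again in Z whatever the jump of w_d
   inside W, and y, xi are again in their initial bounds, so one argues by induction on the samples.
   Completeness of trajectories follows from the bounds and Picard's theorem. *)
Require Import Defs.
From HB Require Import structures.
From mathcomp Require Import all_boot all_order all_algebra.
From mathcomp Require Import complex.
From mathcomp Require Import all_classical all_reals all_analysis.
From mathcomp Require Import ring lra.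
Set Implicit Arguments.
Unset Strict Implicit.
Unset Printing Implicit Defensive.
Import Order.TTheory GRing.Theory Num.Theory.
Import numFieldNormedType.Exports.
Local Open Scope classical_set_scope.
Local Open Scope ring_scope.

(** * Differential inequalities and uniqueness of solutions *)

(** The estimates are circular: the forcing of e is bounded only while z and xi are, z follows the
    zero-error flow only while e is controlled, and the gain must dominate constants depending on
    all of these. The circle is cut by a bootstrap on an open set of states and by the order of the
    constants. The bound required of y at samples comes from yr on W. The ultimate bound on eta uses
    only the bounds on phic, on z and on e, so it is known before the radius allowed for xi at
    samples, which is then taken large enough to contain it. This radius determines the time Ts
    needed to return, and the gain comes last; it depends on Ts but not on the length of the
    sampling interval, so longer intervals cost nothing. Once the encoder is analysed, all that is
    used of w_d is that it follows the exosystem inside W: since the attracted set is the product P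
    x W x Z, a jump of w_d inside W leaves (mu, w_d, z) in it as soon as z is in Z. *)

Section Calculus.
Variable R : realType.

(** At the infimum of the counterexamples, [Q] holds strictly below, hence at the point by the limit
    step, hence slightly beyond it, which contradicts the infimum. All continuation arguments,
    including the bootstrap, go through this principle. *)
Lemma real_induction (a c : R) (Q : R -> Prop) :
  Q a ->
  (forall t, a < t -> t <= c -> (forall s, a <= s -> s < t -> Q s) -> Q t) ->
  (forall t, a <= t -> t < c -> Q t ->
     exists2 e, 0 < e & forall s, t < s -> s < t + e -> s <= c -> Q s) ->
  forall t, a <= t -> t <= c -> Q t.
Proof.
move=> Qa Qlim Qstep t0 at0 t0c; apply: contrapT => nQ.
pose E := [set t | [/\ a <= t, t <= c & ~ Q t]].
have Et0 : E t0 by [].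
have lbE : lbound E a by move=> t [].
have hE : has_inf E by split; [exists t0 | exists a].
pose m := inf E.
have am : a <= m by apply: lb_le_inf => //; exists t0.
have mt0 : m <= t0 by apply: ge_inf => //; exists a.
have mc : m <= c by apply: le_trans t0c.
have below s : a <= s -> s < m -> Q s.
  move=> as_ sm; apply: contrapT => nQs.
  have : m <= s by apply: ge_inf; [exists a | split=> //; apply: (ltW (lt_le_trans sm mc))].
  by rewrite leNgt sm.
have Qm : Q m.
  have [am'|] := ltP a m; first exact: Qlim.
  by move=> ma; have -> : m = a by apply/eqP; rewrite eq_le am ma.
have mt0' : m < t0.
  by rewrite lt_neqAle mt0 andbT; apply/negP => /eqP mE; apply: nQ; rewrite -mE.
have [e e0 He] := Qstep m am (lt_le_trans mt0' t0c) Qm.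
have : m + e <= m.
  apply: lb_le_inf; first by exists t0.
  move=> t [at_ tc nQt]; rewrite leNgt; apply/negP => tme; apply: nQt.
  have [tm|mt] := ltP t m; first exact: below.
  have [mt'|tm] := ltP m t; first exact: He.
  by have -> : t = m by apply/eqP; rewrite eq_le tm mt.
by rewrite leNgt ltrDl e0.
Qed.

(** Free of division and valid at [h = 0], this form transports derivatives to pairs, coordinates
    and translates by a mere comparison of norms. *)
Lemma is_deriveP (V : normedModType R) (g : R -> V) (t : R) (l : V) :
  is_derive t (1 : R) g l <->
  forall e, 0 < e -> exists2 d, 0 < d & forall h, `|h| < d ->
    `|g (t + h) - g t - h *: l| <= e * `|h|.
Proof.
split=> [[dg gl] e e0|H].
  have : h^-1 *: (g (h *: 1 + t) - g t) @[h --> (0:R)^'] --> l.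
    by move: dg; rewrite /derivable => /cvg_ex [l' Hl']; move: gl; rewrite /derive (cvg_lim _ Hl')// => <-.
  move=> /cvgrPdist_le /(_ _ e0); rewrite /= => /nbhs_ballP [d d0 Hd].
  exists d => // h hd; have [->|h0] := eqVneq h 0.
    by rewrite addr0 subrr scale0r subr0 !normr0 mulr0.
  have := Hd h; rewrite /ball /= sub0r normrN => /(_ hd h0).
  have -> : g (t + h) - g t - h *: l = - (h *: (l - h^-1 *: (g (h *: 1 + t) - g t))).
    rewrite scalerBr scalerA mulfV// scale1r opprB.
    by rewrite [h *: 1]mulr1 [h + t]addrC.
  by rewrite normrN normrZ mulrC ler_pM2r// normr_gt0.
have C : h^-1 *: (g (h *: 1 + t) - g t) @[h --> (0:R)^'] --> l.
  apply/cvgrPdist_le => e e0; have [d d0 Hd] := H e e0.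
  apply/nbhs_ballP; exists d => // h; rewrite /ball /= sub0r normrN => hd h0.
  have := Hd h hd.
  have -> : g (t + h) - g t - h *: l = - (h *: (l - h^-1 *: (g (h *: 1 + t) - g t))).
    rewrite scalerBr scalerA mulfV// scale1r opprB.
    by rewrite [h *: 1]mulr1 [h + t]addrC.
  by rewrite normrN normrZ mulrC ler_pM2r// normr_gt0.
split; first by apply/cvg_ex; exists l.
exact: cvg_lim.
Qed.

Lemma is_derive_cont (V : normedModType R) (g : R -> V) (t : R) (l : V) :
  is_derive t (1 : R) g l -> {for t, continuous g}.
Proof. by move=> [dg _]; apply: differentiable_continuous; apply/derivable1_diffP. Qed.

Lemma is_derive_dcomp (U V : normedModType R) (x : R -> U) (F : U -> V) t dx :
  is_derive t (1 : R) x dx -> differentiable F (x t) ->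
  is_derive t (1 : R) (F \o x) ('d F (x t) dx).
Proof.
move=> [dx1 vx] dF; have dxd : differentiable x t by apply/derivable1_diffP.
have dc : differentiable (F \o x) t by apply: differentiable_comp.
split; first by apply/derivable1_diffP.
by rewrite deriveE// diff_comp//= -vx deriveE.
Qed.

Lemma is_derive_ext (V : normedModType R) (f g : R -> V) (t : R) (l : V) :
  (\forall s \near t, f s = g s) -> is_derive t (1 : R) f l -> is_derive t (1 : R) g l.
Proof.
move=> fg /is_deriveP H; apply/is_deriveP => e e0; have [d d0 Hd] := H e e0.
have gt := nbhs_singleton fg.
have /nbhs_ballP [d' d'0 Hd'] := fg.
exists (Num.min d d'); first by rewrite lt_min d0 d'0.
move=> h; rewrite lt_min => /andP[hd hd'].
have := Hd' (t + h); rewrite /ball /= opprD addrA subrr add0r normrN => /(_ hd') <-.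
by rewrite -gt Hd.
Qed.

Lemma is_derive_shiftl (V : normedModType R) (f : R -> V) (t a : R) (l : V) :
  is_derive (t - a) (1 : R) f l -> is_derive t (1 : R) (fun s => f (s - a)) l.
Proof.
move=> /is_deriveP H; apply/is_deriveP => e e0; have [d d0 Hd] := H e e0.
by exists d => // h hd; rewrite (addrAC t); exact: Hd.
Qed.

Lemma is_derive_lin (U V : normedModType R) (x : R -> U) (F : {linear U -> V}) t dx :
  continuous F -> is_derive t (1 : R) x dx -> is_derive t (1 : R) (fun s => F (x s)) (F dx).
Proof.
move=> cF hx; have := is_derive_dcomp hx (linear_differentiable (x t) cF).
by rewrite diff_lin.
Qed.

Lemma is_derive_fst (U V : normedModType R) (x : R -> U * V) t dx :
  is_derive t (1 : R) x dx -> is_derive t (1 : R) (fun s => (x s).1) dx.1.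
Proof.
move=> /is_deriveP H; apply/is_deriveP => e e0; have [d d0 Hd] := H e e0.
exists d => // h hd; apply: le_trans (Hd h hd).
by rewrite [leRHS]prod_normE /= le_max lexx.
Qed.

Lemma is_derive_snd (U V : normedModType R) (x : R -> U * V) t dx :
  is_derive t (1 : R) x dx -> is_derive t (1 : R) (fun s => (x s).2) dx.2.
Proof.
move=> /is_deriveP H; apply/is_deriveP => e e0; have [d d0 Hd] := H e e0.
exists d => // h hd; apply: le_trans (Hd h hd).
by rewrite [leRHS]prod_normE /= le_max lexx orbT.
Qed.

Lemma is_derive_pr (U V : normedModType R) (x : R -> U) (y : R -> V) t dx dy :
  is_derive t (1 : R) x dx -> is_derive t (1 : R) y dy ->
  is_derive t (1 : R) (fun s => (x s, y s)) (dx, dy).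
Proof.
move=> /is_deriveP H /is_deriveP K; apply/is_deriveP => e e0.
have [d d0 Hd] := H e e0; have [d' d'0 Hd'] := K e e0.
exists (Num.min d d'); first by rewrite lt_min d0 d'0.
move=> h; rewrite lt_min => /andP[hd hd'].
by rewrite prod_normE /= ge_max Hd// Hd'.
Qed.

Lemma norm_rV_le n (v : 'rV[R]_n) (C : R) :
  0 <= C -> (forall i, `|v ord0 i| <= C) -> `|v| <= C.
Proof.
move=> C0 H; rewrite /Num.Def.normr /= mx_normrE; apply: bigmax_le => // -[i j] _ /=.
by rewrite (ord1 i).
Qed.

Lemma norm_rV_coord n (v : 'rV[R]_n) i : `|v ord0 i| <= `|v|.
Proof.
by rewrite {2}/Num.Def.normr /= mx_normrE (le_bigmax _ (fun ij => `|v ij.1 ij.2|) (ord0, i)).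
Qed.

Lemma is_derive_coord n (x : R -> 'rV[R]_n) t dx i :
  is_derive t (1 : R) x dx -> is_derive t (1 : R) (fun s => x s ord0 i) (dx ord0 i).
Proof.
move=> /is_deriveP H; apply/is_deriveP => e e0; have [d d0 Hd] := H e e0.
exists d => // h hd; apply: le_trans (Hd h hd).
by apply: le_trans (norm_rV_coord _ i); rewrite !mxE.
Qed.

Lemma is_derive_row n (x : R -> 'rV[R]_n) t (dx : 'rV[R]_n) :
  (forall i, is_derive t (1 : R) (fun s => x s ord0 i) (dx ord0 i)) ->
  is_derive t (1 : R) x dx.
Proof.
move=> H.
have D : derivable x t 1.
  by apply/derivable_mxP => i j; rewrite (ord1 i); apply: ex_derive.
split => //; rewrite derive_mx//; apply/rowP => j; rewrite mxE.
exact: derive_val.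
Qed.


Lemma within_cont_at (V : normedModType R) (g : R -> V) (a b t : R) :
  {within `[a, b], continuous g} -> a <= t -> t <= b ->
  forall e, 0 < e -> exists2 d, 0 < d & forall s, a <= s -> s <= b -> `|s - t| < d ->
    `|g s - g t| < e.
Proof.
move=> cg at_ tb e e0.
have /subspace_continuousP/(_ t) := cg.
rewrite /= in_itv /= at_ tb => /(_ isT) /cvgrPdist_lt /(_ _ e0) /nbhs_ballP [d d0 Hd].
exists d => // s as_ sb st; rewrite distrC; apply: Hd.
  by rewrite /ball /= distrC.
by rewrite /= in_itv /= as_ sb.
Qed.

Lemma within_contP (V : normedModType R) (g : R -> V) (a b : R) :
  (forall t, a <= t -> t <= b -> forall e, 0 < e -> exists2 d, 0 < d &
     forall s, a <= s -> s <= b -> `|s - t| < d -> `|g s - g t| < e) ->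
  {within `[a, b], continuous g}.
Proof.
move=> H; apply/subspace_continuousP => t; rewrite /= in_itv /= => /andP[at_ tb].
apply/cvgrPdist_lt => e e0; have [d d0 Hd] := H t at_ tb e e0.
apply/nbhs_ballP; exists d => // s; rewrite /ball /= => st.
rewrite in_itv /= => /andP[as_ sb]; rewrite distrC; apply: Hd => //.
by rewrite distrC.
Qed.

Lemma within_sub (V : normedModType R) (g : R -> V) (a b a' b' : R) :
  {within `[a, b], continuous g} -> a <= a' -> b' <= b -> {within `[a', b'], continuous g}.
Proof.
move=> cg aa bb; apply: continuous_subspaceW cg => t /=.
by rewrite !in_itv /= => /andP[at_ tb]; rewrite (le_trans aa at_) (le_trans tb bb).
Qed.

(** Vector values admit no intermediate point. The slope [C] is relaxed to [C + e1], and the relaxed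
    bound propagates by [real_induction]. Since the derivative is given only inside the interval,
    [key] treats inner subintervals and continuity then reaches the endpoints. *)
Lemma mvt_norm (V : normedModType R) (g dg : R -> V) (a b C : R) :
  a <= b -> {within `[a, b], continuous g} ->
  (forall t, a < t -> t < b -> is_derive t (1 : R) g (dg t) /\ `|dg t| <= C) ->
  `|g b - g a| <= C * (b - a).
Proof.
move=> ab cg H.
have key a' b' : a < a' -> a' <= b' -> b' < b -> `|g b' - g a'| <= C * (b' - a').
  move=> aa' ab' bb'; apply/ler_addgt0Pr => e e0.
  pose e1 := e / (b' - a' + 1).
  have p0 : 0 < b' - a' + 1 by rewrite ltr_wpDl// subr_ge0.
  have e10 : 0 < e1 by rewrite divr_gt0.
  suff S t : a' <= t -> t <= b' -> `|g t - g a'| <= (C + e1) * (t - a').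
    apply: le_trans (S b' ab' (lexx _)) _; rewrite mulrDl lerD2l /e1 mulrAC.
    by rewrite ler_pdivrMr// ler_pM2l// lerDl.
  move: t; apply: real_induction; first by rewrite !subrr normr0 mulr0.
  - move=> t at_ tb Hs; apply/ler_addgt0Pr => e2 e20.
    have [d d0 Hd] := within_cont_at cg (ltW (lt_trans aa' at_)) (ltW (le_lt_trans tb bb')) (divr_gt0 e20 (ltr0Sn _ 1)).
    pose D := `|C + e1| + 1; have D0 : 0 < D by rewrite ltr_wpDl.
    pose m := Num.min (Num.min (t - a') (d / 2)) (e2 / 2 / D).
    have m0 : 0 < m by rewrite !lt_min subr_gt0 at_ !divr_gt0.
    have mt : m <= t - a' by rewrite !ge_min lexx.
    have md : m < d by rewrite (@le_lt_trans _ _ (d/2)) ?ge_min ?lexx ?orbT//; lra.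
    have me : m * D <= e2 / 2 by rewrite -ler_pdivlMr// ge_min lexx orbT.
    have H1 : `|g (t - m) - g t| < e2 / 2.
      by apply: Hd; [lra | lra | rewrite addrAC subrr add0r normrN gtr0_norm].
    have H2 := Hs (t - m) ltac:(lra) ltac:(lra).
    have -> : g t - g a' = (g (t - m) - g a') - (g (t - m) - g t).
      by rewrite opprB [RHS]addrC subrKA.
    apply: le_trans (ler_normB _ _) _.
    have : (C + e1) * (t - m - a') <= (C + e1) * (t - a') + m * D.
      rewrite (_ : t - m - a' = (t - a') - m); last by ring.
      rewrite mulrBr lerD2l -mulrN mulrC; apply: le_trans (ler_norm _) _.
      by rewrite normrM normrN (gtr0_norm m0) ler_pM2l// /D; lra.
    lra.
  - move=> t at_ tb Ht; have [/is_deriveP D dC] := H t (lt_le_trans aa' at_) (lt_trans tb bb').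
    have [d d0 Hd] := D e1 e10; exists d => // s ts sd sb.
    have h0 : 0 < s - t by rewrite subr_gt0.
    have := Hd (s - t); rewrite gtr0_norm// => /(_ ltac:(lra)); rewrite (addrC t) subrK => Hd'.
    have -> : g s - g a' = (g s - g t - (s - t) *: dg t) + ((s - t) *: dg t + (g t - g a')).
      by rewrite !addrA subrK subrK.
    apply: le_trans (ler_normD _ _) _.
    apply: le_trans (lerD Hd' (ler_normD _ _)) _.
    rewrite normrZ gtr0_norm//.
    have := ler_wpM2l (ltW h0) dC; lra.
have [->|ne] := eqVneq a b; first by rewrite !subrr normr0 mulr0.
have lab : a < b by rewrite lt_neqAle ne.
apply/ler_addgt0Pr => e e0.
have [d d0 Hd] := within_cont_at cg (lexx a) ab (divr_gt0 e0 (ltr0Sn _ 3)).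
have [d' d'0 Hd'] := within_cont_at cg ab (lexx b) (divr_gt0 e0 (ltr0Sn _ 3)).
pose D := `|C| + 1; have D0 : 0 < D by rewrite ltr_wpDl.
pose m := Num.min (Num.min ((b - a) / 3) (d / 2)) (Num.min (d' / 2) (e / 4 / D)).
have m0 : 0 < m by rewrite !lt_min !divr_gt0 ?subr_gt0.
have mt : m <= (b - a) / 3 by rewrite !ge_min lexx.
have md : m < d by rewrite (@le_lt_trans _ _ (d/2)) ?ge_min ?lexx ?orbT//; lra.
have md' : m < d' by rewrite (@le_lt_trans _ _ (d'/2)) ?ge_min ?lexx ?orbT//; lra.
have me : m * D <= e / 4 by rewrite -ler_pdivlMr// !ge_min lexx !orbT.
have H1 : `|g (a + m) - g a| < e / 4.
  by apply: Hd; [lra | lra | rewrite addrAC subrr add0r gtr0_norm].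
have H2 : `|g (b - m) - g b| < e / 4.
  by apply: Hd'; [lra | lra | rewrite addrAC subrr add0r normrN gtr0_norm].
have H3 := key (a + m) (b - m) ltac:(lra) ltac:(lra) ltac:(lra).
have -> : g b - g a = (g (b - m) - g (a + m)) + ((g (a + m) - g a) - (g (b - m) - g b)).
  by rewrite opprB [X in _ = _ + X]addrC [RHS]addrCA !subrKA.
apply: le_trans (ler_normD _ _) _.
apply: le_trans (lerD H3 (ler_normB _ _)) _.
have : C * (b - m - (a + m)) <= C * (b - a) + 2 * (m * D).
  rewrite (_ : b - m - (a + m) = (b - a) - 2 * m); last by ring.
  rewrite mulrBr lerD2l -mulrN mulrC; apply: le_trans (ler_norm _) _.
  by rewrite normrM normrN normrM (gtr0_norm m0) gtr0_norm// mulrA ler_pM2l ?mulr_gt0// /D; lra.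
lra.
Qed.

End Calculus.

Section Ode.
Variable R : realType.

(** The shift by [c / la] makes the inequality homogeneous, and the integrating factor makes
    [U + c / la] nonincreasing. Both signs of [la] occur later: negative for decay, positive for
    Gronwall growth. *)
Lemma comparison (U dU : R -> R) (a b la c : R) :
  a <= b -> la != 0 -> {within `[a, b], continuous U} ->
  (forall t, a < t -> t < b -> is_derive t (1 : R) U (dU t) /\ dU t <= la * U t + c) ->
  U b + c / la <= expR (la * (b - a)) * (U a + c / la).
Proof.
move=> ab la0 cU H.
pose E := fun t : R => expR (- la * (t - a)).
have dE t : is_derive t (1 : R) E (E t * - la).
  rewrite /E; apply: is_derive_eq; rewrite /GRing.scale/=; ring.
pose W := E * (U + cst (c / la)).
have dW t : a < t -> t < b -> is_derive t (1 : R) W (E t * (dU t) + (U t + c / la) * (E t * - la)).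
  move=> at_ tb; have [dUt _] := H t at_ tb.
  have := dE t => dEt; rewrite /W; apply: is_derive_eq.
  by rewrite addr0.
have cE : continuous E by move=> t; apply: (is_derive_cont (dE t)).
have cW : {within `[a, b], continuous W}.
  move=> t; apply: continuousM; first by apply: (@continuous_subspaceT _ _ _ _ cE).
  by apply: continuousD; [apply: cU | apply: cst_continuous].
have : W b <= W a.
  have Wd t : t \in `]a, b[ -> derivable W t 1.
    by rewrite in_itv /= => /andP[at_ tb]; have [] := dW t at_ tb.
  have Wd' t : t \in `]a, b[ -> W^`()%classic t <= 0.
    rewrite in_itv /= => /andP[at_ tb]; rewrite derive1E.
    have [_ ->] := dW t at_ tb; have [_ Ht] := H t at_ tb.
    have -> : E t * dU t + (U t + c / la) * (E t * - la) = E t * (dU t - (la * U t + c)) by field.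
    by rewrite pmulr_rle0 ?expR_gt0// subr_le0.
  by apply: (ler0_derive1_le_cc Wd Wd' cW); rewrite // in_itv /= lexx ab.
rewrite /W /E !fctE subrr mulr0 expR0 mul1r mulNr expRN => Hle.
by rewrite -ler_pdivrMl ?expR_gt0.
Qed.


Lemma loclipP (U V : normedModType R) (F : U -> V) :
  locally_lipschitz F <-> forall p, exists d k, [/\ 0 < d, 0 < k &
    forall x y, `|x - p| < d -> `|y - p| < d -> `|F x - F y| <= k * `|x - y|].
Proof.
split=> H p.
  have [A [k [/nbhs_ballP [d d0 Hd] L]]] := H p.
  exists d, (`|k| + 1); split => //.
  move=> x y xp yp; have := L (x, y); rewrite /= => /(_ _) LL.
  apply: le_trans (LL _) _; last first.
    by rewrite ler_wpM2r// (le_trans (ler_norm k))// lerDl.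
  by split; apply: Hd; rewrite /= -ball_normE /= distrC.
have [d [k [d0 k0 L]]] := H p.
exists (ball p d), k; split; first exact: nbhsx_ballx.
move=> [x y] /= [xp yp]; apply: L; rewrite distrC.
  by move: xp; rewrite -ball_normE.
by move: yp; rewrite -ball_normE.
Qed.

Lemma loclip_continuous (U V : normedModType R) (F : U -> V) :
  locally_lipschitz F -> continuous F.
Proof.
move=> /loclipP H p; have [d [k [d0 k0 L]]] := H p.
apply/cvgrPdist_lt => e e0; apply/nbhs_ballP; exists (Num.min d (e / k)).
  by rewrite /= lt_min d0 divr_gt0.
move=> x; rewrite -ball_normE /= lt_min => /andP[xd xe].
apply: le_lt_trans (L p x _ _) _; rewrite ?subrr ?normr0//.
  by rewrite distrC.
by rewrite mulrC -ltr_pdivlMr.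
Qed.

(** On a window of length [m] with [k * m <= 1 / 2], [mvt_norm] bounds the maximum of the distance
    between the solutions by half of itself, so it is zero; [real_induction] chains the windows. The
    norm, which may fail to be differentiable, is never differentiated. *)
Lemma ode_unique (V : normedModType R) (F : V -> V) (x1 x2 : R -> V) (a b : R) :
  locally_lipschitz F ->
  {within `[a, b], continuous x1} -> {within `[a, b], continuous x2} ->
  (forall t, a < t -> t < b -> is_derive t (1 : R) x1 (F (x1 t))) ->
  (forall t, a < t -> t < b -> is_derive t (1 : R) x2 (F (x2 t))) ->
  x1 a = x2 a -> forall t, a <= t -> t <= b -> x1 t = x2 t.
Proof.
move=> /loclipP lipF c1 c2 d1 d2 E; apply: real_induction => // t.
  move=> at_ tb Hs; apply/eqP; rewrite -subr_eq0 -normr_le0; apply/ler_addgt0Pr => e e0.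
  rewrite add0r.
  have [r1 r10 H1] := within_cont_at c1 (ltW at_) tb (divr_gt0 e0 (ltr0Sn _ 1)).
  have [r2 r20 H2] := within_cont_at c2 (ltW at_) tb (divr_gt0 e0 (ltr0Sn _ 1)).
  pose m := Num.min (Num.min (t - a) (r1 / 2)) (r2 / 2).
  have m0 : 0 < m by rewrite !lt_min subr_gt0 at_ !divr_gt0.
  have mt : m <= t - a by rewrite !ge_min lexx.
  have m1 : m <= r1 / 2 by rewrite !ge_min lexx orbT.
  have m2 : m <= r2 / 2 by rewrite !ge_min lexx !orbT.
  have K1 : `|x1 (t - m) - x1 t| < e / 2.
    by apply: H1; [lra | lra | rewrite addrAC subrr add0r normrN gtr0_norm//; lra].
  have K2 : `|x2 (t - m) - x2 t| < e / 2.
    by apply: H2; [lra | lra | rewrite addrAC subrr add0r normrN gtr0_norm//; lra].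
  rewrite Hs in K1; [|lra|lra].
  rewrite -(subrKA (x2 (t - m))); apply: le_trans (ler_normD _ _) _.
  by rewrite (distrC (x1 t)); lra.
move=> at_ tb Et; have [d [k [d0 k0 L]]] := lipF (x1 t).
have [r1 r10 H1] := within_cont_at c1 at_ (ltW tb) d0.
have [r2 r20 H2] := within_cont_at c2 at_ (ltW tb) d0.
pose m := Num.min (Num.min (b - t) (r1 / 2)) (Num.min (r2 / 2) (k^-1 / 2)).
have m0 : 0 < m by rewrite !lt_min subr_gt0 tb !divr_gt0// invr_gt0.
have mt : m <= b - t by rewrite !ge_min lexx.
have m1 : m <= r1 / 2 by rewrite !ge_min lexx orbT.
have m2 : m <= r2 / 2 by rewrite !ge_min lexx !orbT.
have mk : k * m <= 1 / 2.
  have : m <= k^-1 / 2 by rewrite !ge_min lexx !orbT.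
  move=> /(ler_wpM2l (ltW k0)); rewrite mulrA divff ?gt_eqF//.
exists m => // s ts sm sb.
pose u := x1 \- x2.
have cu : {within `[t, t + m], continuous u}.
  move=> z; apply: continuousB.
    by apply: (within_sub c1 at_); lra.
  by apply: (within_sub c2 at_); lra.
have cnu : {within `[t, t + m], continuous (fun z => `|u z|)}.
  apply: within_contP => z tz zm e e0; have [de de0 Hde] := within_cont_at cu tz zm e0.
  by exists de => // y ty ym yz; apply: le_lt_trans (ler_dist_dist _ _) (Hde _ _ _ _).
have [w] := EVT_max (ltac:(lra) : t <= t + m) cnu.
rewrite in_itv /= => /andP[tw wm] Hmax.
have : `|u w - u t| <= k * `|u w| * (w - t).
  apply: (mvt_norm (dg := fun z => F (x1 z) - F (x2 z))) => //.
    by apply: within_sub cu _ _ => //.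
  move=> z tz zw.
  have az : a < z by exact: le_lt_trans tz.
  have zm : z < t + m by exact: lt_le_trans wm.
  have zb : z < b by apply: lt_le_trans zm _; rewrite -lerBrDl.
  have zt : `|z - t| < m by rewrite gtr0_norm ?subr_gt0// ltrBlDl.
  split.
    have D1 := d1 z az zb; have D2 := d2 z az zb.
    exact: is_deriveB.
  apply: le_trans (L _ _ _ _) _.
  - by apply: H1; rewrite ?(ltW az) ?(ltW zb)//; apply: lt_le_trans zt _; apply: le_trans m1 _; rewrite ler_piMr ?invf_le1 ?(ltW r10)// ler1n.
  - by rewrite Et; apply: H2; rewrite ?(ltW az) ?(ltW zb)//; apply: lt_le_trans zt _; apply: le_trans m2 _; rewrite ler_piMr ?invf_le1 ?(ltW r20)// ler1n.
  - by rewrite ler_pM2l//; apply: Hmax; rewrite in_itv /=; lra.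
rewrite {2}/u /= Et subrr subr0 => Hw.
have uw0 : `|u w| <= 0.
  have : `|u w| * (k * (w - t)) <= `|u w| * (1/2).
    by rewrite ler_wpM2l//; apply: le_trans mk; rewrite ler_pM2l//; lra.
  lra.
apply/eqP; rewrite -subr_eq0 -normr_le0; apply: le_trans uw0.
by apply: Hmax; rewrite in_itv /=; lra.
Qed.

End Ode.

(** * Locally Lipschitz maps *)

Section Lipschitz.
Variable R : realType.

Lemma loclip_comp (U V W : normedModType R) (F : U -> V) (G : V -> W) :
  locally_lipschitz F -> locally_lipschitz G -> locally_lipschitz (G \o F).
Proof.
move=> /loclipP HF /loclipP HG; apply/loclipP => p.
have [d [k [d0 k0 L]]] := HF p; have [d' [k' [d'0 k'0 L']]] := HG (F p).
exists (Num.min d (d' / k)), (k' * k); split; [by rewrite lt_min d0 divr_gt0|exact: mulr_gt0|].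
move=> x y; rewrite !lt_min => /andP[xd xd'] /andP[yd yd'].
have B z : `|z - p| < d -> `|z - p| < d' / k -> `|F z - F p| < d'.
  move=> zd zd'; apply: le_lt_trans (L z p zd _) _; first by rewrite subrr normr0.
  by rewrite mulrC -ltr_pdivlMr.
apply: le_trans (L' _ _ (B _ xd xd') (B _ yd yd')) _.
by rewrite -mulrA ler_pM2l// L.
Qed.

Lemma loclip_bound (U V : normedModType R) (F : U -> V) (C : R) :
  0 <= C -> (forall x y, `|F x - F y| <= C * `|x - y|) -> locally_lipschitz F.
Proof.
move=> C0 H; apply/loclipP => p; exists 1, (C + 1); split => //; first by rewrite ltr_wpDl.
by move=> x y _ _; apply: le_trans (H x y) _; rewrite ler_wpM2r// lerDl.
Qed.

Lemma loclip_cst (U V : normedModType R) (v : V) : locally_lipschitz (fun _ : U => v).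
Proof. by apply: (@loclip_bound _ _ _ 0) => // x y; rewrite subrr normr0 mul0r. Qed.

Lemma loclip_id (U : normedModType R) : locally_lipschitz (@id U).
Proof. by apply: (@loclip_bound _ _ _ 1) => // x y; rewrite mul1r. Qed.

Lemma loclip_fst (U V : normedModType R) : locally_lipschitz (fun x : U * V => x.1).
Proof.
apply: (@loclip_bound _ _ _ 1) => // x y.
by rewrite mul1r [leRHS]prod_normE /= le_max lexx.
Qed.

Lemma loclip_snd (U V : normedModType R) : locally_lipschitz (fun x : U * V => x.2).
Proof.
apply: (@loclip_bound _ _ _ 1) => // x y.
by rewrite mul1r [leRHS]prod_normE /= le_max lexx orbT.
Qed.

Lemma loclip_coord n i : locally_lipschitz (fun x : 'rV[R]_n => x ord0 i).
Proof.
apply: (@loclip_bound _ _ _ 1) => // x y.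
by rewrite mul1r; apply: le_trans (norm_rV_coord _ i); rewrite !mxE.
Qed.

Lemma loclip_pair (U V W : normedModType R) (F : U -> V) (G : U -> W) :
  locally_lipschitz F -> locally_lipschitz G -> locally_lipschitz (fun x => (F x, G x)).
Proof.
move=> /loclipP HF /loclipP HG; apply/loclipP => p.
have [d [k [d0 k0 L]]] := HF p; have [d' [k' [d'0 k'0 L']]] := HG p.
exists (Num.min d d'), (Num.max k k'); split; [by rewrite lt_min d0|by rewrite lt_max k0|].
move=> x y; rewrite !lt_min => /andP[xd xd'] /andP[yd yd'].
rewrite prod_normE /= ge_max; apply/andP; split.
  by apply: le_trans (L x y xd yd) _; rewrite ler_wpM2r// le_max lexx.
by apply: le_trans (L' x y xd' yd') _; rewrite ler_wpM2r// le_max lexx orbT.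
Qed.

Lemma loclip_add (U V : normedModType R) (F G : U -> V) :
  locally_lipschitz F -> locally_lipschitz G -> locally_lipschitz (fun x => F x + G x).
Proof.
move=> HF HG; apply: (loclip_comp (loclip_pair HF HG) (G := fun x : V * V => x.1 + x.2)).
apply: (@loclip_bound _ _ _ 2) => // x y; rewrite opprD addrACA.
apply: le_trans (ler_normD _ _) _; rewrite mulr2n mulrDl mul1r prod_normE.
by apply: lerD; rewrite le_max lexx ?orbT.
Qed.

Lemma loclip_scale (U V : normedModType R) (k : R) (F : U -> V) :
  locally_lipschitz F -> locally_lipschitz (fun x => k *: F x).
Proof.
move=> HF; apply: (loclip_comp HF (G := fun x : V => k *: x)).
by apply: (@loclip_bound _ _ _ `|k|) => // x y; rewrite -scalerBr normrZ.
Qed.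

Lemma loclip_opp (U V : normedModType R) (F : U -> V) :
  locally_lipschitz F -> locally_lipschitz (fun x => - F x).
Proof.
move=> HF; apply: (loclip_comp HF (G := fun x : V => - x)).
by apply: (@loclip_bound _ _ _ 1) => // x y; rewrite mul1r -opprD normrN.
Qed.

Lemma loclip_scaleV (U V : normedModType R) (F : U -> R) (v : V) :
  locally_lipschitz F -> locally_lipschitz (fun x => F x *: v).
Proof.
move=> HF; apply: (loclip_comp HF (G := fun x : R => x *: v)).
by apply: (@loclip_bound _ _ _ `|v|) => // x y; rewrite -scalerBl normrZ mulrC.
Qed.

Lemma loclip_row (U : normedModType R) n (F : U -> 'rV[R]_n) :
  (forall i, locally_lipschitz (fun x => F x ord0 i)) -> locally_lipschitz F.
Proof.
move=> H; apply/loclipP => p.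
have H' i : exists dk : R * R, [/\ 0 < dk.1, 0 < dk.2 & forall x y,
    `|x - p| < dk.1 -> `|y - p| < dk.1 -> `|F x ord0 i - F y ord0 i| <= dk.2 * `|x - y|].
  by have /loclipP/(_ p) [d [k ?]] := H i; exists (d, k).
have [h Hh] := choice H'.
exists (\big[Num.min/1]_i (h i).1), (1 + \sum_i (h i).2); split.
- by apply: lt_bigmin => // i _; have [] := Hh i.
- by rewrite ltr_pwDl// sumr_ge0// => i _; have [_ /ltW] := Hh i.
- move=> x y xd yd; apply: norm_rV_le => [|i].
    by rewrite mulr_ge0// addr_ge0// sumr_ge0// => i _; have [_ /ltW] := Hh i.
  have [_ k0 L] := Hh i; rewrite !mxE.
  apply: le_trans (L x y _ _) _.
  + by apply: lt_le_trans xd _; apply: bigmin_le.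
  + by apply: lt_le_trans yd _; apply: bigmin_le.
  rewrite ler_wpM2r// [X in _ <= 1 + X](bigD1 i)//= addrCA lerDl addr_ge0// sumr_ge0// => j _.
  by have [_ /ltW] := Hh j.
Qed.

(** [C1] gives continuity of the differential in each fixed direction only. Finitely many directions
    [e i], with coordinates bounded by the norm, turn this into a local bound [K] on the whole
    differential, and [mvt_norm] is applied along a segment. *)
Lemma C1_loclip (U V : normedModType R) m (e : 'I_m -> U) (cc : 'I_m -> U -> R) (F : U -> V) :
  (forall v, v = \sum_i cc i v *: e i) -> (forall i v, `|cc i v| <= `|v|) ->
  C1 F -> locally_lipschitz F.
Proof.
move=> decomp ccle HF; apply/loclipP => p.
have H' i : exists2 d : R, 0 < d & forall x, `|x - p| < d -> `|'d F x (e i)| <= `|'d F p (e i)| + 1.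
  have [_ /(_ (e i)) /cvgrPdist_lt /(_ _ ltr01) /nbhs_ballP [d d0 Hd]] := HF p I.
  exists d => // x xp.
  have H1 : `|'d F p (e i) - 'd F x (e i)| < 1 by apply: Hd; rewrite -ball_normE /= distrC.
  rewrite -lerBlDl; apply: le_trans (lerB_dist _ _) (ltW _).
  by rewrite distrC.
have /choice [h Hh] : forall i, exists d : R, 0 < d /\ forall x, `|x - p| < d ->
    `|'d F x (e i)| <= `|'d F p (e i)| + 1.
  by move=> i; have [d] := H' i; exists d.
pose K := \sum_i (`|'d F p (e i)| + 1).
have K0 : 0 <= K by apply: sumr_ge0 => i _; rewrite addr_ge0.
exists (\big[Num.min/1]_i h i), (K + 1); split.
- by apply: lt_bigmin => // i _; have [] := Hh i.
- by rewrite ltr_wpDl.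
move=> x y xd yd; rewrite distrC.
pose g (s : R) := F (x + s *: (y - x)).
pose pth (s : R) := x + s *: (y - x).
have dp s : is_derive s (1 : R) pth (y - x).
  apply/is_deriveP => ep ep0; exists 1 => // hh _.
  rewrite /pth opprD addrACA subrr add0r -scalerBl [s + hh]addrC addrK subrr normr0.
  by rewrite mulr_ge0// ltW.
have dg s : is_derive s (1 : R) g ('d F (pth s) (y - x)).
  apply: (is_derive_dcomp (F := F) (dp s)).
  by have [] := HF (pth s) I.
have := @mvt_norm R V g (fun s => 'd F (pth s) (y - x)) 0 1 (K * `|y - x|) ler01.
have -> : g 1 = F y by rewrite /g scale1r addrC subrK.
have -> : g 0 = F x by rewrite /g scale0r addr0.
rewrite subr0 mulr1 => M.
apply: le_trans (M _ _) _.
- by apply: continuous_subspaceT => s; apply: is_derive_cont (dg s).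
- move=> s s0 s1; split; first exact: dg.
  rewrite [X in 'd F _ X]decomp linear_sum; apply: le_trans (ler_norm_sum _ _ _) _.
  rewrite /K mulr_suml; apply: ler_sum => i _.
  rewrite linearZ normrZ mulrC; apply: ler_pM => //.
  have [_] := Hh i; apply.
  (* Convexity of the ball: the segment from [x] to [y] stays where the directional bounds hold. *)
  have -> : pth s - p = (1 - s) *: (x - p) + s *: (y - p).
    rewrite /pth scalerBl scale1r -[RHS]addrA [X in _ = _ + X]addrC -scalerBr opprB subrKA.
    by rewrite addrAC.
  have dh : \big[Num.min/1]_i h i <= h i by apply: bigmin_le.
  have xh := lt_le_trans xd dh; have yh := lt_le_trans yd dh.
  apply: le_lt_trans (ler_normD _ _) _; rewrite !normrZ !gtr0_norm ?subr_gt0//; nra.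
- by rewrite distrC ler_wpM2r// lerDl.
Qed.

End Lipschitz.

(** * A Lyapunov function for the regulator *)

Section EuclideanSquare.
Variable R : realType.

(** The square, unlike the norm, is differentiable everywhere, so it can serve as a Lyapunov
    function. *)
Definition enorm2 n (x : 'rV[R]_n) : R := \sum_(i < n) x ord0 i ^+ 2.
Definition edot n (x y : 'rV[R]_n) : R := \sum_(i < n) x ord0 i * y ord0 i.

Lemma enorm2_ge0 n (x : 'rV[R]_n) : 0 <= enorm2 x.
Proof. by apply: sumr_ge0 => i _; apply: sqr_ge0. Qed.

Lemma enormE n (x : 'rV[R]_n) : enorm x = Num.sqrt (enorm2 x).
Proof. by []. Qed.

Lemma coord_le_enorm2 n (x : 'rV[R]_n) i : x ord0 i ^+ 2 <= enorm2 x.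
Proof. by rewrite /enorm2 (bigD1 i)//= lerDl sumr_ge0// => j _; apply: sqr_ge0. Qed.

Lemma enorm2_le_norm n (x : 'rV[R]_n) : enorm2 x <= n%:R * `|x| ^+ 2.
Proof.
rewrite mulr_natl -[X in _ *+ X]card_ord -sumr_const; apply: ler_sum => i _.
by rewrite -real_normK ?num_real// lerXn2r// ?nnegrE// norm_rV_coord.
Qed.

Lemma norm_le_enorm2 n (x : 'rV[R]_n) : `|x| ^+ 2 <= enorm2 x.
Proof.
rewrite -[leRHS]sqr_sqrtr ?enorm2_ge0// lerXn2r ?nnegrE ?sqrtr_ge0//.
apply: norm_rV_le => [|i]; first exact: sqrtr_ge0.
by rewrite -sqrtr_sqr ler_sqrt ?enorm2_ge0// coord_le_enorm2.
Qed.

Lemma enorm2D n (x y : 'rV[R]_n) : enorm2 (x + y) <= 2 * enorm2 x + 2 * enorm2 y.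
Proof.
rewrite /enorm2 !mulr_sumr -big_split /=; apply: ler_sum => i _; rewrite mxE.
by have := sqr_ge0 (x ord0 i - y ord0 i); rewrite !expr2; nra.
Qed.

Lemma enorm2Z n (k : R) (x : 'rV[R]_n) : enorm2 (k *: x) = k ^+ 2 * enorm2 x.
Proof. by rewrite /enorm2 mulr_sumr; apply: eq_bigr => i _; rewrite mxE exprMn. Qed.

Lemma enorm2N n (x : 'rV[R]_n) : enorm2 (- x) = enorm2 x.
Proof. by apply: eq_bigr => i _; rewrite mxE sqrrN. Qed.

Lemma edotDr n (x y z : 'rV[R]_n) : edot x (y + z) = edot x y + edot x z.
Proof. by rewrite /edot -big_split /=; apply: eq_bigr => i _; rewrite mxE mulrDr. Qed.

Lemma edotC n (x y : 'rV[R]_n) : edot x y = edot y x.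
Proof. by apply: eq_bigr => i _; rewrite mulrC. Qed.

Lemma edot_young n (x y : 'rV[R]_n) (a : R) : 0 < a ->
  2 * edot x y <= a * enorm2 x + enorm2 y / a.
Proof.
move=> a0; rewrite /edot /enorm2 !mulr_sumr mulr_suml -big_split /=; apply: ler_sum => i _.
rewrite -subr_ge0.
rewrite (_ : _ - _ = (a * x ord0 i - y ord0 i) ^+ 2 / a); last by field; rewrite gt_eqF.
by rewrite divr_ge0 ?sqr_ge0// ltW.
Qed.

Lemma edot_le_norm n (x y : 'rV[R]_n) : edot x y <= n%:R * (`|x| * `|y|).
Proof.
rewrite mulr_natl -[X in _ *+ X]card_ord -sumr_const; apply: ler_sum => i _.
by apply: le_trans (ler_norm _) _; rewrite normrM ler_pM// norm_rV_coord.
Qed.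

Lemma enorm2_mulmx n m (B : 'M[R]_(n, m)) :
  exists2 K : R, 0 < K & forall x, enorm2 (x *m B) <= K * enorm2 x.
Proof.
exists (\sum_j (\sum_i `|B i j|) ^+ 2 + 1).
  by rewrite ltr_wpDl// sumr_ge0// => j _; apply: sqr_ge0.
move=> x; apply: le_trans (_ : (\sum_j (\sum_i `|B i j|) ^+ 2) * enorm2 x <= _); last first.
  by rewrite ler_wpM2r ?enorm2_ge0// lerDl.
rewrite mulr_suml; apply: ler_sum => j _; rewrite mxE.
apply: le_trans (_ : (\sum_i `|B i j|) ^+ 2 * `|x| ^+ 2 <= _); last first.
  by rewrite ler_wpM2l ?sqr_ge0// norm_le_enorm2.
rewrite -exprMn -real_normK ?num_real// lerXn2r// ?nnegrE// ?mulr_ge0// ?sumr_ge0//.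
rewrite mulr_suml; apply: le_trans (ler_norm_sum _ _ _) _; apply: ler_sum => i _.
by rewrite normrM mulrC ler_wpM2l// norm_rV_coord.
Qed.

Lemma is_derive_enorm2 n (x : R -> 'rV[R]_n) t dx :
  is_derive t (1 : R) x dx -> is_derive t (1 : R) (fun s => enorm2 (x s)) (2 * edot (x t) dx).
Proof.
move=> H; rewrite /enorm2 /edot mulr_sumr.
have E : (fun s => \sum_(i < n) x s ord0 i ^+ 2) = \sum_(i < n) (fun s => x s ord0 i ^+ 2).
  by apply/funext => s; rewrite fct_sumE.
rewrite E; apply: is_derive_sum => i.
have D := is_derive_coord i H.
have := is_deriveX 1 D => D2; apply: is_derive_eq.
by rewrite /GRing.scale /=; ring.
Qed.

Lemma within_enorm2 n (x : R -> 'rV[R]_n) (a b : R) :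
  {within `[a, b], continuous x} -> {within `[a, b], continuous (fun s => enorm2 (x s))}.
Proof.
move=> cx; have E : (fun s => enorm2 (x s)) = \sum_(i < n) (fun s => x s ord0 i ^+ 2).
  by apply/funext => s; rewrite fct_sumE.
have C : continuous (@enorm2 n).
  move=> v; rewrite /enorm2.
  have -> : (fun x0 : 'rV[R]_n => \sum_(i < n) x0 ord0 i ^+ 2) = \sum_(i < n) (fun x0 : 'rV[R]_n => x0 ord0 i ^+ 2).
    by apply/funext => s; rewrite fct_sumE.
  apply: differentiable_continuous; apply: differentiable_sum => i.
  have D : differentiable (fun N : 'rV[R]_n => N ord0 i : R) v by apply: differentiable_coord.
  by have := differentiableX 1 D.
by move=> t; apply: (continuous_comp (cx t)); apply: C.
Qed.

End EuclideanSquare.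

(** * Finite coordinates and Lipschitz constants on compact sets *)

Section Coordinates.
Variable R : realType.

Lemma norm_triangle3 (V : normedModType R) (a b c d : V) :
  `|a - d| <= `|a - b| + `|b - c| + `|c - d|.
Proof.
rewrite -addrA -(subrKA b a) -(subrKA c b).
by rewrite (le_trans (ler_normD _ _))// lerD2l ler_normD.
Qed.

(** Finite dimension in the form consumed by [C1_loclip]; it passes to products, which matters
    because the states are nested pairs. *)
Definition fin_coords (U : normedModType R) : Prop :=
  exists m (e : 'I_m -> U) (cc : 'I_m -> U -> R),
    (forall v, v = \sum_i cc i v *: e i) /\ (forall i v, `|cc i v| <= `|v|).

Lemma fin_coords_R : fin_coords R.
Proof.
exists 1%N, (fun=> 1), (fun _ v => v); split=> // v.
by rewrite big_ord1 /GRing.scale /= mulr1.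
Qed.

Lemma fin_coords_rV n : fin_coords 'rV[R]_n.
Proof.
exists n, (fun i => delta_mx ord0 i), (fun i (v : 'rV[R]_n) => v ord0 i); split=> [v|i v].
  exact: row_sum_delta.
exact: norm_rV_coord.
Qed.

Lemma fin_coords_prod (U V : normedModType R) :
  fin_coords U -> fin_coords V -> fin_coords (U * V)%type.
Proof.
move=> [m [e [cc [D B]]]] [m' [e' [cc' [D' B']]]].
pose E (k : 'I_(m + m')) : U * V := match fintype.split k with inl i => (e i, 0) | inr j => (0, e' j) end.
pose CC (k : 'I_(m + m')) (v : U * V) : R := match fintype.split k with inl i => cc i v.1 | inr j => cc' j v.2 end.
exists (m + m')%N, E, CC; split=> [[v v']|k [v v']].
  rewrite big_split_ord /=.
  under eq_bigr => i _.
    rewrite /E /CC (unsplitK (inl i : 'I_m + 'I_m')); over.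
  under [X in _ = _ + X]eq_bigr => i _.
    rewrite /E /CC (unsplitK (inr i : 'I_m + 'I_m')); over.
  have S1 : \sum_(i < m) cc i v *: (e i, (0 : V)) = (v, 0).
    rewrite [in RHS](D v); elim/big_ind2 : _ => //.
      by move=> x1 x2 y1 y2 -> ->; apply: injective_projections; rewrite /= ?addr0.
    by move=> i _; apply: injective_projections; rewrite /= ?scaler0.
  have S2 : \sum_(i < m') cc' i v' *: ((0 : U), e' i) = (0, v').
    rewrite [in RHS](D' v'); elim/big_ind2 : _ => //.
      by move=> x1 x2 y1 y2 -> ->; apply: injective_projections; rewrite /= ?addr0.
    by move=> i _; apply: injective_projections; rewrite /= ?scaler0.
  by rewrite /= S1 S2; apply: injective_projections; rewrite /= ?addr0 ?add0r.
rewrite /CC prod_normE /= le_max; case: (fintype.split k) => i.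
  by rewrite B.
by rewrite B' orbT.
Qed.

Lemma C1_locally_lipschitz (U V : normedModType R) (F : U -> V) :
  fin_coords U -> C1 F -> locally_lipschitz F.
Proof. by move=> [m [e [cc [D B]]]]; apply: C1_loclip D B. Qed.

(** [K] need not be convex, so local constants cannot be chained along segments. Instead [K] x [K]
    is covered: near the diagonal the local constant applies, and near a pair of distinct points
    [|x - y|] stays above half of their distance while [|F x - F y|] stays bounded. *)
Lemma loclip_compact (U V : normedModType R) (F : U -> V) (K : set U) :
  locally_lipschitz F -> compact K ->
  exists2 k : R, 0 < k & forall x y, K x -> K y -> `|F x - F y| <= k * `|x - y|.
Proof.
move=> HF cK; have cF := loclip_continuous HF; move: (HF) => /loclipP HL.
have /compact_near_coveringP NC := compact_setX cK cK.
pose Q (k : R) (xy : U * U) := `|F xy.1 - F xy.2| <= k * `|xy.1 - xy.2|.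
have : \forall k \near +oo, (K `*` K) `<=` Q k.
  apply: NC => -[p1 p2] _ /=.
  have [E|NE] := eqVneq p1 p2.
    have [d [k [d0 k0 L]]] := HL p1.
    exists (ball p1 d `*` ball p2 d, [set k' | k <= k']).
      split; last by apply: nbhs_pinfty_ge; rewrite num_real.
      by exists (ball p1 d, ball p2 d) => //=; split; exact: nbhsx_ballx.
    move=> [[x y] k'] /= [[xd yd] kk']; rewrite /Q /=.
    apply: le_trans (L x y _ _) _.
    + by move: xd; rewrite -ball_normE /= distrC.
    + by move: yd; rewrite -ball_normE /= E distrC.
    + by rewrite ler_wpM2r.
  pose h := `|p1 - p2|.
  have h0 : 0 < h by rewrite normr_gt0 subr_eq0.
  have N (p : U) : \forall x \near p, `|F p - F x| < 1 /\ `|p - x| < h / 4.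
    have F1 : \forall x \near p, `|F p - F x| < 1.
      by have /cvgrPdist_lt/(_ _ ltr01) := cF p.
    have F2 : \forall x \near p, `|p - x| < h / 4.
      by apply/nbhs_ballP; exists (h / 4); [rewrite /= divr_gt0|move=> x; rewrite -ball_normE].
    by near=> x; split; near: x.
  pose B := 2 + `|F p1 - F p2|.
  exists ([set x | `|F p1 - F x| < 1 /\ `|p1 - x| < h / 4] `*`
          [set x | `|F p2 - F x| < 1 /\ `|p2 - x| < h / 4], [set k' | B / (h / 2) <= k']).
    split; last by apply: nbhs_pinfty_ge; rewrite num_real.
    by exists ([set x | `|F p1 - F x| < 1 /\ `|p1 - x| < h / 4],
          [set x | `|F p2 - F x| < 1 /\ `|p2 - x| < h / 4]) => //=; split; exact: N.
  move=> [[x y] k'] /= [[[x1 x2] [y1 y2]] kk']; rewrite /Q /=.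
  have A1 : h / 2 <= `|x - y|.
    have : h <= `|p1 - x| + `|x - y| + `|p2 - y|.
      by rewrite (distrC p2); exact: norm_triangle3.
    lra.
  have A2 : `|F x - F y| <= B.
    have : `|F x - F y| <= `|F p1 - F x| + `|F p1 - F p2| + `|F p2 - F y|.
      by rewrite (distrC (F p1) (F x)); exact: norm_triangle3.
    rewrite /B; lra.
  apply: le_trans A2 _.
  have k'0 : 0 <= k'.
    apply: le_trans kk'; rewrite !divr_ge0// ?ltW// /B ltr_wpDr//.
  apply: le_trans (_ : k' * (h / 2) <= _); last by rewrite ler_wpM2l.
  by rewrite -ler_pdivrMr// divr_gt0.
move=> /filter_ex [k Hk]; exists (`|k| + 1); first by rewrite ltr_wpDl.
move=> x y Kx Ky; apply: le_trans (Hk (x, y) _) _ => //=.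
by rewrite ler_wpM2r// (le_trans (ler_norm k))// lerDl.
Unshelve. all: by end_near. Qed.

End Coordinates.

(** * Quadratic Lyapunov functions from eigenvalues *)

Section Lyapunov.
Variable R : realType.
Local Notation C := (complex R).
Local Notation Re := (@complex.Re R).
Local Notation Im := (@complex.Im R).
Local Notation rc := (real_complex R).

Lemma Re_sum I (r : seq I) (P : pred I) (F : I -> C) :
  Re (\sum_(i <- r | P i) F i) = \sum_(i <- r | P i) Re (F i).
Proof. by elim/big_rec2 : _ => // i y1 y2 _ <-; case: (F i) y2 => ? ? [? ?]. Qed.

Lemma Im_sum I (r : seq I) (P : pred I) (F : I -> C) :
  Im (\sum_(i <- r | P i) F i) = \sum_(i <- r | P i) Im (F i).
Proof. by elim/big_rec2 : _ => // i y1 y2 _ <-; case: (F i) y2 => ? ? [? ?]. Qed.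

Lemma ReM (a b : C) : Re (a * b) = Re a * Re b - Im a * Im b.
Proof. by case: a b => [? ?] [? ?]. Qed.

Lemma ImM (a b : C) : Im (a * b) = Re a * Im b + Im a * Re b.
Proof. by case: a b => [? ?] [? ?]. Qed.

Definition csq (z : C) : R := Re z ^+ 2 + Im z ^+ 2.
Definition cdot (z w : C) : R := Re z * Re w + Im z * Im w.

Lemma cdot_sum I (r : seq I) (P : pred I) (F : I -> C) w :
  cdot (\sum_(i <- r | P i) F i) w = \sum_(i <- r | P i) cdot (F i) w.
Proof. by rewrite /cdot Re_sum Im_sum !mulr_suml -big_split. Qed.

Lemma cdot_mul_le (a z w : C) :
  cdot (z * a) w <= (`|Re a| + `|Im a|) * (csq z + csq w).
Proof.
rewrite /cdot /csq ReM ImM; move: (Re a) (Im a) (Re z) (Im z) (Re w) (Im w) => a1 a2 z1 z2 w1 w2.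
have K (x y u v : R) : `|x * u + y * v| <= x ^+ 2 + y ^+ 2 + (u ^+ 2 + v ^+ 2).
  rewrite ler_norml; apply/andP; split.
    by have := sqr_ge0 (x + u); have := sqr_ge0 (y + v); have := sqr_ge0 x; have := sqr_ge0 y;
    have := sqr_ge0 u; have := sqr_ge0 v; rewrite !expr2; lra.
  by have := sqr_ge0 (x - u); have := sqr_ge0 (y - v); have := sqr_ge0 x; have := sqr_ge0 y;
    have := sqr_ge0 u; have := sqr_ge0 v; rewrite !expr2; lra.
have -> : (z1 * a1 - z2 * a2) * w1 + (z1 * a2 + z2 * a1) * w2 =
  a1 * (z1 * w1 + z2 * w2) + a2 * (z1 * w2 + (- z2) * w1) by ring.
rewrite mulrDl; apply: le_trans (ler_norm _) _; apply: le_trans (ler_normD _ _) _.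
rewrite !normrM; apply: lerD; apply: ler_wpM2l => //.
by apply: le_trans (K _ _ _ _) _; rewrite sqrrN; lra.
Qed.

Lemma cdot_mul_diag (a z : C) : cdot (z * a) z = Re a * csq z.
Proof. by rewrite /cdot /csq ReM ImM; ring. Qed.

Lemma map_mul_Re d m (x : 'rV[R]_d) (S : 'M[C]_(d, m)) i :
  Re ((map_mx rc x *m S) ord0 i) = (x *m map_mx Re S) ord0 i.
Proof.
by rewrite !mxE Re_sum; apply: eq_bigr => j _; rewrite !mxE ReM /= mul0r subr0.
Qed.

Lemma map_mul_Im d m (x : 'rV[R]_d) (S : 'M[C]_(d, m)) i :
  Im ((map_mx rc x *m S) ord0 i) = (x *m map_mx Im S) ord0 i.
Proof.
by rewrite !mxE Im_sum; apply: eq_bigr => j _; rewrite !mxE ImM /= mul0r addr0.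
Qed.

(* Schur's triangularization, followed by a diagonal scaling by powers of [sg] that
   makes the off-diagonal coupling small compared with the spectral gap [a].  [Q] stacks
   the real and imaginary parts of the complex change of coordinates. *)
Lemma lyapunov_of_eigenvalues d (F : 'M[R]_d) : (0 < d)%N ->
  (forall (u : 'rV[C]_d) l, u != 0 -> u *m map_mx rc F = l *: u -> Re l < 0) ->
  exists m (Q : 'M[R]_(d, m)) (B : 'M[R]_(m, d)) (al : R),
    [/\ 0 < al, Q *m B = 1%:M &
      forall x : 'rV[R]_d, edot (x *m F *m Q) (x *m Q) <= - al * enorm2 (x *m Q)].
Proof.
move=> d0 HF; pose FC := map_mx rc F.
have [P PU] := Schur FC d0.
rewrite /similar_to conjymx// => trigPF.
have Pu : P \in unitmx by apply: unitarymx_unit.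
pose P' := invmx P.
have PP' : P *m P' = 1%:M by rewrite mulmxV.
have P'P : P' *m P = 1%:M by rewrite mulVmx.
have [T TE trigT] : exists2 T, T = P *m FC *m P' & is_trig_mx T.
  by exists (P *m FC *m P') => //; rewrite /P' invmx_unitary.
(* A diagonal entry of a triangular matrix is an eigenvalue, and [P] carries a left eigenvector of
   [T] to one of [FC]. *)
have diagT i : Re (T i i) < 0.
  have : eigenvalue T (T i i).
    rewrite eigenvalue_root_char char_poly_trig// /root horner_prod.
    by rewrite prodf_seq_eq0; apply/hasP; exists i; rewrite ?mem_index_enum//= !hornerE subrr.
  move=> /eigenvalueP [v vE v0]; apply: (HF (v *m P)).
    by apply: contraNneq v0 => vP0; rewrite -[v]mulmx1 -PP' mulmxA vP0 mul0mx.
  rewrite -/FC scalemxAl -vE TE.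
  by rewrite !mulmxA -[RHS]mulmxA P'P mulmx1.
pose a := \big[Num.min/1]_i (- Re (T i i)).
have a0 : 0 < a by apply: lt_bigmin => // i _; rewrite oppr_gt0.
have aT i : Re (T i i) <= - a by rewrite lerNr bigmin_le.
pose K := \sum_i \sum_j (`|Re (T i j)| + `|Im (T i j)|).
have KT i j : `|Re (T i j)| + `|Im (T i j)| <= K.
  rewrite /K (bigD1 i)//= (bigD1 j)//= -addrA lerDl addr_ge0//.
    by apply: sumr_ge0 => k _; rewrite addr_ge0.
  by apply: sumr_ge0 => k _; apply: sumr_ge0 => l _; rewrite addr_ge0.
have K0 : 0 <= K by apply: sumr_ge0 => k _; apply: sumr_ge0 => l _; rewrite addr_ge0.
(* Chosen so that the off-diagonal coupling, once divided by [sg] and summed, uses at most half of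
   the gap [a]; this is [Ksg]. *)
pose sg := 1 + 4 * d%:R * K / a.
have sg1 : 1 <= sg by rewrite lerDl !divr_ge0 ?mulr_ge0 ?ler0n// ltW.
have sg0 : 0 < sg by apply: lt_le_trans sg1.
have sgK : 0 <= K / sg by rewrite divr_ge0// ltW.
have Ksg : K / sg * (2 * d%:R) <= a / 2.
  rewrite mulrAC ler_pdivrMr// /sg.
  rewrite (_ : a / 2 * _ = a / 2 + K * (2 * d%:R)); last by field; rewrite gt_eqF.
  by rewrite lerDr divr_ge0// ltW.
pose D := \matrix_(i < d, j < d) (if i == j then rc (sg ^+ i) else 0).
pose D' := \matrix_(i < d, j < d) (if i == j then rc (sg ^- i) else 0).
have mulD n (X : 'M[C]_(n, d)) i j : (X *m D) i j = X i j * rc (sg ^+ j).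
  rewrite mxE (bigD1 j)//= mxE eqxx big1 ?addr0// => k kj.
  by rewrite mxE (negPf kj) mulr0.
have DD' : D *m D' = 1%:M.
  apply/matrixP => i j; rewrite mxE (bigD1 j)//= !mxE eqxx big1 ?addr0; last first.
    by move=> k kj; rewrite !mxE (negPf kj) mulr0.
  case: eqP => [->|_]; last by rewrite mul0r.
  by rewrite -rmorphM /= divff ?expf_neq0 ?gt_eqF.
pose S := P' *m D.
pose S' := D' *m P.
have SS' : S *m S' = 1%:M by rewrite /S /S' mulmxA -(mulmxA P') DD' mulmx1.
exists (d + d)%N, (row_mx (map_mx Re S) (map_mx Im S)),
  (col_mx (map_mx Re S') (- map_mx Im S')), (a / 2); split.
- by rewrite divr_gt0.
(* This is the real part of [S *m S' = 1%:M]. The right inverse is what lets [x *m Q] control [x],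
   although [Q] is not square. *)
- rewrite mul_row_col; apply/matrixP => i j.
  have := congr1 (fun M : 'M[C]_d => Re (M i j)) SS'.
  rewrite !mxE Re_sum => H.
  have -> : ((i == j)%:R : R) = Re ((i == j)%:R : C) by case: (i == j).
  rewrite -H -big_split; apply: eq_bigr => k _ /=.
  by rewrite !mxE ReM mulrN.
move=> x; pose z := map_mx rc x *m S.
have FS : map_mx rc (x *m F) *m S = map_mx rc x *m P' *m T *m D.
  have FP : FC *m P' = P' *m T by rewrite TE !mulmxA P'P mul1mx.
  by rewrite map_mxM -/FC /S mulmxA -[_ *m FC *m P']mulmxA FP mulmxA.
have N2 : enorm2 (x *m row_mx (map_mx Re S) (map_mx Im S)) = \sum_i csq (z ord0 i).
  rewrite mul_mx_row /enorm2 big_split_ord /= -big_split; apply: eq_bigr => i _ /=.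
  by rewrite row_mxEl row_mxEr /csq map_mul_Re map_mul_Im.
have ED : edot (x *m F *m row_mx (map_mx Re S) (map_mx Im S)) (x *m row_mx (map_mx Re S) (map_mx Im S))
   = \sum_j cdot ((map_mx rc (x *m F) *m S) ord0 j) (z ord0 j).
  rewrite !mul_mx_row /edot big_split_ord /= -big_split; apply: eq_bigr => i _ /=.
  by rewrite !row_mxEl !row_mxEr /cdot !map_mul_Re !map_mul_Im.
rewrite N2 ED FS mulr_sumr.
pose y := map_mx rc x *m P'.
have zE j : z ord0 j = y ord0 j * rc (sg ^+ j) by rewrite /z /S mulmxA mulD.
have step j : cdot ((y *m T *m D) ord0 j) (z ord0 j) <=
    - a * csq (z ord0 j) + \sum_i K / sg * (csq (z ord0 i) + csq (z ord0 j)).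
  rewrite mulD mxE mulr_suml cdot_sum (bigD1 j)//= [X in _ <= _ + X](bigD1 j)//=.
  rewrite mulrAC -zE cdot_mul_diag; apply: lerD.
    by rewrite ler_wpM2r// addr_ge0// sqr_ge0.
  apply: ler_wpDl.
    by rewrite mulr_ge0// !addr_ge0 ?sqr_ge0.
  apply: ler_sum => i ij.
  have [lij|lji] := ltnP i j.
    have -> : T i j = 0 by apply/eqP; move: trigT => /is_trig_mxP/(_ _ _ lij) ->.
    rewrite mulr0 mul0r /cdot /= !mul0r addr0.
    by rewrite mulr_ge0// !addr_ge0 ?sqr_ge0.
  have ltji : (j < i)%N by rewrite ltn_neqAle lji andbT eq_sym.
  (* Conjugation by [D] multiplies the entry [(i, j)] by [sg ^- (i - j)], which is at most [sg^-1]
     below the diagonal. *)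
  have -> : y ord0 i * T i j * rc (sg ^+ j) = z ord0 i * (T i j * rc (sg ^- (i - j))).
    rewrite zE (_ : sg ^+ i = sg ^+ (i - j) * sg ^+ j); last by rewrite -exprD subnK.
    rewrite rmorphM /= !mulrA.
    rewrite [X in _ = X](_ : _ = y ord0 i * T i j * rc (sg ^+ j) * (rc (sg ^+ (i - j)) * rc (sg ^- (i - j)))); last by ring.
    by rewrite -rmorphM divff ?expf_neq0 ?gt_eqF// mulr1.
  apply: le_trans (cdot_mul_le _ _ _) _; apply: ler_wpM2r.
    by rewrite !addr_ge0 ?sqr_ge0.
  have sgi : 0 <= sg ^- (i - j) <= sg^-1.
    rewrite invr_ge0 exprn_ge0 ?(ltW sg0)//= lef_pV2 ?posrE ?exprn_gt0//.
    by rewrite -[X in X <= _]expr1 ler_weXn2l// subn_gt0.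
  move: sgi => /andP[s0 s1].
  rewrite ReM ImM /= !mulr0 subr0 add0r !normrM (ger0_norm s0) -mulrDl.
  by apply: ler_pM => //; rewrite addr_ge0.
apply: le_trans (ler_sum _ (fun j _ => step j)) _.
rewrite big_split /= -!mulr_sumr.
set N := \sum_i csq (z ord0 i).
have NE : \sum_j \sum_i K / sg * (csq (z ord0 i) + csq (z ord0 j)) = K / sg * (2 * d%:R) * N.
  under eq_bigr do rewrite -mulr_sumr big_split /= sumr_const card_ord.
  rewrite -mulr_sumr big_split /= sumr_const card_ord -/N.
  rewrite sumrMnl -/N -(mulr_natl N d) -mulr2n -[RHS]mulrA; congr (_ * _).
  by rewrite -(mulr_natl (d%:R * N) 2) mulrA.
rewrite NE; have N0 : 0 <= N by apply: sumr_ge0 => i _; rewrite addr_ge0 ?sqr_ge0.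
rewrite -mulrDl; apply: ler_wpM2r => //.
by move: (K / sg * (2 * d%:R)) Ksg; clear => u; lra.
Qed.

End Lyapunov.

(** * The filter matrix and its eigenvalues *)

Section ObserverForm.
Variables (R : realType) (d : nat).
Local Notation C := (complex R).
Local Notation rc := (real_complex R).

(** Transpose of the usual observer matrix (shift minus output injection), since states are row
    vectors: component [j] of [xi *m observer_mx g] is component [j + 1] of [xi], or 0 past the end,
    minus the first component of [xi] times [g ord0 j]. *)
Definition observer_mx (g : 'rV[R]_d) : 'M[R]_d :=
  \matrix_(i, j) (((i : nat) == j.+1)%:R - ((i : nat) == 0%N)%:R * g ord0 j).

Definition last_row : 'rV[R]_d := \row_(i < d) (i.+1 == d)%:R.

Lemma sum_nat_delta (K : comNzRingType) (u : 'I_d -> K) (j : nat) :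
  \sum_(k < d) u k * ((k : nat) == j)%:R = if insub j is Some k then u k else 0.
Proof.
case: insubP => [k _ kj|jd].
  rewrite (bigD1 k)//= kj eqxx mulr1 big1 ?addr0// => i ik.
  by rewrite -kj -[(_ == _)]/(i == k) (negPf ik) mulr0.
rewrite big1// => i _; case: eqP => [ij|_]; last by rewrite mulr0.
by move: jd; rewrite -ij ltn_ord.
Qed.

Lemma observer_mxE (K : comNzRingType) (phi : {rmorphism R -> K}) (u : 'rV[K]_d) g j :
  (u *m map_mx phi (observer_mx g)) ord0 j =
  (if insub j.+1 is Some k then u ord0 k else 0) -
  (if insub 0%N is Some k then u ord0 k else 0) * phi (g ord0 j).
Proof.
rewrite -2!sum_nat_delta mulr_suml mxE -sumrB; apply: eq_bigr => i _.
by rewrite !mxE rmorphB rmorphM /= !rmorph_nat mulrBr mulrA.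
Qed.

(** The derivative of [xi - e G] receives the term Gamma xi from that of [e]. Together with the
    shift contained in [PhiC] it forms [observer_mx], and the only nonlinearity left is the bounded
    [phic]. *)
Lemma PhiC_observer (phic : 'rV[R]_d -> R) (xi g : 'rV[R]_d) :
  PhiC phic xi - (Gamma R d *m xi^T) ord0 ord0 *: g =
  xi *m observer_mx g - phic xi *: last_row.
Proof.
apply/rowP => j; have := observer_mxE idfun xi g j; rewrite map_mx_id// => E.
rewrite [LHS]mxE [RHS]mxE E !mxE.
under eq_bigr do rewrite !mxE mulrC.
rewrite sum_nat_delta; case: insubP => [k kd kj|jd] /=.
  by rewrite (ltn_eqF kd) mulr0 subr0.
have -> : j.+1 == d by rewrite eqn_leq ltn_ord leqNgt.
by rewrite mulr1 sub0r addrC.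
Qed.

(** The eigenvalues are [kappa] times the roots of the given polynomial. With [nu = l / kappa], the
    eigenvector equation is a recursion on the components, solved by [un 0 * kappa ^+ j * h j],
    where [h] runs through Horner's scheme at [nu]. The vanishing of component [d] says that the
    last Horner value, the polynomial at [nu], is zero. *)
Lemma observer_eigenvalue (c : 'I_d -> R) (kappa : R) (u : 'rV[C]_d) (l : C) :
  (0 < d)%N -> 0 < kappa -> Hurwitz (char_poly_of c) -> u != 0 ->
  u *m map_mx rc (observer_mx (gainG c kappa)) = l *: u -> complex.Re l < 0.
Proof.
move=> d0 k0 Hc u0 uE.
have [un [unv und unE]] : exists un : nat -> C, [/\ forall j : 'I_d, un j = u ord0 j, un d = 0 &
    forall j : 'I_d, un j.+1 = l * un j + un 0%N * rc (kappa ^+ j.+1 * c (rev_ord j))].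
  pose un (j : nat) := if insub j is Some k then u ord0 k else 0.
  have unv (j : 'I_d) : un j = u ord0 j by rewrite /un valK.
  exists un; split => // [|j]; first by rewrite /un insubF ?ltnn.
  have := congr1 (fun M : 'rV[C]_d => M ord0 j) uE.
  rewrite observer_mxE -/(un j.+1) -/(un 0%N) => /eqP; rewrite subr_eq => /eqP ->.
  by rewrite unv [(l *: u) _ _]mxE mxE.
have [cn cnE] : exists cn : nat -> C, forall i : 'I_d, cn i = rc (c i).
  by exists (fun j => if insub j is Some k then rc (c k) else 0) => i; rewrite valK.
have rk0 : rc kappa != 0 by rewrite fmorph_eq0 gt_eqF.
have [nu lE] : exists nu, l = nu * rc kappa by exists (l / rc kappa); rewrite divfK.
have revE (i : 'I_d) : (d.-1 - i)%N = rev_ord i by rewrite /= -subn1 -subnDA add1n.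
have [h [h0 hS]] : exists h : nat -> C, h 0%N = 1 /\
    forall j, h j.+1 = nu * h j + cn (d.-1 - j)%N.
  by exists (fix h (j : nat) : C := if j is j'.+1 then nu * h j' + cn (d.-1 - j')%N else 1).
have unh j : (j <= d)%N -> un j = un 0%N * rc kappa ^+ j * h j.
  elim: j => [|j IH] jd; first by rewrite expr0 h0 !mulr1.
  have U : un j.+1 = l * un j + un 0%N * rc (kappa ^+ j.+1 * c (rev_ord (Ordinal jd))).
    exact: (unE (Ordinal jd)).
  rewrite U (IH (ltnW jd)) rmorphM rmorphXn /= -cnE -revE lE.
  rewrite hS [in LHS]exprS [in RHS]exprS.
  by move: (un 0%N) (cn _) (h j) (rc kappa) => a1 a2 a3 a4; ring.
(* All components are multiples of the first one, so it cannot vanish in an eigenvector. *)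
have un0 : un 0%N != 0.
  apply: contraNneq u0 => un0; apply/eqP/rowP => j; rewrite mxE.
  by rewrite -unv (unh j (ltnW (ltn_ord j))) un0 !mul0r.
have hd : h d = 0.
  have := unh d (leqnn d); rewrite und => /esym/eqP.
  by rewrite !mulf_eq0 (negPf un0) expf_eq0 (negPf rk0) andbF => /eqP.
have hE j : (j <= d)%N -> h j = nu ^+ j + \sum_(i < j) cn (d.-1 - i)%N * nu ^+ (j.-1 - i).
  elim: j => [|j IH] jd; first by rewrite big_ord0 addr0 h0.
  rewrite hS (IH (ltnW jd)) big_ord_recr /= subnn expr0 mulr1 addrA mulrDr -exprS.
  congr (_ + _ + _); rewrite mulr_sumr; apply: eq_bigr => i _.
  rewrite mulrCA -exprS; congr (_ * _ ^+ _).
  by rewrite -subSn ?prednK//; [apply: leq_trans (ltn_ord i)|rewrite -ltnS prednK//; apply: leq_trans (ltn_ord i)].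
have : root (map_poly rc (char_poly_of c)) nu.
  rewrite /root /char_poly_of rmorphD rmorph_sum /= map_polyXn hornerD hornerXn horner_sum.
  apply/eqP; rewrite -[RHS]hd (hE d (leqnn d)); congr (_ + _).
  rewrite [LHS](reindex_inj rev_ord_inj) /=; apply: eq_bigr => i _.
  by rewrite map_polyZ map_polyXn hornerZ hornerXn revE cnE.
move=> /Hc; rewrite lE; case: (nu) => a b /=; rewrite mulr0 subr0 => a0.
by rewrite pmulr_llt0.
Qed.

Lemma observer_lyapunov (c : 'I_d -> R) (kappa : R) :
  (0 < d)%N -> 0 < kappa -> Hurwitz (char_poly_of c) ->
  exists m (Q : 'M[R]_(d, m)) (B : 'M[R]_(m, d)) (al : R),
    [/\ 0 < al, Q *m B = 1%:M &
      forall x : 'rV[R]_d, edot (x *m observer_mx (gainG c kappa) *m Q) (x *m Q)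
        <= - al * enorm2 (x *m Q)].
Proof.
move=> d0 k0 Hc; apply: lyapunov_of_eigenvalues => // u l u0 uE.
exact: observer_eigenvalue uE.
Qed.

End ObserverForm.

(** * Existence of solutions *)

Section Picard.
Variable R : realType.

(* Completeness and integration in the form used by Picard's iteration; both properties
   pass to row vectors and to products. *)
Definition geo_complete (V : normedModType R) : Prop :=
  forall (u : nat -> V) (C : R), (forall n, `|u n.+1 - u n| <= C * (1/2) ^+ n) ->
  exists l, forall n, `|u n - l| <= 2 * C * (1/2) ^+ n.

Definition has_primitives (V : normedModType R) : Prop :=
  forall g : R -> V, continuous g -> exists G : R -> V, G 0 = 0 /\
    forall t : R, -1 < t -> t < 1 -> is_derive t (1 : R) G (g t).

Lemma geo_complete_R : geo_complete R.
Proof.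
move=> u C H.
have C0 : 0 <= C by have := H 0%N; rewrite expr0 mulr1; apply: le_trans.
(* The radius is the tail of the geometric series, so the intervals from [a n] to [b n] are nested
   and the supremum of the left ends lies in all of them. *)
pose a n := u n - 2 * C * (1/2) ^+ n; pose b n := u n + 2 * C * (1/2) ^+ n.
have hn n : 0 <= (1 / 2 : R) ^+ n by rewrite exprn_ge0.
have aS n : a n <= a n.+1.
  by rewrite /a; have := H n; rewrite ler_norml exprS => /andP[]; lra.
have bS n : b n.+1 <= b n.
  by rewrite /b; have := H n; rewrite ler_norml exprS => /andP[]; lra.
have am n k : a n <= a (n + k)%N.
  by elim: k => [|k IH]; rewrite ?addn0// addnS (le_trans IH).
have bm n k : b (n + k)%N <= b n.
  by elim: k => [|k IH]; rewrite ?addn0// addnS (le_trans _ IH).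
have ab n : a n <= b n by rewrite /a /b; have := mulr_ge0 C0 (hn n); lra.
have abm n m : a n <= b m.
  by apply: le_trans (am n m) _; apply: le_trans (ab _) _; rewrite addnC bm.
have hs : has_sup (range a).
  split; first by exists (a 0%N), 0%N.
  by exists (b 0%N) => _ [n _ <-].
exists (sup (range a)) => n.
have H1 : a n <= sup (range a) by apply: ub_le_sup; [case: hs|exists n].
have H2 : sup (range a) <= b n by apply: ge_sup => [|_ [m _ <-]//]; case: hs.
by rewrite ler_norml; move: H1 H2; rewrite /a /b; lra.
Qed.

Lemma geo_complete_rV n : geo_complete 'rV[R]_n.
Proof.
move=> u C H.
have C0 : 0 <= C by have := H 0%N; rewrite expr0 mulr1; apply: le_trans.
have /choice [l Hl] : forall i, exists l, forall k, `|u k ord0 i - l| <= 2 * C * (1/2) ^+ k.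
  move=> i; apply: geo_complete_R => k; apply: le_trans (H k).
  by apply: le_trans (norm_rV_coord _ i); rewrite !mxE.
exists (\row_i l i) => k; apply: norm_rV_le => [|i].
  by rewrite !mulr_ge0// exprn_ge0.
by rewrite !mxE Hl.
Qed.

Lemma geo_complete_prod (U V : normedModType R) :
  geo_complete U -> geo_complete V -> geo_complete (U * V)%type.
Proof.
move=> HU HV u C H.
have [l1 H1] : exists l, forall n, `|(u n).1 - l| <= 2 * C * (1/2) ^+ n.
  by apply: HU => n; apply: le_trans (H n); rewrite [leRHS]prod_normE /= le_max lexx.
have [l2 H2] : exists l, forall n, `|(u n).2 - l| <= 2 * C * (1/2) ^+ n.
  by apply: HV => n; apply: le_trans (H n); rewrite [leRHS]prod_normE /= le_max lexx orbT.
by exists (l1, l2) => n; rewrite prod_normE /= ge_max H1 H2.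
Qed.

Lemma has_primitives_R : has_primitives R.
Proof.
move=> g cg.
(* Starting the integral at -1 makes 0 an interior point; the value at 0 is subtracted
   afterwards. *)
pose F (x : R) : R := (\int[lebesgue_measure]_(t in `[-1, x]) g t)%R.
exists (fun t => F t - F 0); split; first by rewrite subrr.
move=> t t1 t2.
have ig : lebesgue_measure.-integrable `[-1, 1] (EFin \o g).
  apply: continuous_compact_integrable; first exact: segment_compact.
  exact: continuous_subspaceT.
have [dF vF] := @continuous_FTC1 R g (BLeft (-1)) t 1 t2 ig t1 (cg t).
have D : is_derive t (1 : R) F (g t) by apply: DeriveDef; [exact: dF|rewrite -derive1E].
have -> : (fun s => F s - F 0) = F - cst (F 0) by apply/funext.
by apply: is_derive_eq; rewrite subr0.
Qed.

Lemma has_primitives_rV n : has_primitives 'rV[R]_n.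
Proof.
move=> g cg.
have /choice [G HG] : forall i : 'I_n, exists G : R -> R, G 0 = 0 /\
    forall t : R, -1 < t -> t < 1 -> is_derive t (1 : R) G (g t ord0 i).
  move=> i; apply: (has_primitives_R (g := fun t => g t ord0 i)) => t.
  have C : {for g t, continuous (fun v : 'rV[R]_n => v ord0 i)}.
    by apply: differentiable_continuous; apply: differentiable_coord.
  exact: (cvg_comp _ _ (cg t) C).
exists (fun t => \row_i G i t); split.
  by apply/rowP => i; rewrite !mxE; have [] := HG i.
move=> t t1 t2; apply: is_derive_row => i.
have [_ /(_ t t1 t2) D] := HG i; apply: is_derive_ext D.
by apply/nbhs_ballP; exists 1 => //= s _; rewrite mxE.
Qed.

Lemma has_primitives_prod (U V : normedModType R) :
  has_primitives U -> has_primitives V -> has_primitives (U * V)%type.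
Proof.
move=> HU HV g cg.
have c1 : continuous (fun t => (g t).1).
  by move=> t; exact: (cvg_comp _ _ (cg t) (loclip_continuous (@loclip_fst R U V) (x := g t))).
have c2 : continuous (fun t => (g t).2).
  by move=> t; exact: (cvg_comp _ _ (cg t) (loclip_continuous (@loclip_snd R U V) (x := g t))).
have [G1 [G10 H1]] := HU _ c1.
have [G2 [G20 H2]] := HV _ c2.
exists (fun t => (G1 t, G2 t)); split; first by rewrite G10 G20.
by move=> t t1 t2; have := is_derive_pr (H1 t t1 t2) (H2 t t1 t2); case: (g t).
Qed.

Lemma le_geo (a b C : R) : (forall n, a <= b + C * (1/2) ^+ n) -> a <= b.
Proof.
move=> H; apply/ler_addgt0Pr => e e0.
have C1 : 0 < `|C| + 1 by rewrite ltr_wpDl.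
have [n Hn] : exists n, (`|C| + 1) * (1/2) ^+ n < e.
  have h : (1/2 : R) ^+ n @[n --> \oo] --> (0 : R).
    by apply: (@cvg_expr _ (1/2 : R)); rewrite ger0_norm; lra.
  have /cvgrPdist_lt /(_ _ (divr_gt0 e0 C1)) [n _ Hn] := h.
  exists n; have := Hn n (leqnn n); rewrite /= sub0r normrN ger0_norm ?exprn_ge0//.
  by rewrite ltr_pdivlMr// mulrC.
apply: le_trans (H n) _; rewrite lerD2l; apply: le_trans (ltW Hn).
by rewrite ler_wpM2r ?exprn_ge0// (le_trans (ler_norm _))// lerDl.
Qed.

Lemma mvt_sym (V : normedModType R) (g dg : R -> V) (de C s t : R) :
  (forall z, `|z| <= de -> is_derive z (1 : R) g (dg z) /\ `|dg z| <= C) ->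
  `|s| <= de -> `|t| <= de -> `|g t - g s| <= C * `|t - s|.
Proof.
move=> H; wlog st : s t / s <= t.
  move=> W hs ht; have [st|/ltW ts] := leP s t; first exact: W.
  by rewrite distrC (distrC t); apply: W.
move=> hs ht; rewrite (ger0_norm (_ : 0 <= t - s)) ?subr_ge0//.
have B z : s <= z -> z <= t -> `|z| <= de.
  by move: hs ht; rewrite !ler_norml => /andP[? ?] /andP[? ?] ? ?; apply/andP; split; lra.
apply: (mvt_norm (dg := dg)) => //.
  apply: derivable_within_continuous => z; rewrite in_itv /= => /andP[sz zt].
  by have [[]] := H z (B z sz zt).
by move=> z sz zt; apply: H; apply: B; apply: ltW.
Qed.

End Picard.

Section PicardLindelof.
Variable R : realType.

Lemma clamp_lipschitz (a b t s : R) : a <= b ->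
  `|Num.max a (Num.min t b) - Num.max a (Num.min s b)| <= `|t - s|.
Proof.
move=> ab; wlog st : s t / s <= t.
  move=> H; have [st|/ltW ts] := leP s t; first exact: H.
  by rewrite distrC (distrC t); apply: H.
have mono : Num.max a (Num.min s b) <= Num.max a (Num.min t b).
  by rewrite ge_max le_max lexx/= le_max le_min !ge_min st lexx !orbT.
rewrite !ger0_norm ?subr_ge0// /Num.max /Num.min.
by repeat case: ifPn; rewrite -?leNgt => *; lra.
Qed.

(** The life span [de] is common to all initial points near [p]. This uniformity is what allows a
    solution to be continued from an accumulation point of its past values. *)
Lemma picard (V : normedModType R) (F : V -> V) :
  geo_complete V -> has_primitives V -> locally_lipschitz F ->
  forall p, exists rho de : R, [/\ 0 < rho, 0 < de & forall x0, `|x0 - p| < rho ->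
    exists x : R -> V, x 0 = x0 /\
      forall t, `|t| < de -> is_derive t (1 : R) x (F (x t))].
Proof.
move=> gV pV /loclipP HF p; have [d [k [d0 k0 L]]] := HF p.
pose rho := d / 3; have rho0 : 0 < rho by rewrite divr_gt0.
have rd : d = 3 * rho by rewrite /rho; field.
pose Mx := `|F p| + k * d.
have Mx0 : 0 <= Mx by rewrite addr_ge0// ltW// mulr_gt0.
have Mx1 : 0 < Mx + 1 by rewrite ltr_wpDl.
(* The three bounds keep time inside the interval where primitives exist, make the iteration
   contract by one half, and confine the curves to the ball of radius [rho] around [x0]. *)
pose de := Num.min (1/2) (Num.min (1 / (2 * k)) (rho / (Mx + 1))).
have de0 : 0 < de by rewrite !lt_min !divr_gt0// mulr_gt0.
have de1 : de <= 1/2 by rewrite ge_min lexx.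
have dek : k * de <= 1/2.
  have : de <= 1 / (2 * k) by rewrite !ge_min lexx orbT.
  by rewrite ler_pdivlMr ?mulr_gt0// mulrCA (mulrC de); lra.
have deM : Mx * de <= rho.
  have : de <= rho / (Mx + 1) by rewrite !ge_min lexx !orbT.
  rewrite ler_pdivlMr// mulrDr mulr1 (mulrC Mx) => H.
  by apply: le_trans H; rewrite lerDl ltW.
clearbody de; clearbody rho.
exists rho, de; split => // x0 hx0.
have inball v : `|v - x0| <= rho -> `|v - p| < d.
  move=> hv; rewrite -(subrKA x0); apply: le_lt_trans (ler_normD _ _) _; lra.
have LF u v : `|u - x0| <= rho -> `|v - x0| <= rho -> `|F u - F v| <= k * `|u - v|.
  by move=> hu hv; apply: L; apply: inball.
have FM v : `|v - x0| <= rho -> `|F v| <= Mx.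
  move=> hv; rewrite -(subrK (F p) (F v)); apply: le_trans (ler_normD _ _) _.
  rewrite addrC lerD2l; apply: le_trans (L _ _ (inball _ hv) _) _; first by rewrite subrr normr0.
  by rewrite ler_pM2l// ltW// inball.
(* The Lipschitz bound is carried along with the confinement because it makes the next integrand
   continuous. *)
pose good (x : R -> V) := (forall t, `|t| <= de -> `|x t - x0| <= rho) /\
  (forall s t, `|s| <= de -> `|t| <= de -> `|x t - x s| <= Mx * `|t - s|).
(* Time is clamped because [has_primitives] asks for an integrand continuous on the whole line. *)
pose ct t := Num.max (- de) (Num.min t de).
have ctb t : `|ct t| <= de.
  rewrite ler_norml /ct le_max lexx ge_max ge_min lexx orbT andbT; lra.
have cte t : `|t| <= de -> ct t = t.
  by rewrite ler_norml /ct => /andP[t1 t2]; rewrite (min_idPl t2) (max_idPr t1).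
have ctl t s : `|ct t - ct s| <= `|t - s| by apply: clamp_lipschitz; rewrite ge0_cp ?ltW.
have step (x : {x | good x}) : exists y : {x | good x}, sval y 0 = x0 /\
    forall t, `|t| <= de -> is_derive t (1 : R) (sval y) (F (sval x t)).
  case: x => x [gx1 gx2] /=.
  have cg : continuous (fun t => F (x (ct t))).
    apply: loclip_continuous; apply: (@loclip_bound _ _ _ _ (k * Mx)).
      by rewrite mulr_ge0// ltW.
    move=> t s; apply: le_trans (LF _ _ (gx1 _ (ctb t)) (gx1 _ (ctb s))) _.
    rewrite -mulrA ler_pM2l//; apply: le_trans (gx2 _ _ (ctb s) (ctb t)) _.
    by rewrite ler_wpM2l.
  have [G [G0 dG]] := pV _ cg.
  pose y t := x0 + G t.
  have dy t : `|t| <= de -> is_derive t (1 : R) y (F (x t)).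
    move=> td; have := td; rewrite ler_norml => /andP[t1 t2].
    have := dG t ltac:(lra) ltac:(lra); rewrite cte// => /is_deriveP H.
    apply/is_deriveP => e e0; have [r r0 Hr] := H e e0; exists r => // h hr.
    by rewrite /y opprD addrACA subrr add0r; apply: Hr.
  have dyM t : `|t| <= de -> is_derive t (1 : R) y (F (x t)) /\ `|F (x t)| <= Mx.
    by move=> td; split; [exact: dy|apply: FM; exact: gx1].
  have y0 : y 0 = x0 by rewrite /y G0 addr0.
  have n0 : `|0 : R| <= de by rewrite normr0 ltW.
  have gy2 s t : `|s| <= de -> `|t| <= de -> `|y t - y s| <= Mx * `|t - s|.
    by move=> sd td; apply: (mvt_sym dyM).
  have gy : good y.
    split => // t td; rewrite -{1}y0; apply: le_trans (gy2 _ _ n0 td) _.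
    by rewrite subr0; apply: le_trans deM; rewrite ler_wpM2l.
  by exists (exist _ y gy).
have [op Hop] := choice step.
have g0 : good (fun=> x0).
  split=> [t _|s t _ _]; rewrite subrr normr0; first exact: ltW.
  exact: mulr_ge0.
pose it n := iter n op (exist _ _ g0).
have gr1 (x : {x | good x}) t : `|t| <= de -> `|sval x t - x0| <= rho by case: x => x [/= H _]; apply: H.
have gr2 (x : {x | good x}) s t : `|s| <= de -> `|t| <= de -> `|sval x t - sval x s| <= Mx * `|t - s|.
  by case: x => x [/= _ H]; apply: H.
have contr (x x' : {x | good x}) C : (forall t, `|t| <= de -> `|sval x t - sval x' t| <= C) ->
    forall t, `|t| <= de -> `|sval (op x) t - sval (op x') t| <= C / 2.
  move=> H t td; have [y0 dy] := Hop x; have [y'0 dy'] := Hop x'.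
  have C0 : 0 <= C by apply: le_trans (H t td).
  have D z : `|z| <= de -> is_derive z (1 : R) (sval (op x) \- sval (op x')) (F (sval x z) - F (sval x' z)) /\
      `|F (sval x z) - F (sval x' z)| <= k * C.
    move=> zd; have D1 := dy z zd; have D2 := dy' z zd; split; first exact: is_deriveB.
    by apply: le_trans (LF _ _ _ _) _; rewrite ?gr1// ler_pM2l// H.
  have n0 : `|0 : R| <= de by rewrite normr0 ltW.
  have := mvt_sym D n0 td; rewrite /= y0 y'0 subrr !subr0 => H1.
  apply: le_trans H1 _; apply: le_trans (_ : k * C * de <= _).
    by rewrite ler_wpM2l// mulr_ge0// ltW.
  by rewrite mulrAC; have := ler_wpM2r C0 dek; lra.
have dist n t : `|t| <= de -> `|sval (it n.+1) t - sval (it n) t| <= 2 * rho * (1/2) ^+ n.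
  elim: n t => [|n IH] t td.
    rewrite expr0 mulr1 -(subrKA x0); apply: le_trans (ler_normD _ _) _.
    by have := gr1 (it 1%N) t td; have := gr1 (it 0%N) t td; rewrite (distrC x0); lra.
  rewrite exprS; have := contr (it n.+1) (it n) _ IH t td; rewrite /it !iterS; lra.
have /choice [l Hl] : forall t, exists l, `|t| <= de -> forall n,
    `|sval (it n) t - l| <= 2 * (2 * rho) * (1/2) ^+ n.
  move=> t; have [td|td] := pselect (`|t| <= de); last by exists 0.
  have [l Hl] := gV (fun n => sval (it n) t) (2 * rho) (fun n => dist n t td).
  by exists l.
have gl : good l.
  split=> [t td|s t sd td].
    apply: (@le_geo _ _ _ (2 * (2 * rho))) => n.
    rewrite -(subrKA (sval (it n) t)); apply: le_trans (ler_normD _ _) _.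
    by have := Hl t td n; have := gr1 (it n) t td; rewrite (distrC (l t)); lra.
  apply: (@le_geo _ _ _ (2 * (2 * (2 * rho)))) => n.
  apply: le_trans (norm_triangle3 _ (sval (it n) t) (sval (it n) s) _) _.
  by have := Hl t td n; have := Hl s sd n; have := gr2 (it n) s t sd td; rewrite (distrC (l t)); lra.
(* The pointwise limit [l] is not known to be differentiable, whereas its image under the iteration
   is; contraction shows that both agree on the interval. *)
pose y := op (exist _ l gl).
have [y0 dy] := Hop (exist _ l gl).
have yl t : `|t| <= de -> sval y t = l t.
  move=> td; apply/eqP; rewrite -subr_eq0 -normr_le0; apply: (@le_geo _ _ _ (4 * rho)) => n.
  rewrite -(subrKA (sval (it n.+1) t)); apply: le_trans (ler_normD _ _) _.
  have H1 : `|sval y t - sval (it n.+1) t| <= 2 * (2 * rho) * (1/2) ^+ n / 2.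
    rewrite /y /it iterS; apply: contr => // z zd /=; rewrite distrC.
    exact: Hl.
  by have := Hl t td n.+1; rewrite exprS; lra.
exists (sval y); split=> // t /ltW td.
by rewrite yl//; apply: dy.
Qed.

End PicardLindelof.

(** * The encoder *)

Section Quantizer.
Variable R : realType.

(** Up to the sign, [N |e| / l] is rounded to a nearest integer for odd [N] and to a nearest
    half-integer for even [N], so the error is at most half a cell. A zero range forces [e = 0]. *)
Lemma quantize_err (N : nat) (l e : R) : (0 < N)%N -> 0 <= l -> `|e| <= l ->
  `|e - l / N%:R * quantize N l e| <= l / (2 * N%:R).
Proof.
move=> N0 l0 el; have N0' : 0 < N%:R :> R by rewrite ltr0n.
have [l00|ln0] := eqVneq l 0.
  by move: el; rewrite l00 normr_le0 => /eqP ->; rewrite !mul0r subrr normr0.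
have lp : 0 < l by rewrite lt_neqAle eq_sym ln0.
rewrite /quantize; set x := N%:R * `|e| / l; set q := (if _ then _ else _).
have xq : e != 0 -> `|x - q| <= 1 / 2.
  move=> e0; have xp : 0 < x by rewrite divr_gt0// mulr_gt0// normr_gt0.
  rewrite /q ler_norml; case: ifP => _.
    by have := ceil_itv (x - 1/2); rewrite intrB => /andP[]; lra.
  by have := ceil_itv x; rewrite intrB => /andP[]; lra.
have [->|e0] := eqVneq e 0; first by rewrite sgr0 mul0r mulr0 subrr normr0 divr_ge0// mulr_ge0// ler0n.
have -> : e - l / N%:R * (Num.sg e * q) = Num.sg e * (l / N%:R) * (x - q).
  rewrite {1}[e]numEsg /x; field; apply/andP; split; rewrite gt_eqF//.
have lN : 0 <= l / N%:R by exact: divr_ge0 l0 (ltW N0').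
rewrite normrM [X in X * _]normrM normr_sg e0 mul1r (ger0_norm lN).
rewrite (_ : l / (2 * N%:R) = l / N%:R * (1 / 2)); last by field; rewrite gt_eqF.
by rewrite ler_wpM2l ?xq.
Qed.

End Quantizer.

Section Exosystem.
Variable R : realType.

Lemma invariant_solution (V : normedModType R) (s : V -> V) (S : set V) x0 (a : R) :
  invariant_set s S -> S x0 -> exists psi : R -> V, [/\ psi a = x0,
    forall t, is_derive t (1 : R) psi (s (psi t)) & forall t, S (psi t)].
Proof.
move=> inv /inv [x [x0E dx Sx]]; exists (fun t => x (t - a)); split=> [|t|t //].
  by rewrite subrr.
exact: is_derive_shiftl.
Qed.

Lemma is_derive_shiftr (V : normedModType R) (f : R -> V) (t a : R) (l : V) :
  is_derive (t + a) (1 : R) f l -> is_derive t (1 : R) (fun s => f (s + a)) l.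
Proof.
move=> H; have : is_derive t (1 : R) (fun s => f (s - (- a))) l.
  by apply: is_derive_shiftl; rewrite opprK.
by apply: is_derive_ext; apply/nbhs_ballP; exists 1 => //= z _; rewrite opprK.
Qed.

Lemma flow_solution (V : normedModType R) (s : V -> V) (psi : R -> V) (a : R) b :
  (forall t, is_derive t (1 : R) psi (s (psi t))) -> solution s b (fun t => psi (t + a)).
Proof.
move=> H; have D t : is_derive t (1 : R) (fun t => psi (t + a)) (s (psi (t + a))).
  exact: is_derive_shiftr.
split=> [|t _ _]; last exact: D.
by apply: continuous_subspaceT => t; exact: is_derive_cont (D t).
Qed.

Lemma upto_within (V : normedModType R) (g : R -> V) (b : \bar R) (a t : R) :
  {within upto b, continuous g} -> 0 <= a -> (t%:E < b)%E -> {within `[a, t], continuous g}.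
Proof.
move=> cg a0 tb; apply: continuous_subspaceW cg => u /=; rewrite in_itv /= => /andP[au ut].
split; first exact: le_trans au.
by apply: le_lt_trans tb; rewrite lee_fin.
Qed.

Lemma solution_unique (V : normedModType R) (s : V -> V) (b : \bar R) (w psi : R -> V) :
  locally_lipschitz s -> solution s b w -> (forall t, is_derive t (1 : R) psi (s (psi t))) ->
  w 0 = psi 0 -> forall t, upto b t -> w t = psi t.
Proof.
move=> ls [cw dw] dpsi E t [t0 tb].
apply: (ode_unique (a := 0) (b := t) ls _ _ _ _ E) => //.
- exact: upto_within cw _ tb.
- by apply: continuous_subspaceT => u; exact: is_derive_cont (dpsi u).
- by move=> u u0 ut; apply: dw => //; apply: lt_trans tb; rewrite lte_fin.
Qed.

Lemma within_cont_right (V : normedModType R) (g : R -> V) (a b : R) :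
  g t @[t --> a^'+] --> g a -> (forall u, a < u -> u <= b -> {for u, continuous g}) ->
  {within `[a, b], continuous g}.
Proof.
move=> ga gu; apply: within_contP => u au ub e e0.
have [<-|ne] := eqVneq a u.
  have /cvgrPdist_lt/(_ _ e0) /nbhs_ballP [d d0 Hd] := ga.
  exists d => // z az zb zd; have [->|az'] := eqVneq z a; first by rewrite subrr normr0.
  rewrite distrC; apply: Hd; first by rewrite /ball /= distrC.
  by rewrite lt_neqAle az eq_sym az'.
have au' : a < u by rewrite lt_neqAle ne.
have /cvgrPdist_lt/(_ _ e0) /nbhs_ballP [d d0 Hd] := gu u au' ub.
by exists d => // z az zb zd; rewrite distrC; apply: Hd; rewrite /ball /= distrC.
Qed.

Lemma at_left_ex (a : R) (Q : R -> Prop) : (\forall u \near a^'-, Q u) -> exists u, Q u.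
Proof.
move=> /nbhs_ballP [e /= e0 He]; exists (a - e / 2).
have e20 : 0 < e / 2 by rewrite divr_gt0.
apply: He; last by rewrite gtrBl.
by rewrite /ball /= opprB addrC subrK gtr0_norm//; lra.
Qed.

End Exosystem.

Section Encoder.
Variables (R : realType) (p r n d N : nat).
Variables (s : 'rV[R]_r -> 'rV[R]_r) (yr : 'rV[R]_r -> R)
  (f : 'rV[R]_n -> R -> 'rV[R]_p -> 'rV[R]_n) (q : 'rV[R]_n -> R -> 'rV[R]_p -> R)
  (phic : 'rV[R]_d -> R) (c : 'I_d -> R) (lev : nat -> R) (T kappa k : R)
  (mu : 'rV[R]_p) (b : \bar R) (X : signals R r n d).
Hypothesis T0 : 0 < T.
Hypothesis traj : trajectory s yr f q phic c N lev T kappa k mu b X.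

Lemma no_sampling_between (j : nat) (t : R) :
  j%:R * T < t -> t < j.+1%:R * T -> forall i : nat, t <> i%:R * T.
Proof.
move=> jt tj i E; move: jt tj; rewrite E !ltr_pM2r// !ltr_nat => ji.
by rewrite ltnS leqNgt ji.
Qed.

(** Right continuity at the reset and the differential equation up to the next sample are all that
    [ode_unique] requires, so the past of [wd_] before the jump is irrelevant. *)
Lemma traj_segment (j : nat) (psi : R -> 'rV[R]_r) : locally_lipschitz s ->
  ((j%:R * T)%:E < b)%E -> (forall t, is_derive t (1 : R) psi (s (psi t))) ->
  wd_ X (j%:R * T) = psi (j%:R * T) ->
  forall t, j%:R * T <= t -> t < j.+1%:R * T -> (t%:E < b)%E -> wd_ X t = psi t.
Proof.
move=> ls jb dpsi E t jt tj tb.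
have j0 : 0 <= j%:R * T by rewrite mulr_ge0// ?ler0n// ltW.
have D u : j%:R * T < u -> u <= t -> is_derive u (1 : R) (wd_ X) (s (wd_ X u)).
  move=> ju ut; have u0 : 0 < u by exact: le_lt_trans ju.
  have ub : (u%:E < b)%E by apply: le_lt_trans tb; rewrite lee_fin.
  have uT := no_sampling_between ju (le_lt_trans ut tj).
  by have [] := traj_flow traj u0 ub uT.
have C1 : {within `[j%:R * T, t], continuous (wd_ X)}.
  apply: within_cont_right; first exact: (traj_wd_right traj jb).
  by move=> ? ju ut; exact: is_derive_cont (D _ ju ut).
have C2 : {within `[j%:R * T, t], continuous psi}.
  by apply: continuous_subspaceT => v; exact: is_derive_cont (dpsi v).
have D1 z : j%:R * T < z -> z < t -> is_derive z (1 : R) (wd_ X) (s (wd_ X z)).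
  by move=> ju ut; apply: D => //; apply: ltW.
exact: (ode_unique ls C1 C2 D1 (fun u _ _ => dpsi u) E).
Qed.

Lemma traj_segment_end (j : nat) (psi : R -> 'rV[R]_r) : locally_lipschitz s ->
  ((j.+1%:R * T)%:E < b)%E -> (forall t, is_derive t (1 : R) psi (s (psi t))) ->
  wd_ X (j%:R * T) = psi (j%:R * T) -> wdm_ X j.+1 = psi (j.+1%:R * T).
Proof.
move=> ls jb dpsi E.
have jj : j%:R * T < j.+1%:R * T by rewrite ltr_pM2r// ltr_nat.
have jb' : ((j%:R * T)%:E < b)%E by apply: lt_trans jb; rewrite lte_fin.
have H := traj_segment ls jb' dpsi E.
have L1 := traj_wd_left traj (ltn0Sn j) jb.
have L2 : psi t @[t --> (j.+1%:R * T)^'-] --> psi (j.+1%:R * T).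
  by apply: cvg_at_left_filter; exact: is_derive_cont (dpsi _).
apply/eqP; rewrite -subr_eq0 -normr_le0; apply/ler_addgt0Pr => e e0; rewrite add0r.
have [u [u1 u2 u3]] : exists u, [/\ wd_ X u = psi u, `|wdm_ X j.+1 - wd_ X u| < e / 2 &
    `|psi (j.+1%:R * T) - psi u| < e / 2].
  have e2 : 0 < e / 2 by rewrite divr_gt0.
  have P1 : \forall u \near (j.+1%:R * T)^'-, wd_ X u = psi u.
    near=> u; have ub : u < j.+1%:R * T by near: u; exact: nbhs_left_lt.
    apply: H => //; last by apply: lt_trans jb; rewrite lte_fin.
    by apply: ltW; near: u; exact: nbhs_left_gt.
  have P2 : \forall u \near (j.+1%:R * T)^'-, `|wdm_ X j.+1 - wd_ X u| < e / 2.
    by move/cvgrPdist_lt: L1; apply.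
  have P3 : \forall u \near (j.+1%:R * T)^'-, `|psi (j.+1%:R * T) - psi u| < e / 2.
    by move/cvgrPdist_lt: L2; apply.
  have : \forall u \near (j.+1%:R * T)^'-, [/\ wd_ X u = psi u, `|wdm_ X j.+1 - wd_ X u| < e / 2 &
    `|psi (j.+1%:R * T) - psi u| < e / 2].
    by near=> u; split; near: u.
  exact: at_left_ex.
rewrite -(subrKA (wd_ X u)); apply: le_trans (ler_normD _ _) _.
by rewrite {2}u1 (distrC (psi u)); lra.
Unshelve. all: by end_near. Qed.

End Encoder.

Section EncoderInvariant.
Variables (R : realType) (p r n d N : nat).
Variables (s : 'rV[R]_r -> 'rV[R]_r) (yr : 'rV[R]_r -> R)
  (f : 'rV[R]_n -> R -> 'rV[R]_p -> 'rV[R]_n) (q : 'rV[R]_n -> R -> 'rV[R]_p -> R)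
  (phic : 'rV[R]_d -> R) (c : 'I_d -> R) (W0 W : set 'rV[R]_r) (M : R -> R).

Lemma enorm_le_coord (v : 'rV[R]_r) (l : R) : 0 <= l -> (forall i, `|v ord0 i| <= l) ->
  enorm v <= Num.sqrt r%:R * l.
Proof.
move=> l0 H; rewrite -[X in _ * X](ger0_norm l0) -sqrtr_sqr -sqrtrM ?ler0n//.
rewrite enormE ler_sqrt ?mulr_ge0 ?ler0n ?sqr_ge0//.
apply: le_trans (enorm2_le_norm v) _; rewrite ler_wpM2l ?ler0n//.
by rewrite lerXn2r ?nnegrE// norm_rV_le.
Qed.

Lemma coord_le_enorm (v : 'rV[R]_r) i : `|v ord0 i| <= enorm v.
Proof. by rewrite -sqrtr_sqr enormE ler_sqrt ?enorm2_ge0// coord_le_enorm2. Qed.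

Lemma initial_rangeP (x y : 'rV[R]_r) i : compact W0 -> W0 x -> W0 y ->
  `|x ord0 i - y ord0 i| <= initial_range W0.
Proof.
move=> /compact_bounded [B [_ HB]] Wx Wy; apply: ub_le_sup; last by exists i, x, y.
exists (2 * (B + 1)) => _ [j [u [v [Wu Wv ->]]]].
have Hu := HB (B + 1) ltac:(by rewrite ltrDl) u Wu.
have Hv := HB (B + 1) ltac:(by rewrite ltrDl) v Wv.
apply: le_trans (ler_normB _ _) _.
have := le_trans (norm_rV_coord u j) Hu; have := le_trans (norm_rV_coord v j) Hv; lra.
Qed.

Lemma initial_range_ge0 : compact W0 -> 0 <= initial_range W0.
Proof.
move=> cW0; have [[l [i [x [y [Wx Wy _]]]]]|ne] := pselect (exists l, exists (i : 'I_r) (x y : 'rV[R]_r),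
         [/\ W0 x, W0 y & l = `|x ord0 i - y ord0 i|]).
  exact: le_trans (normr_ge0 _) (initial_rangeP i cW0 Wx Wy).
(* If [W0] is empty or [r = 0], the range is the supremum of the empty set, whose value is 0. *)
rewrite /initial_range (_ : [set l | _] = set0) ?sup0//.
by apply/seteqP; split => // l Hl; apply: ne; exists l.
Qed.

Lemma edist_le_enorm (S : set 'rV[R]_r) x y : S y -> Defs.edist S x <= enorm (x - y).
Proof.
move=> Sy; apply: ge_inf; last by exists y.
by exists 0 => _ [z _ <-]; apply: sqrtr_ge0.
Qed.

(** By induction every coordinate error before reset [j] is at most [lev j]. The reset leaves a
    Euclidean error of at most [sqrt r * lev j / (2 N)], which grows by at most [M T] until the next
    sample and so stays below [lev j.+1], with a factor 2 to spare. As [sqrt r * M T < N] makes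
    [lev] nonincreasing, the error after a reset never exceeds the margin around [W0] granted by
    [assumption_A1]. *)
Lemma encoder_invariant (T kappa k : R) (mu : 'rV[R]_p) (b : \bar R) (X : signals R r n d) :
  (0 < N)%N -> assumption_A0 s W0 -> assumption_A1 s W0 W N -> divergence_bound s W M ->
  0 < T -> Num.sqrt r%:R * M T < N%:R ->
  trajectory s yr f q phic c N (chan_range r N (M T) (initial_range W0)) T kappa k mu b X ->
  W0 (w_ X 0) -> W0 (wdm_ X 0%N) ->
  forall j : nat, ((j%:R * T)%:E < b)%E -> W (wd_ X (j%:R * T)).
Proof.
move=> N0 [ls cW0 invW0] [cW W0W invW distW] [M0 Mmono M1 Mdiv] T0 MT traj w0 wd0.
set lev := chan_range _ _ _ _ in traj.
have N0' : 0 < N%:R :> R by rewrite ltr0n.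
have L00 := initial_range_ge0 cW0.
have MT0 : 0 < M T by apply: M0; exact: ltW.
have sr0 : 0 <= Num.sqrt r%:R :> R by exact: sqrtr_ge0.
pose q1 := Num.sqrt r%:R * (M T / N%:R).
have q10 : 0 <= q1 by rewrite mulr_ge0// divr_ge0// ltW.
have q11 : q1 <= 1 by rewrite /q1 mulrA ler_pdivrMr// mul1r ltW.
have levS j : lev j.+1 = q1 * lev j by [].
have lev0 j : 0 <= lev j by elim: j => [//|j IH]; rewrite levS mulr_ge0.
have levL j : lev j <= initial_range W0.
  elim: j => [//|j IH]; rewrite levS; apply: le_trans IH.
  by rewrite -[leRHS]mul1r ler_wpM2r.
have [om [om0 dom Wom]] := invariant_solution 0 invW0 w0.
have wom : forall t, upto b t -> w_ X t = om t by exact: solution_unique (traj_w traj) dom (esym om0).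
have reset j : ((j%:R * T)%:E < b)%E ->
    (forall i, `|w_ X (j%:R * T) ord0 i - wdm_ X j ord0 i| <= lev j) ->
    enorm (w_ X (j%:R * T) - wd_ X (j%:R * T)) <= Num.sqrt r%:R * (lev j / (2 * N%:R)).
  move=> jb Hj; apply: enorm_le_coord => [|i]; first by rewrite divr_ge0// mulr_ge0// ltW.
  have := quantize_err N0 (lev0 j) (Hj i).
  by rewrite (traj_wd_reset traj jb) !mxE opprD addrA.
have inW j : ((j%:R * T)%:E < b)%E ->
    (forall i, `|w_ X (j%:R * T) ord0 i - wdm_ X j ord0 i| <= lev j) -> W (wd_ X (j%:R * T)).
  move=> jb Hj; apply: contrapT => /distW; apply/negP; rewrite -leNgt.
  have jT0 : 0 <= j%:R * T by rewrite mulr_ge0// ?ler0n// ltW.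
  have Ww : W0 (w_ X (j%:R * T)) by rewrite wom.
  apply: le_trans (edist_le_enorm _ Ww) _.
  rewrite -opprB enormE enorm2N -enormE; apply: le_trans (reset j jb Hj) _.
  by rewrite ler_wpM2l// ler_wpM2r// invr_ge0 mulr_ge0// ltW.
suff Hall j : ((j%:R * T)%:E < b)%E ->
    forall i, `|w_ X (j%:R * T) ord0 i - wdm_ X j ord0 i| <= lev j.
  by move=> j jb; apply: inW => //; apply: Hall.
elim: j => [_ i|j IH jb i].
  by rewrite mul0r; apply: initial_rangeP.
have jj : j%:R * T < j.+1%:R * T by rewrite ltr_pM2r// ltr_nat.
have jb' : ((j%:R * T)%:E < b)%E by apply: lt_trans jb; rewrite lte_fin.
have jT0 : 0 <= j%:R * T by rewrite mulr_ge0// ?ler0n// ltW.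
have [psi [psi0 dpsi Wpsi]] := invariant_solution (j%:R * T) invW (inW j jb' (IH jb')).
rewrite (traj_segment_end T0 traj ls jb dpsi (esym psi0)) wom; last first.
  by split => //; apply: le_trans jT0 (ltW jj).
have := Mdiv _ _ (flow_solution (j%:R * T) +oo%E dom) (flow_solution (j%:R * T) +oo%E dpsi).
rewrite !add0r => /(_ (W0W _ (Wom _)) (Wpsi _) T (ltW T0)).
have -> : T + j%:R * T = j.+1%:R * T by rewrite -natr1 mulrDl mul1r addrC.
rewrite psi0 -(wom (j%:R * T))// => Hdiv.
have := coord_le_enorm (om (j.+1%:R * T) - psi (j.+1%:R * T)) i.
rewrite !mxE => Hi; apply: le_trans Hi _; apply: le_trans Hdiv _.
apply: le_trans (ler_wpM2l (ltW MT0) (reset j jb' (IH jb'))) _.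
rewrite levS /q1.
have -> : M T * (Num.sqrt r%:R * (lev j / (2 * N%:R))) =
    Num.sqrt r%:R * (M T / N%:R) * lev j / 2 by field; rewrite gt_eqF.
have : 0 <= Num.sqrt r%:R * (M T / N%:R) * lev j by rewrite mulr_ge0.
by move: (_ * lev j) => l; lra.
Qed.

End EncoderInvariant.

(** * The loop between two sampling times *)

Section Estimates.
Variable R : realType.

Lemma within_comp (U V : normedModType R) (g : R -> U) (F : U -> V) (a b : R) :
  {within `[a, b], continuous g} -> continuous F ->
  {within `[a, b], continuous (fun t => F (g t))}.
Proof. by move=> cg cF t; apply: (continuous_comp (cg t)); exact: cF. Qed.

Lemma within_lincomb (g1 g2 : R -> R) (x a b : R) :
  {within `[a, b], continuous g1} -> {within `[a, b], continuous g2} ->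
  {within `[a, b], continuous (fun t => g1 t + x * g2 t)}.
Proof.
move=> c1 c2; have -> : (fun t => g1 t + x * g2 t) = g1 + cst x * g2 by apply/funext.
move=> t; apply: continuousD; first exact: c1.
by apply: continuousM; [apply: cst_continuous|exact: c2].
Qed.

Lemma within_sub_fun (V : normedModType R) (g1 g2 : R -> V) (a b : R) :
  {within `[a, b], continuous g1} -> {within `[a, b], continuous g2} ->
  {within `[a, b], continuous (fun t => g1 t - g2 t)}.
Proof.
move=> c1 c2; have -> : (fun t => g1 t - g2 t) = g1 \- g2 by apply/funext.
by move=> t; apply: continuousB; [exact: c1|exact: c2].
Qed.

Lemma within_sqr (e : R -> R) (a b : R) :
  {within `[a, b], continuous e} -> {within `[a, b], continuous (fun t => e t ^+ 2)}.
Proof.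
move=> ce t; apply: (continuous_comp (ce t) (g := fun x : R => x ^+ 2)).
exact: exprn_continuous.
Qed.

Lemma is_derive_sqr (e : R -> R) (t l : R) :
  is_derive t (1 : R) e l -> is_derive t (1 : R) (fun u => e u ^+ 2) (2 * e t * l).
Proof.
move=> D; have := is_deriveX 1 D => D2; apply: is_derive_eq.
by rewrite /GRing.scale /=; ring.
Qed.

(** Half of the damping [- 2 k x^2] absorbs the cross term; the other half is left as decay. *)
Lemma fast_young (k B x y : R) : 0 < k -> `|y| <= B ->
  2 * x * (- k * x + y) <= - k * x ^+ 2 + B ^+ 2 / k.
Proof.
move=> k0 yB.
have y2 : y ^+ 2 <= B ^+ 2.
  by rewrite -(@real_normK _ y) ?num_real// lerXn2r// nnegrE (le_trans _ yB).
rewrite -subr_ge0.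
have -> : - k * x ^+ 2 + B ^+ 2 / k - 2 * x * (- k * x + y) =
  ((k * x - y) ^+ 2 + (B ^+ 2 - y ^+ 2)) / k by field; rewrite gt_eqF.
apply: divr_ge0; last exact: ltW.
by apply: addr_ge0; [exact: sqr_ge0|rewrite subr_ge0].
Qed.

Lemma mulmx_continuous d m (Q : 'M[R]_(d, m)) : continuous (fun x : 'rV[R]_d => x *m Q).
Proof.
apply: loclip_continuous; apply: (@loclip_bound _ _ _ _ (\sum_i \sum_j `|Q i j|)).
  by apply: sumr_ge0 => i _; apply: sumr_ge0.
move=> x y; rewrite -mulmxBl; apply: norm_rV_le => [|i].
  by rewrite mulr_ge0//; apply: sumr_ge0 => ? _; apply: sumr_ge0.
rewrite mxE mulr_suml; apply: le_trans (ler_norm_sum _ _ _) _; apply: ler_sum => j _.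
rewrite normrM mulrC; apply: ler_pM => //; last exact: norm_rV_coord.
by rewrite (bigD1 i)//= lerDl sumr_ge0.
Qed.

Lemma fast_tracking (e be : R -> R) (a t k B : R) : 0 < k -> a <= t ->
  {within `[a, t], continuous e} ->
  (forall u, a < u -> u < t -> is_derive u (1 : R) e (- k * e u + be u) /\ `|be u| <= B) ->
  e t ^+ 2 <= expR (- k * (t - a)) * e a ^+ 2 + (B / k) ^+ 2.
Proof.
move=> k0 at_ ce H.
have nk : - k != 0 by rewrite oppr_eq0 gt_eqF.
have := comparison (U := fun u => e u ^+ 2) (dU := fun u => 2 * e u * (- k * e u + be u)) (c := B ^+ 2 / k)
  at_ nk (within_sqr ce).
move=> C; have {C} := C (fun u au ut => conj (is_derive_sqr (H u au ut).1) (fast_young (e u) k0 (H u au ut).2)).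
have -> : B ^+ 2 / k / - k = - (B / k) ^+ 2 by field; rewrite gt_eqF.
have : 0 <= expR (- k * (t - a)) by exact: expR_ge0.
have : 0 <= (B / k) ^+ 2 by exact: sqr_ge0.
by move: (expR _) ((B / k) ^+ 2) (e a ^+ 2) (e t ^+ 2); clear => x1 x2 x3 x4; nra.
Qed.

(** Source of the ultimate bound: the residue [V / al ^+ 2] involves only the forcing and the decay
    rate, not the initial value. *)
Lemma filtered_bound d m (Q : 'M[R]_(d, m)) (F : 'M[R]_d) (et v : R -> 'rV[R]_d) (a t al V : R) :
  0 < al -> 0 <= V -> a <= t ->
  (forall x : 'rV[R]_d, edot (x *m F *m Q) (x *m Q) <= - al * enorm2 (x *m Q)) ->
  {within `[a, t], continuous et} ->
  (forall u, a < u -> u < t -> is_derive u (1 : R) et (et u *m F + v u) /\ enorm2 (v u *m Q) <= V) ->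
  enorm2 (et t *m Q) <= expR (- al * (t - a)) * enorm2 (et a *m Q) + V / al ^+ 2.
Proof.
move=> al0 V0 at_ HQ ce H.
have cQ := @mulmx_continuous d m Q.
have cz : {within `[a, t], continuous (fun u => et u *m Q)}.
  exact: (within_comp ce cQ).
have nal : - al != 0 by rewrite oppr_eq0 gt_eqF.
have D u : a < u -> u < t -> is_derive u (1 : R) (fun u => enorm2 (et u *m Q))
     (2 * edot (et u *m Q) ((et u *m F + v u) *m Q)) /\
   2 * edot (et u *m Q) ((et u *m F + v u) *m Q) <= - al * enorm2 (et u *m Q) + V / al.
  move=> au ut; have [Du vV] := H u au ut; split.
    apply: is_derive_enorm2.
    have := is_derive_lin (F := mulmxr Q) cQ Du; exact.
  rewrite mulmxDl edotDr mulrDr.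
  have := HQ (et u); rewrite edotC => H1.
  have H2 := edot_young (et u *m Q) (v u *m Q) al0.
  have H3 : enorm2 (v u *m Q) / al <= V / al by rewrite ler_pM2r ?invr_gt0.
  by move: (edot _ _) (edot _ _) (enorm2 (et u *m Q)) (enorm2 _ / al) (V / al) H1 H2 H3; clear => x1 x2 x3 x4 x5; lra.
have := comparison at_ nal (within_enorm2 cz) D.
have -> : V / al / - al = - (V / al ^+ 2) by field; rewrite gt_eqF.
have : 0 <= expR (- al * (t - a)) by exact: expR_ge0.
have : 0 <= V / al ^+ 2 by rewrite divr_ge0 ?sqr_ge0.
by move: (expR _) (V / al ^+ 2) (enorm2 _) (enorm2 _); clear => x1 x2 x3 x4; nra.
Qed.

(* The fast term [- k * e] absorbs the effect of [e] on [z]: the function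
   [enorm2 (z - zb) + a2 / k * e ^+ 2] satisfies a Gronwall inequality whose
   forcing term is [a2 * (B / k) ^+ 2]. *)
Lemma compare_flows n (F : 'rV[R]_n -> R -> 'rV[R]_n) (z zb : R -> 'rV[R]_n) (e yb be : R -> R)
    (a t k B L Rz Yb : R) : 0 < k -> a <= t -> 0 <= L -> 
  (forall x x' y y', `|x| <= Rz -> `|x'| <= Rz -> `|y| <= Yb -> `|y'| <= Yb ->
     `|F x y - F x' y'| <= L * (`|x - x'| + `|y - y'|)) ->
  {within `[a, t], continuous z} -> {within `[a, t], continuous zb} ->
  {within `[a, t], continuous e} ->
  (forall u, a < u -> u < t -> is_derive u (1 : R) z (F (z u) (yb u + e u))) ->
  (forall u, a < u -> u < t -> is_derive u (1 : R) zb (F (zb u) (yb u))) ->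
  (forall u, a < u -> u < t -> is_derive u (1 : R) e (- k * e u + be u) /\ `|be u| <= B) ->
  (forall u, a < u -> u < t -> [/\ `|z u| <= Rz, `|zb u| <= Rz, `|yb u + e u| <= Yb & `|yb u| <= Yb]) ->
  z a = zb a ->
  forall a1 a2, a1 = 3 * n%:R * L + 1 -> a2 = n%:R * L ->
  enorm2 (z t - zb t) <= expR (a1 * (t - a)) * (a2 / k * e a ^+ 2 + a2 * (B / k) ^+ 2 / a1).
Proof.
move=> k0 at_ L0 LF cz czb ce dz dzb de reg E a1 a2 a1E a2E.
have nL : 0 <= n%:R * L by exact: mulr_ge0 (ler0n _ _) L0.
have a10 : 0 < a1 by rewrite a1E ltr_wpDl// -mulrA mulr_ge0.
have a20 : 0 <= a2 by rewrite a2E.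
pose U u := enorm2 (z u - zb u) + a2 / k * e u ^+ 2.
pose dU u := 2 * edot (z u - zb u) (F (z u) (yb u + e u) - F (zb u) (yb u)) +
   a2 / k * (2 * e u * (- k * e u + be u)).
have cU : {within `[a, t], continuous U}.
  apply: within_lincomb; last exact: within_sqr.
  exact: (within_enorm2 (within_sub_fun cz czb)).
have D u : a < u -> u < t -> is_derive u (1 : R) U (dU u) /\ dU u <= a1 * U u + a2 * (B / k) ^+ 2.
  move=> au ut; have [deu beB] := de u au ut; split.
    have D1 := is_derive_enorm2 (is_deriveB (dz u au ut) (dzb u au ut)).
    have D2 := is_deriveZ (a2 / k) (is_derive_sqr deu).
    exact: (is_deriveD D1 D2).
  have [r1 r2 r3 r4] := reg u au ut.
  have H1 := edot_le_norm (z u - zb u) (F (z u) (yb u + e u) - F (zb u) (yb u)).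
  have H2 := LF _ _ _ _ r1 r2 r3 r4; rewrite addrAC subrr add0r in H2.
  have H3 := norm_le_enorm2 (z u - zb u).
  have H4 : 2 * e u * (- k * e u + be u) <= - k * e u ^+ 2 + B ^+ 2 / k by exact: fast_young.
  (* The weight [a2 / k] is tuned so that the damping yields exactly [- a2 * e u ^+ 2], which
     cancels the term produced by the Lipschitz bound in [H6]. *)
  have H5 : a2 / k * (2 * e u * (- k * e u + be u)) <= - a2 * e u ^+ 2 + a2 * (B / k) ^+ 2.
    have a2k : 0 <= a2 / k by rewrite divr_ge0// ltW.
    apply: le_trans (ler_wpM2l a2k H4) _.
    by rewrite le_eqVlt; apply/orP; left; apply/eqP; field; rewrite gt_eqF.
  have H6 : 2 * edot (z u - zb u) (F (z u) (yb u + e u) - F (zb u) (yb u)) <=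
      3 * n%:R * L * enorm2 (z u - zb u) + a2 * e u ^+ 2.
    have H7 : edot (z u - zb u) (F (z u) (yb u + e u) - F (zb u) (yb u)) <=
        n%:R * (`|z u - zb u| * (L * (`|z u - zb u| + `|e u|))).
      by apply: le_trans H1 _; rewrite ler_wpM2l// ler_wpM2l.
    (* This is the origin of the 3 in [a1]; the added 1 there keeps [a1] positive when [n] or [L] is
       0. *)
    have H8 : `|z u - zb u| * (`|z u - zb u| + `|e u|) * 2 <= 3 * enorm2 (z u - zb u) + e u ^+ 2.
      rewrite -(@real_normK _ (e u)) ?num_real//.
      have := sqr_ge0 (`|z u - zb u| - `|e u|).
      move: `|z u - zb u| `|e u| (enorm2 _) H3; clear => x1 x2 x3; rewrite !expr2; nra.
    have := ler_wpM2l nL H8; rewrite a2E; move: H7.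
    move: (edot _ _) `|z u - zb u| `|e u| (enorm2 _) (e u ^+ 2) (n%:R : R) => x1 x2 x3 x4 x5 x6; clear => H7 H8.
    have -> : 3 * x6 * L * x4 + x6 * L * x5 = x6 * L * (3 * x4 + x5) by ring.
    apply: le_trans H8; rewrite (_ : x6 * L * (x2 * (x2 + x3) * 2) = 2 * (x6 * (x2 * (L * (x2 + x3))))); last by ring.
    lra.
  rewrite /dU /U a1E.
  have e20 : 0 <= a2 / k * e u ^+ 2 by rewrite mulr_ge0 ?sqr_ge0// divr_ge0// ltW.
  have N0 := enorm2_ge0 (z u - zb u).
  have M0 : 0 <= 3 * n%:R * L * (a2 / k * e u ^+ 2) by rewrite mulr_ge0// -mulrA mulr_ge0.
  move: H5 H6 e20 N0 M0; move: (2 * edot _ _) (a2 / k * (2 * _ * _)) (a2 * (B / k) ^+ 2) (a2 / k * e u ^+ 2).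
  rewrite mulNr; move: (enorm2 _) (a2 * e u ^+ 2) (3 * n%:R * L); clear => x1 x2 x3 x4 x5 x6 x7; lra.
have := comparison at_ (lt0r_neq0 a10) cU D.
rewrite {2}/U E subrr => H.
have z0 : enorm2 (0 : 'rV[R]_n) = 0 by rewrite /enorm2 big1// => i _; rewrite mxE expr0n.
rewrite z0 add0r in H; apply: le_trans H.
rewrite /U -addrA lerDl; apply: addr_ge0.
  exact: mulr_ge0 (divr_ge0 a20 (ltW k0)) (sqr_ge0 _).
exact: divr_ge0 (mulr_ge0 a20 (sqr_ge0 _)) (ltW a10).
Qed.

End Estimates.

(** * Uniform attraction and compactness *)

Section Attraction.
Variable R : realType.

(** Otherwise there are solutions far from the omega-limit set at times tending to infinity. Their
    values at these times lie in [C], and a cluster point of them belongs to the omega-limit set by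
    its very definition. *)
Lemma omega_limit_attracts (V : normedModType R) (F : V -> V) (X C : set V) (eps : R) :
  compact C -> 0 < eps -> exists2 h : R, 0 < h &
  forall x, solution F +oo%E x -> X (x 0) -> (forall t, 0 <= t -> C (x t)) ->
  forall t, h <= t -> exists2 p, omega_limit F X p & `|x t - p| <= eps.
Proof.
move=> cC eps0; apply: contrapT => nex.
have H (i : nat) : exists xt : (R -> V) * R, [/\ solution F +oo%E xt.1, X (xt.1 0),
    i.+1%:R <= xt.2, C (xt.1 xt.2) & forall p, omega_limit F X p -> eps < `|xt.1 xt.2 - p|].
  apply: contrapT => nH; apply: nex; exists i.+1%:R; first by rewrite ltr0n.
  move=> x sx x0 Cx t ht; apply: contrapT => np; apply: nH; exists (x, t); split => //=.
    by apply: Cx; apply: le_trans ht; rewrite ler0n.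
  by move=> p op; rewrite ltNge; apply/negP => le; apply: np; exists p.
have [xt Hxt] := choice H.
pose u i := (xt i).1 (xt i).2.
have uC : (u @ \oo) C by exists 0%N => // i _; have [_ _ _ ? _] := Hxt i.
have [p [Cp clp]] := cC (u @ \oo) _ uC.
have nearp (m : nat) : exists i : nat, (m <= i)%N /\ `|u i - p| < m.+1%:R^-1.
  have m0 : 0 < m.+1%:R^-1 :> R by rewrite invr_gt0 ltr0n.
  have A1 : (u @ \oo) [set u i | i in [set i | (m <= i)%N]] by exists m => // i /= mi; exists i.
  have [v [[i /= mi <-] hv]] := clp _ _ A1 (nbhsx_ballx p _ m0).
  by exists i; split => //; rewrite distrC; move: hv; rewrite -ball_normE.
have [sg Hsg] := choice nearp.
have inv_small e : 0 < e -> \forall i \near \oo, i.+1%:R^-1 < e :> R.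
  by move=> e0; apply: (near_infty_natSinv_lt (PosNum e0)).
have op : omega_limit F X p.
  exists (fun i => (xt (sg i)).1), (fun i => (xt (sg i)).2); split.
  - by move=> i; have [? ? _ _ _] := Hxt (sg i).
  - by move=> i; have [_ _ h _ _] := Hxt (sg i); apply: le_trans h; rewrite ler0n.
  - apply/cvgryPge => A; near=> i.
    have [_ _ h _ _] := Hxt (sg i); apply: le_trans h.
    have Ai : A <= i%:R by near: i; exact: nbhs_infty_ger.
    by apply: le_trans Ai _; rewrite ler_nat ltnW// ltnS; have [] := Hsg i.
  - apply/cvgrPdist_lt => e e0; near=> i; rewrite distrC.
    have [_ h] := Hsg i; apply: lt_trans h _.
    by near: i; exact: inv_small.
have [m _ Hm] := inv_small eps eps0.
have [_ hm] := Hsg m; have [_ _ _ _ /(_ p op)] := Hxt (sg m).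
by rewrite ltNge (ltW (lt_trans hm _))// Hm /=.
Unshelve. all: by end_near. Qed.

Lemma enorm2_row_mx m1 m2 (x : 'rV[R]_m1) (y : 'rV[R]_m2) :
  enorm2 (row_mx x y) = enorm2 x + enorm2 y.
Proof.
rewrite /enorm2 big_split_ord /=; congr (_ + _); apply: eq_bigr => i _.
  by rewrite row_mxEl.
by rewrite row_mxEr.
Qed.

Lemma enorm2_stack p r n (x : zstate R p r n) :
  enorm2 (stack x) = enorm2 x.1.1 + enorm2 x.1.2 + enorm2 x.2.
Proof. by rewrite /stack !enorm2_row_mx. Qed.

Lemma stackB p r n (x y : zstate R p r n) : stack x - stack y = stack (x - y).
Proof. by rewrite /stack !opp_row_mx !add_row_mx. Qed.

Lemma enorm2_stack_le p r n (x : zstate R p r n) :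
  enorm2 (stack x) <= (p + r + n)%:R * `|x| ^+ 2.
Proof.
have x1 : `|x.1| <= `|x| by rewrite [leRHS]prod_normE le_max lexx.
have x2 : `|x.2| <= `|x| by rewrite [leRHS]prod_normE le_max lexx orbT.
have x11 : `|x.1.1| <= `|x| by apply: le_trans x1; rewrite [leRHS]prod_normE le_max lexx.
have x12 : `|x.1.2| <= `|x| by apply: le_trans x1; rewrite [leRHS]prod_normE le_max lexx orbT.
rewrite enorm2_stack !natrD !mulrDl.
by repeat apply: lerD; (apply: le_trans (enorm2_le_norm _) _; rewrite ler_wpM2l ?ler0n// lerXn2r// nnegrE).
Qed.

Lemma continuous_bounded (U : topologicalType) (V : normedModType R) (F : U -> V) (K : set U) :
  continuous F -> compact K -> exists2 B : R, 0 < B & forall x, K x -> `|F x| <= B.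
Proof.
move=> cF cK; have := continuous_compact (continuous_subspaceT cF) cK.
move=> /compact_bounded [B [_ HB]]; exists (`|B| + 1); first by rewrite ltr_wpDl.
by move=> x Kx; apply: (HB (`|B| + 1)); [rewrite (le_lt_trans (ler_norm B))// ltrDl|exists x].
Qed.

Lemma compact_norm_bound (V : normedModType R) (K : set V) : compact K ->
  exists2 B : R, 0 < B & forall x, K x -> `|x| <= B.
Proof. by move=> cK; apply: (continuous_bounded (F := id)) => // x. Qed.

Lemma compact_support_bounded (V : normedModType R) (F : V -> R) :
  continuous F -> compact_support F -> exists2 B : R, 0 < B & forall x, `|F x| <= B.
Proof.
move=> cF cs; have [B B0 HB] := continuous_bounded cF cs; exists B => // x.
have [->|Fx] := eqVneq (F x) 0; first by rewrite normr0 ltW.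
by apply: HB; apply: subset_closure; apply/eqP.
Qed.

(** A ball of the sup norm, written as a product of segments so that [rV_compact] applies. *)
Definition box n (Rz : R) : set 'rV[R]_n := [set v | forall i, `[- Rz, Rz]%classic (v ord0 i)].

Lemma compact_box n Rz : compact (@box n Rz).
Proof. exact: (rV_compact (A := fun=> `[- Rz, Rz]%classic) (fun=> @segment_compact _ _ _)). Qed.

Lemma boxP n Rz (v : 'rV[R]_n) : `|v| <= Rz -> box Rz v.
Proof.
by move=> vR i; rewrite /= in_itv /= -ler_norml; apply: le_trans vR; exact: norm_rV_coord.
Qed.

End Attraction.

(** * Comparison with the zero-error flow over one window *)

Section Window.
Variable R : realType.

Lemma within_shift (V : normedModType R) (g : R -> V) (a ta : R) :
  {within `[0, ta - a], continuous g} -> {within `[a, ta], continuous (fun u => g (u - a))}.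
Proof.
move=> cg; apply: within_contP => t at_ tt e e0.
have [d d0 Hd] := within_cont_at cg (ltac:(lra) : 0 <= t - a) (ltac:(lra) : t - a <= ta - a) e0.
exists d => // z az zt zd; apply: Hd; [lra|lra|].
by rewrite (_ : z - a - (t - a) = z - t)//; ring.
Qed.

Variables (r n p : nat).
Variables (s : 'rV[R]_r -> 'rV[R]_r) (yr : 'rV[R]_r -> R)
  (f : 'rV[R]_n -> R -> 'rV[R]_p -> 'rV[R]_n)
  (W : set 'rV[R]_r) (P : set 'rV[R]_p) (Z : set 'rV[R]_n).
Let Z0 : set (zstate R p r n) := P `*` W `*` Z.
Let A0 := omega_limit (zero_field s yr f) Z0.
Variables (C : set (zstate R p r n)) (Rc Ry d1 h eps2 : R).
Hypothesis ls : locally_lipschitz s.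
Hypothesis hC : forall x0, Z0 x0 -> exists x, [/\ solution (zero_field s yr f : zstate R p r n -> _) +oo%E x, x 0 = x0 &
          forall t, 0 <= t -> C (x t)].
Hypothesis CR : forall x, C x -> `|x| <= Rc.
Hypothesis d10 : 0 < d1.
Hypothesis hd1 : forall x : zstate R p r n, (P `*` W `*` setT) x -> xdist A0 x <= d1 -> Z0 x.
Hypothesis hatt : forall x, solution (zero_field s yr f : zstate R p r n -> _) +oo%E x -> Z0 (x 0) ->
  (forall t, 0 <= t -> C (x t)) -> forall t, h <= t ->
  exists2 x', A0 x' & (p + r + n)%:R * `|x t - x'| ^+ 2 <= (d1 / 2) ^+ 2.
Hypothesis yrR : forall w, W w -> `|yr w| <= Ry.
Hypothesis eps1 : eps2 <= 1.
Hypothesis epsd : eps2 <= (d1 / 2) ^+ 2.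

Lemma zero_fieldE (x : zstate R p r n) :
  zero_field s yr f x = ((0, s x.1.2), f x.2 (yr x.1.2) x.1.1).
Proof. by case: x => [[? ?] ?]. Qed.

(** Uniqueness identifies the first two components, so after a translation by [a] the zero-error
    flow sees the same [mu] and [psi] as the plant, and only its [z] component has to be
    compared. *)
Lemma zero_flow_components (x : R -> zstate R p r n) (psi : R -> 'rV[R]_r) (a : R) (mu : 'rV[R]_p) :
  solution (zero_field s yr f : zstate R p r n -> _) +oo%E x ->
  (forall t, is_derive t (1 : R) psi (s (psi t))) ->
  (x 0).1.1 = mu -> (x 0).1.2 = psi a ->
  [/\ forall u, 0 <= u -> (x u).1.1 = mu /\ (x u).1.2 = psi (u + a),
   forall ta, {within `[a, ta], continuous (fun u => (x (u - a)).2)} &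
   forall u, a < u -> is_derive u (1 : R) (fun u => (x (u - a)).2)
      (f (x (u - a)).2 (yr (psi u)) mu)].
Proof.
move=> [cx dx] dpsi xmu xpsi.
have dx' (u : R) : 0 < u -> is_derive u (1 : R) x (zero_field s yr f (x u)) by move=> u0; apply: dx => //; exact: ltry.
have cx' (u : R) : {within `[0, u], continuous x} by apply: upto_within cx _ _ => //; exact: ltry.
have c1 (u : R) : {within `[0, u], continuous (fun u => (x u).1)}.
  exact: (within_comp (F := fun x : zstate R p r n => x.1) (cx' u) (loclip_continuous (@loclip_fst R _ _))).
have c2 (u : R) : {within `[0, u], continuous (fun u => (x u).2)}.
  exact: (within_comp (F := fun x : zstate R p r n => x.2) (cx' u) (loclip_continuous (@loclip_snd R _ _))).
have c11 (u : R) : {within `[0, u], continuous (fun u => (x u).1.1)}.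
  exact: (within_comp (F := fun x : 'rV[R]_p * 'rV[R]_r => x.1) (c1 u) (loclip_continuous (@loclip_fst R _ _))).
have c12 (u : R) : {within `[0, u], continuous (fun u => (x u).1.2)}.
  exact: (within_comp (F := fun x : 'rV[R]_p * 'rV[R]_r => x.2) (c1 u) (loclip_continuous (@loclip_snd R _ _))).
have m1 (u : R) : 0 <= u -> (x u).1.1 = mu.
  move=> u0; apply: (ode_unique (F := fun=> 0) (x1 := fun u => (x u).1.1) (x2 := fun=> mu) (a := 0) (b := u)) => //.
  - exact: loclip_cst.
  - by apply: continuous_subspaceT => ?; exact: cvg_cst.
  - by move=> v v0 _; have := is_derive_fst (is_derive_fst (dx' v v0)); rewrite zero_fieldE.
have m2 (u : R) : 0 <= u -> (x u).1.2 = psi (u + a).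
  move=> u0; apply: (ode_unique (F := s) (x1 := fun u => (x u).1.2) (x2 := fun u => psi (u + a)) (a := 0) (b := u)) => //.
  - by apply: continuous_subspaceT => v; exact: (is_derive_cont (is_derive_shiftr (dpsi (v + a)))).
  - by move=> v v0 _; have := is_derive_snd (is_derive_fst (dx' v v0)); rewrite zero_fieldE.
  - by move=> v _ _; exact: (is_derive_shiftr (dpsi (v + a))).
  - by rewrite xpsi add0r.
split=> [u u0|ta|u au].
- by rewrite m1// m2.
- exact: (within_shift (g := fun u => (x u).2) (c2 _)).
- have ua : 0 < u - a by rewrite subr_gt0.
  apply: (is_derive_shiftl (f := fun u => (x u).2)).
  have := is_derive_snd (dx' _ ua); rewrite zero_fieldE /= m1 ?ltW//.
  by rewrite m2 ?ltW// subrK.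
Qed.

(** The zero-error state [zb] starts at [z a] in [Z] and remains in [C]; the length at most [2 * h]
    keeps the Gronwall factor fixed, so [z] stays close to it. After time [h] the zero-error state
    is near [A0], hence so is [z], and [hd1] puts [z] back in [Z]. *)
Lemma window (mu : 'rV[R]_p) (psi : R -> 'rV[R]_r) (z : R -> 'rV[R]_n) (e be : R -> R)
  (a t k B L Rz E1 : R) :
  P mu -> (forall t, is_derive t (1 : R) psi (s (psi t))) -> (forall t, W (psi t)) ->
  0 < k -> a < t -> 0 <= L -> t - a <= 2 * h -> Rc <= Rz -> 0 <= E1 ->
  (forall x x' y y', `|x| <= Rz -> `|x'| <= Rz -> `|y| <= E1 + Ry -> `|y'| <= E1 + Ry ->
     `|f x y mu - f x' y' mu| <= L * (`|x - x'| + `|y - y'|)) ->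
  {within `[a, t], continuous z} -> {within `[a, t], continuous e} ->
  (forall u, a < u -> u < t -> is_derive u (1 : R) z (f (z u) (yr (psi u) + e u) mu)) ->
  (forall u, a < u -> u < t -> is_derive u (1 : R) e (- k * e u + be u) /\ `|be u| <= B) ->
  (forall u, a < u -> u < t -> `|z u| <= Rz /\ `|e u| <= E1) ->
  `|e a| <= E1 -> Z (z a) ->
  forall a1 a2, a1 = 3 * n%:R * L + 1 -> a2 = n%:R * L ->
  expR (a1 * (2 * h)) * (a2 / k * E1 ^+ 2 + a2 * (B / k) ^+ 2 / a1) <= eps2 ->
  `|z t| <= Rc + 1 /\ (h <= t - a -> Z (z t)).
Proof.
move=> Pmu dpsi Wpsi k0 at_ L0 th RR E10 LF cz ce dz de reg ea Za a1 a2 a1E a2E small.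
have a10 : 0 < a1 by rewrite a1E ltr_wpDl// -mulrA mulr_ge0// mulr_ge0.
have a20 : 0 <= a2 by rewrite a2E mulr_ge0.
have Zx : Z0 ((mu, psi a), z a) by split => //=; split => //=.
have [x [sx x0 Cx]] := hC Zx.
have [xc czb dzb] := zero_flow_components (a := a) (mu := mu) sx dpsi ltac:(by rewrite x0) ltac:(by rewrite x0).
pose zb u := (x (u - a)).2.
have zbR u : a <= u -> `|zb u| <= Rc.
  move=> au; have ua : 0 <= u - a by rewrite subr_ge0.
  by apply: le_trans (CR (Cx _ ua)); rewrite [leRHS]prod_normE le_max lexx orbT.
have ta : 0 <= t - a by rewrite subr_ge0 ltW.
have close : enorm2 (z t - zb t) <= eps2.
  apply: le_trans small.
  have := @compare_flows R n (fun x y => f x y mu) z zb e (fun u => yr (psi u)) be a t k B L Rz (E1 + Ry)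
    k0 (ltW at_) L0 LF cz (czb t) ce dz (fun u au _ => dzb u au) de.
  move=> /(_ _ _ a1 a2 a1E a2E) H; apply: le_trans (H _ _) _.
  - move=> u au ut; have [zR eE] := reg u au ut; split => //.
    + by apply: le_trans RR; apply: zbR; exact: ltW.
    + by apply: le_trans (ler_normD _ _) _; rewrite addrC lerD// yrR.
    + by apply: le_trans (yrR (Wpsi u)) _; rewrite lerDr.
  - by rewrite /zb subrr x0.
  apply: ler_pM.
  - exact: expR_ge0.
  - apply: addr_ge0; first exact: mulr_ge0 (divr_ge0 a20 (ltW k0)) (sqr_ge0 _).
    exact: divr_ge0 (mulr_ge0 a20 (sqr_ge0 _)) (ltW a10).
  - by rewrite ler_expR ler_pM2l.
  - rewrite lerD2r; apply: ler_wpM2l; first exact: divr_ge0 a20 (ltW k0).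
    by rewrite -(@real_normK _ (e a)) ?num_real// lerXn2r// nnegrE.
split.
  have zz : `|z t - zb t| <= 1.
    rewrite -(@ler_sqr R) ?nnegrE// expr1n.
    by apply: le_trans (norm_le_enorm2 _) (le_trans close eps1).
  by rewrite -(subrK (zb t) (z t)) addrC; apply: le_trans (ler_normD _ _) _; apply: lerD => //; apply: zbR; exact: ltW.
move=> hta.
have Z0x : Z0 (x 0) by rewrite x0.
have [x' Ax' x'd] := hatt sx Z0x Cx hta.
pose xs : zstate R p r n := ((mu, psi t), z t).
have : Z0 xs.
  apply: hd1; first by split => //=; split => //=.
  apply: le_trans (_ : enorm (stack xs - stack x') <= _).
    by apply: edist_le_enorm; exists x'.
  rewrite enormE -[leRHS](ger0_norm (ltW d10)) -sqrtr_sqr ler_sqrt ?sqr_ge0//.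
  rewrite -(subrKA (stack (x (t - a)))); apply: le_trans (enorm2D _ _) _.
  have H1 : enorm2 (stack xs - stack (x (t - a))) <= (d1 / 2) ^+ 2.
    apply: le_trans epsd; apply: le_trans close; rewrite stackB enorm2_stack /=.
    have [-> ->] := xc _ ta; rewrite subrK !subrr.
    have e0 m : enorm2 (0 : 'rV[R]_m) = 0 by rewrite /enorm2 big1// => i _; rewrite mxE expr0n.
    by rewrite !e0 !add0r.
  have H2 : enorm2 (stack (x (t - a)) - stack x') <= (d1 / 2) ^+ 2.
    by apply: le_trans x'd; rewrite stackB; exact: enorm2_stack_le.
  (* Each squared distance is at most a quarter of [d1 ^+ 2]; the factor 2 of [enorm2D] makes the
     sum exactly [d1 ^+ 2]. *)
  apply: le_trans (lerD (ler_wpM2l _ H1) (ler_wpM2l _ H2)) _ => //.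
  by rewrite le_eqVlt; apply/orP; left; apply/eqP; field.
by case.
Qed.

End Window.

(** * The bootstrap between two samples *)

Section Core.
Variable R : realType.
Variables (r n p d m : nat).
Variables (s : 'rV[R]_r -> 'rV[R]_r) (yr : 'rV[R]_r -> R)
  (f : 'rV[R]_n -> R -> 'rV[R]_p -> 'rV[R]_n)
  (W : set 'rV[R]_r) (P : set 'rV[R]_p) (Z : set 'rV[R]_n).
Let Z0 : set (zstate R p r n) := P `*` W `*` Z.
Let A0 := omega_limit (zero_field s yr f) Z0.
Variables (C : set (zstate R p r n)) (Rc Ry d1 h eps2 : R).
Hypothesis ls : locally_lipschitz s.
Hypothesis hC : forall x0, Z0 x0 -> exists x, [/\ solution (zero_field s yr f : zstate R p r n -> _) +oo%E x, x 0 = x0 &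
          forall t, 0 <= t -> C (x t)].
Hypothesis CR : forall x, C x -> `|x| <= Rc.
Hypothesis d10 : 0 < d1.
Hypothesis hd1 : forall x : zstate R p r n, (P `*` W `*` setT) x -> xdist A0 x <= d1 -> Z0 x.
Hypothesis h0 : 0 < h.
Hypothesis hatt : forall x, solution (zero_field s yr f : zstate R p r n -> _) +oo%E x -> Z0 (x 0) ->
  (forall t, 0 <= t -> C (x t)) -> forall t, h <= t ->
  exists2 x', A0 x' & (p + r + n)%:R * `|x t - x'| ^+ 2 <= (d1 / 2) ^+ 2.
Hypothesis yrR : forall w, W w -> `|yr w| <= Ry.
Hypothesis eps1 : eps2 <= 1.
Hypothesis epsd : eps2 <= (d1 / 2) ^+ 2.

Variables (Q : 'M[R]_(d, m)) (F : 'M[R]_d) (al V1 V2 D0 E0 B L k : R).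
Variables (mu : 'rV[R]_p) (psi : R -> 'rV[R]_r) (t0 t1 : R).
Variables (z : R -> 'rV[R]_n) (e be : R -> R) (et v : R -> 'rV[R]_d).
Hypothesis Pmu : P mu.
Hypothesis dpsi : forall t, is_derive t (1 : R) psi (s (psi t)).
Hypothesis Wpsi : forall t, W (psi t).
Hypothesis k0 : 0 < k.
Hypothesis L0 : 0 <= L.
Hypothesis E00 : 0 <= E0.
Hypothesis LF : forall x x' y y', `|x| <= Rc + 2 -> `|x'| <= Rc + 2 ->
  `|y| <= E0 + 1 + Ry -> `|y'| <= E0 + 1 + Ry ->
  `|f x y mu - f x' y' mu| <= L * (`|x - x'| + `|y - y'|).
Hypothesis al0 : 0 < al.
Hypothesis V10 : 0 <= V1.
Hypothesis HQ : forall x : 'rV[R]_d, edot (x *m F *m Q) (x *m Q) <= - al * enorm2 (x *m Q).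
Hypothesis cz : {within `[t0, t1], continuous z}.
Hypothesis ce : {within `[t0, t1], continuous e}.
Hypothesis cet : {within `[t0, t1], continuous et}.
(** Strict inequalities make the condition open, so it persists for a short time. The forcing bounds
    in [de] and [det] are granted only while it holds. *)
Let good u := [/\ `|z u| < Rc + 2, `|e u| < E0 + 1 & enorm2 (et u *m Q) < V2].
Hypothesis dz : forall u, t0 < u -> u < t1 -> is_derive u (1 : R) z (f (z u) (yr (psi u) + e u) mu).
Hypothesis de : forall u, t0 < u -> u < t1 -> is_derive u (1 : R) e (- k * e u + be u) /\
  (good u -> `|be u| <= B).
Hypothesis det : forall u, t0 < u -> u < t1 -> is_derive u (1 : R) et (et u *m F + v u) /\
  (good u -> enorm2 (v u *m Q) <= V1).
Hypothesis kB : (B / k) ^+ 2 <= 1 / 4.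
Hypothesis DV : D0 + V1 / al ^+ 2 < V2.
Variables a1 a2 : R.
Hypothesis a1E : a1 = 3 * n%:R * L + 1.
Hypothesis a2E : a2 = n%:R * L.
Hypothesis small : expR (a1 * (2 * h)) * (a2 / k * (E0 + 1) ^+ 2 + a2 * (B / k) ^+ 2 / a1) <= eps2.
Hypothesis Zt0 : Z (z t0).
Hypothesis et0 : `|e t0| <= E0.
Hypothesis Dt0 : enorm2 (et t0 *m Q) <= D0.

Lemma core_Z_bound x : Z x -> `|x| <= Rc.
Proof.
move=> Zx; have Zx0 : Z0 ((mu, psi t0), x) by split => //=; split => //=.
have [u [_ u0 Cu]] := hC Zx0; have := CR (Cu 0 (lexx _)); rewrite u0.
by apply: le_trans; rewrite [leRHS]prod_normE le_max lexx orbT.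
Qed.

Lemma core_init : good t0.
Proof.
split.
- by apply: le_lt_trans (core_Z_bound Zt0) _; rewrite ltrDl.
- by apply: le_lt_trans et0 _; rewrite ltrDl.
- apply: le_lt_trans Dt0 (le_lt_trans _ DV).
  by rewrite lerDl; apply: divr_ge0 => //; exact: sqr_ge0.
Qed.

Lemma core_decay t : t0 <= t -> t <= t1 -> (forall u, t0 <= u -> u < t -> good u) ->
  e t ^+ 2 <= expR (- k * (t - t0)) * E0 ^+ 2 + 1 / 4 /\
  enorm2 (et t *m Q) <= expR (- al * (t - t0)) * D0 + V1 / al ^+ 2.
Proof.
move=> t0t tt1 g; split.
  apply: le_trans (fast_tracking (be := be) (B := B) k0 t0t (within_sub ce (lexx _) tt1) _) _.
    move=> u u0 ut; have [H1 H2] := de u0 (lt_le_trans ut tt1); split => //.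
    by apply: H2; apply: g => //; exact: ltW.
  apply: lerD => //; apply: ler_wpM2l; first exact: expR_ge0.
  by rewrite -(@real_normK _ (e t0)) ?num_real// lerXn2r// nnegrE.
apply: le_trans (filtered_bound (F := F) (v := v) al0 V10 t0t HQ (within_sub cet (lexx _) tt1) _) _.
  move=> u u0 ut; have [H1 H2] := det u0 (lt_le_trans ut tt1); split => //.
  by apply: H2; apply: g => //; exact: ltW.
by rewrite lerD2r; apply: ler_wpM2l => //; exact: expR_ge0.
Qed.

Lemma core_window a t : t0 <= a -> a < t -> t <= t1 -> t - a <= 2 * h ->
  (forall u, t0 <= u -> u < t -> good u) -> Z (z a) ->
  `|z t| <= Rc + 1 /\ (h <= t - a -> Z (z t)).
Proof.
move=> t0a at_ tt1 th g Za.
apply: (window ls hC CR d10 hd1 hatt yrR eps1 epsd (psi := psi) (e := e) (be := be)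
  Pmu dpsi Wpsi k0 at_ L0 th _ _ LF _ _ _ _ _ _ Za a1E a2E small).
- by rewrite lerDl.
- by rewrite addr_ge0.
- exact: within_sub cz t0a tt1.
- exact: within_sub ce t0a tt1.
- by move=> u au ut; apply: dz; [exact: le_lt_trans au|exact: lt_le_trans tt1].
- move=> u au ut; have u0 := le_lt_trans t0a au.
  have [H1 H2] := de u0 (lt_le_trans ut tt1); split => //.
  by apply: H2; apply: g => //; exact: ltW.
- move=> u au ut; have [/ltW ? /ltW ? _] := g u (ltW (le_lt_trans t0a au)) ut.
  by split.
- by have [_ /ltW ? _] := g a t0a at_.
Qed.

(* The nominal flow is restarted at times where [z] is back in [Z], so that comparisons over
   windows of length at most [2 * h] cover arbitrarily long intervals. *)
Lemma core_return t : t0 <= t -> t <= t1 -> (forall u, t0 <= u -> u < t -> good u) ->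
  t0 + h <= t -> Z (z t).
Proof.
move=> t0t tt1 g hh.
suff H (j : nat) : forall u, t0 + h <= u -> u <= t -> u <= t0 + j.+1%:R * h -> Z (z u).
  have [j _ Hj] := nbhs_infty_ger ((t - t0) / h).
  apply: (H j t hh (lexx _)).
  have : (t - t0) / h <= j%:R by exact: (Hj j (leqnn j)).
  rewrite ler_pdivrMr// -natr1 mulrDl mul1r; move: (j%:R * h) => x; move: h0; lra.
have near0 u : t0 + h <= u -> u <= t -> u <= t0 + 2 * h -> Z (z u).
  move=> hu ut u2; apply: (core_window (a := t0) (t := u) _ _ _ _ _ Zt0).2 => //.
  - by apply: lt_le_trans hu; rewrite ltrDl.
  - exact: le_trans ut tt1.
  - by rewrite lerBlDl.
  - by move=> w w0 wu; apply: g => //; apply: lt_le_trans ut.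
  - by rewrite lerBrDl.
elim: j => [|j IH] u hu ut uj.
  by apply: near0 => //; apply: le_trans uj _; rewrite lerD2l ler_pM2r// ler1n.
have [u2|u2] := leP u (t0 + 2 * h); first exact: near0.
(* The restart at [u - h] gives a window of length exactly [h], the shortest one after which
   [core_window] returns [z] to [Z]. *)
have Zu : Z (z (u - h)).
  apply: IH.
  - by move: u2; lra.
  - by move: h0 ut; lra.
  - by move: uj; rewrite -(natr1 j.+1) mulrDl mul1r; move: (_ * h) => x; lra.
apply: (core_window (a := u - h) (t := u) _ _ _ _ _ Zu).2 => //.
- by move: h0 u2; lra.
- by move: h0; lra.
- exact: le_trans ut tt1.
- by move: h0; lra.
- by move=> w w0 wu; apply: g => //; apply: lt_le_trans ut.
- by move: h0; lra.
Qed.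

(** If [good] holds before [t], each estimate holds at [t] with room to spare: [Rc + 1] against
    [Rc + 2], [E0 ^+ 2 + 1 / 4] against [(E0 + 1) ^+ 2], and [DV] for the filtered state. Continuity
    then carries [good] past [t]. *)
Lemma core_good t : t0 <= t -> t <= t1 -> good t.
Proof.
move: t; apply: real_induction; first exact: core_init.
- move=> t t0t tt1 g; have [H1 H2] := core_decay (ltW t0t) tt1 g; split.
  + suff : `|z t| <= Rc + 1 by move=> H; apply: le_lt_trans H _; rewrite ltrD2l ltr1n.
    have [th|th] := leP (t - t0) (2 * h).
      exact: (core_window (lexx _) t0t tt1 th g Zt0).1.
    (* [good] is known only before [t], so [core_return] is used at the earlier time [t - h] and one
       window leads from there to [t]. *)
    have Za : Z (z (t - h)).
      apply: core_return.
      * by move: h0 th; lra.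
      * by move: h0 tt1; lra.
      * by move=> u u0 ut; apply: g => //; apply: lt_trans ut _; rewrite gtrBl.
      * by move: h0 th; lra.
    apply: (core_window (a := t - h) _ _ tt1 _ g Za).1.
    * by move: h0 th; lra.
    * by rewrite gtrBl.
    * by move: h0; lra.
  + rewrite -(@ltr_sqr R) ?nnegrE ?addr_ge0// real_normK ?num_real//.
    apply: le_lt_trans H1 _.
    have e1 : expR (- k * (t - t0)) <= 1 by rewrite -expR0 ler_expR mulNr oppr_le0 mulr_ge0 ?subr_ge0// ltW.
    have := ler_wpM2r (sqr_ge0 E0) e1; move: E00; move: (expR _ * _); move=> x; nra.
  + apply: le_lt_trans H2 _; apply: le_lt_trans DV; rewrite lerD2r.
    have e1 : expR (- al * (t - t0)) <= 1 by rewrite -expR0 ler_expR mulNr oppr_le0 mulr_ge0 ?subr_ge0// ltW.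
    by rewrite -[leRHS]mul1r ler_wpM2r// (le_trans _ Dt0)// enorm2_ge0.
- move=> t t0t tt1 [g1 g2 g3].
  have cD : {within `[t0, t1], continuous (fun u => enorm2 (et u *m Q))}.
    exact: (within_enorm2 (within_comp cet (@mulmx_continuous R d m Q))).
  have p1 : 0 < Rc + 2 - `|z t| by rewrite subr_gt0.
  have p2 : 0 < E0 + 1 - `|e t| by rewrite subr_gt0.
  have p3 : 0 < V2 - enorm2 (et t *m Q) by rewrite subr_gt0.
  have [r1 r10 H1] := within_cont_at cz t0t (ltW tt1) p1.
  have [r2 r20 H2] := within_cont_at ce t0t (ltW tt1) p2.
  have [r3 r30 H3] := within_cont_at cD t0t (ltW tt1) p3.
  exists (Num.min r1 (Num.min r2 r3)); first by rewrite !lt_min r10 r20 r30.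
  move=> u tu; rewrite -ltrBlDl !lt_min => /and3P[ur1 ur2 ur3] ut1.
  have u0 : t0 <= u by exact: le_trans (ltW tu).
  have nu : `|u - t| = u - t by rewrite ger0_norm// subr_ge0 ltW.
  split.
  + have := H1 u u0 ut1; rewrite nu => /(_ ur1) H; rewrite -(subrK (z t) (z u)).
    by apply: le_lt_trans (ler_normD _ _) _; rewrite -ltrBrDr.
  + have := H2 u u0 ut1; rewrite nu => /(_ ur2) H; rewrite -(subrK (e t) (e u)).
    by apply: le_lt_trans (ler_normD _ _) _; rewrite -ltrBrDr.
  + have := H3 u u0 ut1; rewrite nu => /(_ ur3) H.
    have := le_lt_trans (ler_norm _) H.
    by rewrite ltrBlDr subrK.
Qed.

Lemma core_conclusion t : t0 <= t -> t <= t1 ->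
  [/\ good t, t0 + h <= t -> Z (z t),
    e t ^+ 2 <= expR (- k * (t - t0)) * E0 ^+ 2 + 1 / 4 &
    enorm2 (et t *m Q) <= expR (- al * (t - t0)) * D0 + V1 / al ^+ 2].
Proof.
move=> t0t tt1; have g u : t0 <= u -> u < t -> good u.
  by move=> u0 ut; apply: core_good => //; apply: ltW; apply: lt_le_trans tt1.
have [H1 H2] := core_decay t0t tt1 g.
split=> //; first exact: core_good.
exact: core_return.
Qed.

End Core.

(** * Error coordinates of the closed loop *)

Section ClosedLoop.
Variable R : realType.
Variables (r n p d : nat).
Variables (s : 'rV[R]_r -> 'rV[R]_r) (yr : 'rV[R]_r -> R)
  (f : 'rV[R]_n -> R -> 'rV[R]_p -> 'rV[R]_n) (q : 'rV[R]_n -> R -> 'rV[R]_p -> R)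
  (phic : 'rV[R]_d -> R) (c : 'I_d -> R).

Definition closed_loop (kappa k : R) (mu : 'rV[R]_p) (psi : R -> 'rV[R]_r) (t0 t1 : R)
    (z : R -> 'rV[R]_n) (y : R -> R) (xi : R -> 'rV[R]_d) : Prop :=
  [/\ {within `[t0, t1], continuous z}, {within `[t0, t1], continuous y},
      {within `[t0, t1], continuous xi} &
      forall t, t0 < t -> t < t1 ->
      [/\ is_derive t (1 : R) z (f (z t) (y t) mu),
          is_derive t (1 : R) y (q (z t) (y t) mu + (Gamma R d *m (xi t)^T) ord0 ord0
             - k * (y t - yr (psi t))) &
          is_derive t (1 : R) xi (PhiC phic (xi t) - (k * (y t - yr (psi t))) *: gainG c kappa)]].

Lemma is_derive_scalel (e : R -> R) (G : 'rV[R]_d) t l :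
  is_derive t (1 : R) e l -> is_derive t (1 : R) (fun u => e u *: G) (l *: G).
Proof.
move=> D; apply: is_derive_row => i.
have -> : (fun u => (e u *: G) ord0 i) = G ord0 i \*: e.
  by apply/funext => u; rewrite mxE mulrC.
by have := is_deriveZ (G ord0 i) D => D'; apply: is_derive_eq; rewrite mxE mulrC.
Qed.

Definition track (psi : R -> 'rV[R]_r) (y : R -> R) (t : R) : R := y t - yr (psi t).

Definition track_input (mu : 'rV[R]_p) (psi : R -> 'rV[R]_r) (z : R -> 'rV[R]_n) (y : R -> R) (t : R) : R :=
  q (z t) (y t) mu - 'd yr (psi t) (s (psi t)).

(* In this coordinate the high-gain terms in [k] cancel. *)
Definition filt (kappa : R) (psi : R -> 'rV[R]_r) (y : R -> R) (xi : R -> 'rV[R]_d) (t : R) : 'rV[R]_d :=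
  xi t - track psi y t *: gainG c kappa.

Lemma closed_loop_error kappa k mu psi t0 t1 z y xi : C1 yr ->
  (forall t, is_derive t (1 : R) psi (s (psi t))) ->
  closed_loop kappa k mu psi t0 t1 z y xi ->
  [/\ {within `[t0, t1], continuous (track psi y)},
      {within `[t0, t1], continuous (filt kappa psi y xi)},
      forall t, t0 < t -> t < t1 -> is_derive t (1 : R) (track psi y)
        (- k * track psi y t + (track_input mu psi z y t + (Gamma R d *m (xi t)^T) ord0 ord0)) &
      forall t, t0 < t -> t < t1 -> is_derive t (1 : R) (filt kappa psi y xi)
        (filt kappa psi y xi t *m observer_mx (gainG c kappa) +
         (track psi y t *: (gainG c kappa *m observer_mx (gainG c kappa)) - phic (xi t) *: last_row R d
          - track_input mu psi z y t *: gainG c kappa))].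
Proof.
move=> C1yr dpsi [cz cy cxi D].
have dyr t : is_derive t (1 : R) (yr \o psi) ('d yr (psi t) (s (psi t))).
  by apply: is_derive_dcomp => //; have [] := C1yr (psi t) I.
have cyr : {within `[t0, t1], continuous (yr \o psi)}.
  by apply: continuous_subspaceT => t; exact: is_derive_cont (dyr t).
have ce : {within `[t0, t1], continuous (track psi y)} := within_sub_fun cy cyr.
have cG : continuous (fun x : R => x *: gainG c kappa).
  by apply: loclip_continuous; apply: loclip_scaleV; exact: loclip_id.
have de t : t0 < t -> t < t1 -> is_derive t (1 : R) (track psi y)
        (- k * track psi y t + (track_input mu psi z y t + (Gamma R d *m (xi t)^T) ord0 ord0)).
  move=> t0t tt1; have [_ dy _] := D t t0t tt1.
  have H := is_deriveB dy (dyr t); apply: is_derive_eq H _.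
  by rewrite /track /track_input; ring.
have cf : {within `[t0, t1], continuous (filt kappa psi y xi)}.
  exact: (within_sub_fun cxi (within_comp ce cG)).
split; [exact: ce|exact: cf|exact: de|].
move=> t t0t tt1; have [_ _ dxi] := D t t0t tt1.
have H := is_deriveB dxi (is_derive_scalel (gainG c kappa) (de t t0t tt1)).
apply: is_derive_eq H _.
set G := gainG c kappa; set e := track psi y t; rewrite -[_ - yr _]/e.
set ga := (_ *m _) ord0 ord0; set rho := track_input _ _ _ _ _.
rewrite /filt -/e -/G mulmxBl -scalemxAl.
have := PhiC_observer phic (xi t) G; rewrite -/ga.
move: (PhiC _ _) (_ *m _) (_ *m _) (phic _ *: _) => a1 a2 a3 a4 H1.
(* The terms [k e G] from the equations of [xi] and of [e] cancel here; [PhiC_observer] then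
   supplies the linear part. *)
transitivity (a1 - ga *: G - rho *: G); first by apply/rowP => i; rewrite !mxE; ring.
by rewrite H1; apply/rowP => i; rewrite !mxE; ring.
Qed.

Lemma Gamma_norm (x : 'rV[R]_d) : `|(Gamma R d *m x^T) ord0 ord0| <= `|x|.
Proof.
rewrite mxE; under eq_bigr do rewrite !mxE mulrC.
rewrite sum_nat_delta; case: insubP => [k _ _|_]; first exact: norm_rV_coord.
by rewrite normr0.
Qed.

(** Since the exponential dominates its tangent at 0, a transient of size [D] is damped below 1 by
    an exponent [D]. This keeps logarithms out of the constants. *)
Lemma le_expRN_mul (x D : R) : D <= x -> 0 <= D -> expR (- x) * D <= 1.
Proof.
move=> Dx D0; rewrite expRN mulrC ler_pdivrMr ?expR_gt0// mul1r.
by apply: le_trans (expR_ge1Dx x); apply: le_trans Dx _; rewrite lerDr.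
Qed.

Lemma enorm2_comb m (a b e : 'rV[R]_m) (x1 x2 x3 : R) (E1 ph Q1 : R) :
  `|x1| <= E1 -> `|x2| <= ph -> `|x3| <= Q1 ->
  enorm2 (x1 *: a - x2 *: b - x3 *: e) <=
  4 * (E1 ^+ 2 * enorm2 a + ph ^+ 2 * enorm2 b + Q1 ^+ 2 * enorm2 e).
Proof.
have S (x E N : R) : `|x| <= E -> 0 <= N -> x ^+ 2 * N <= E ^+ 2 * N.
  move=> xE N0; apply: ler_wpM2r => //.
  by rewrite -(@real_normK _ x) ?num_real// lerXn2r// nnegrE (le_trans _ xE).
move=> h1 h2 h3; apply: le_trans (enorm2D _ _) _; rewrite enorm2N enorm2Z.
have := enorm2D (x1 *: a) (- (x2 *: b)); rewrite enorm2N !enorm2Z.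
have := S _ _ _ h1 (enorm2_ge0 a); have := S _ _ _ h2 (enorm2_ge0 b); have := S _ _ _ h3 (enorm2_ge0 e).
have := enorm2_ge0 e; have := sqr_ge0 Q1; move: (enorm2 (_ - _)) => N.
move=> q0 e0; have := mulr_ge0 q0 e0.
move: (x1 ^+ 2 * _) (x2 ^+ 2 * _) (x3 ^+ 2 * _) (E1 ^+ 2 * _) (ph ^+ 2 * _) (Q1 ^+ 2 * _).
clear => *; lra.
Qed.

(** For [k >= 1] the quadratic term is also of order [1 / k], so smallness of the comparison error
    becomes one linear condition on [k]. *)
Lemma scaled_error_small (x a2 a1 E1 B k : R) : 0 <= x -> 0 <= a2 -> 0 < a1 -> 1 <= k ->
  x * (a2 / k * E1 ^+ 2 + a2 * (B / k) ^+ 2 / a1) <= x * (a2 * E1 ^+ 2 + a2 * B ^+ 2 / a1) / k.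
Proof.
move=> x0 a20 a10 k1; have k0 : 0 < k by apply: lt_le_trans k1.
have -> : x * (a2 * E1 ^+ 2 + a2 * B ^+ 2 / a1) / k = x * (a2 / k * E1 ^+ 2 + a2 * B ^+ 2 / k / a1).
  by field; rewrite !gt_eqF.
apply: ler_wpM2l => //; rewrite lerD2l; apply: ler_wpM2r; first by rewrite invr_ge0 ltW.
rewrite expr_div_n mulrA; apply: ler_wpM2l; first by rewrite mulr_ge0// sqr_ge0.
by rewrite lef_pV2 ?posrE ?exprn_gt0// expr2 ler_peMl// ltW.
Qed.

End ClosedLoop.

Section Arithmetic.
Variable R : realType.
Implicit Types a b x : R.

Lemma le_1Dsqr a b : a ^+ 2 <= b -> a <= 1 + b.
Proof. by have := sqr_ge0 (a - 1); nra. Qed.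

Lemma mul_sqr_le a b : 0 <= b -> b * a ^+ 2 <= (a * (b + 1)) ^+ 2.
Proof. by rewrite exprMn; have := sqr_ge0 a; move: (a ^+ 2) => x; nra. Qed.

Lemma sqr_le_quarter x : 0 <= x -> x <= 1 / 2 -> x ^+ 2 <= 1 / 4.
Proof. nra. Qed.

Lemma le_sum3 a b x y : 0 <= a -> 0 <= b -> 0 <= x -> y <= a \/ y <= b \/ y <= x -> y <= a + b + x.
Proof. by move=> ? ? ? [|[]]; lra. Qed.

Lemma add4_ge a b x y : 0 <= a -> 0 <= b -> 0 <= x -> 0 <= y ->
  [/\ a <= a + b + x + y, b <= a + b + x + y, x <= a + b + x + y & y <= a + b + x + y].
Proof. by move=> *; split; lra. Qed.

Lemma le_one_of_decay a b x : a <= x * b + 1 / 4 -> x * (2 * b) <= 1 -> a <= 1.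
Proof. lra. Qed.

End Arithmetic.

(** * Choice of the constants *)

Section Interval.
Variable R : realType.
Variables (r n p d : nat).
Variables (s : 'rV[R]_r -> 'rV[R]_r) (yr : 'rV[R]_r -> R)
  (f : 'rV[R]_n -> R -> 'rV[R]_p -> 'rV[R]_n) (q : 'rV[R]_n -> R -> 'rV[R]_p -> R)
  (phic : 'rV[R]_d -> R) (c : 'I_d -> R)
  (W : set 'rV[R]_r) (P : set 'rV[R]_p) (Z : set 'rV[R]_n) (Y : set R) (Xi : set 'rV[R]_d).
Hypothesis d0 : (0 < d)%N.
Hypothesis cP : compact P.
Hypothesis cY : compact Y.
Hypothesis cXi : compact Xi.
Hypothesis cW : compact W.
Hypothesis ls : locally_lipschitz s.
Hypothesis hyr : C1 yr.
Hypothesis hf : C1 (fun x : 'rV[R]_n * R * 'rV[R]_p => f x.1.1 x.1.2 x.2).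
Hypothesis hq : C1 (fun x : 'rV[R]_n * R * 'rV[R]_p => q x.1.1 x.1.2 x.2).
Hypothesis hin : C1 (zero_input s yr q : zstate R p r n -> R).
Hypothesis lphic : locally_lipschitz phic.
Hypothesis phic_supp : compact_support phic.
Hypothesis hc : Hurwitz (char_poly_of c).
Hypothesis hA2 : assumption_A2 s yr f P W Z.

Lemma fin_coords_zfy : fin_coords ('rV[R]_n * R * 'rV[R]_p)%type.
Proof.
apply: fin_coords_prod; last exact: fin_coords_rV.
by apply: fin_coords_prod; [exact: fin_coords_rV|exact: fin_coords_R].
Qed.

Lemma yr_loclip : locally_lipschitz yr.
Proof. by apply: C1_locally_lipschitz => //; exact: fin_coords_rV. Qed.

(** The rate is recovered from the first component of [tau], whose regularity is assumed, by adding
    [q] back at [mu = 0] and [z = 0]. *)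
Lemma reference_rate_bounded : exists2 B : R, 0 < B & forall w, W w -> `|'d yr w (s w)| <= B.
Proof.
have lin : locally_lipschitz (zero_input s yr q : zstate R p r n -> R).
  apply: C1_locally_lipschitz hin; apply: fin_coords_prod; last exact: fin_coords_rV.
  by apply: fin_coords_prod; exact: fin_coords_rV.
have lq := C1_locally_lipschitz fin_coords_zfy hq.
have l1 : locally_lipschitz (fun w : 'rV[R]_r => ((0 : 'rV[R]_p, w), 0 : 'rV[R]_n)).
  apply: loclip_pair; last exact: loclip_cst.
  by apply: loclip_pair; [exact: loclip_cst|exact: loclip_id].
have l2 : locally_lipschitz (fun w : 'rV[R]_r => ((0 : 'rV[R]_n, yr w), 0 : 'rV[R]_p)).
  apply: loclip_pair; last exact: loclip_cst.
  by apply: loclip_pair; [exact: loclip_cst|exact: yr_loclip].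
have l3 : locally_lipschitz (fun w : 'rV[R]_r => 'd yr w (s w)).
  have := loclip_add (loclip_comp l1 lin) (loclip_comp l2 lq).
  by congr locally_lipschitz; apply/funext => w /=; rewrite subrK.
exact: (continuous_bounded (loclip_continuous l3) cW).
Qed.

Lemma plant_bounds (Rz Yb : R) : exists L Q0 : R, [/\ 0 < L, 0 < Q0,
  forall mu x x' y y', P mu -> `|x| <= Rz -> `|x'| <= Rz -> `|y| <= Yb -> `|y'| <= Yb ->
     `|f x y mu - f x' y' mu| <= L * (`|x - x'| + `|y - y'|) &
  forall mu x y, P mu -> `|x| <= Rz -> `|y| <= Yb -> `|q x y mu| <= Q0].
Proof.
have lf := C1_locally_lipschitz fin_coords_zfy hf.
have lq := C1_locally_lipschitz fin_coords_zfy hq.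
pose K : set ('rV[R]_n * R * 'rV[R]_p) := box Rz `*` `[- Yb, Yb]%classic `*` P.
have cK : compact K.
  by apply: compact_setX => //; apply: compact_setX; [exact: compact_box|exact: segment_compact].
have KP mu x y : P mu -> `|x| <= Rz -> `|y| <= Yb -> K ((x, y), mu).
  move=> Pmu xR yY; split => //=; split => /=; first exact: boxP.
  by rewrite in_itv /= -ler_norml.
have [L L0 HL] := loclip_compact lf cK.
have [Q0 Q00 HQ0] := continuous_bounded (loclip_continuous lq) cK.
exists L, Q0; split => // [mu x x' y y' Pmu xR x'R yY y'Y|mu x y Pmu xR yY].
  apply: le_trans (HL _ _ (KP _ _ _ Pmu xR yY) (KP _ _ _ Pmu x'R y'Y)) _.
  rewrite ler_pM2l// prod_normE /= subrr normr0 ge_max addr_ge0// andbT.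
  by rewrite prod_normE /= ge_max lerDl lerDr !normr_ge0.
exact: (HQ0 _ (KP _ _ _ Pmu xR yY)).
Qed.

(* [Y1] and [X1] are reached again before the next sample because the ultimate bounds on the
   tracking error and on the filtered state do not depend on their initial values. *)
Lemma sampling_interval (kappa : R) : 0 < kappa ->
  exists Ts ks X1 Y1 Bd : R, [/\ 0 < Ts, 0 < ks, (forall y, Y y -> `|y| <= Y1),
    (forall xi, Xi xi -> `|xi| <= X1) &
    forall k, ks <= k -> forall mu, P mu -> forall psi,
    (forall t, is_derive t (1 : R) psi (s (psi t))) -> (forall t, W (psi t)) ->
    forall t0 t1 z y xi, t0 <= t1 -> closed_loop yr f q phic c kappa k mu psi t0 t1 z y xi ->
    Z (z t0) -> `|y t0| <= Y1 -> `|xi t0| <= X1 ->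
    (forall t, t0 <= t -> t <= t1 -> [/\ `|z t| <= Bd, `|y t| <= Bd & `|xi t| <= Bd]) /\
    (t0 + Ts <= t1 -> [/\ Z (z t1), `|y t1| <= Y1 & `|xi t1| <= X1])].
Proof.
move=> kap0; have [[C [cC Cst hC]] _ [d1 d10 [hd1 _]]] := hA2.
have [Rc Rc0 CR] := compact_norm_bound cC.
have [Ry Ry0 yrR] := continuous_bounded (loclip_continuous yr_loclip) cW.
have [Ly Ly0 LyB] := reference_rate_bounded.
have [Y0 Y00 YB] := compact_norm_bound cY.
have [X0 X00 XB] := compact_norm_bound cXi.
(* Contains the initial set and also the value recovered at the end of the interval, where the
   tracking error is at most 1. *)
pose Y1 := Num.max Y0 (Ry + 1).
have Y10 : 0 < Y1 by rewrite lt_max Y00.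
have Y1r : Ry + 1 <= Y1 by rewrite le_max lexx orbT.
pose E0 := Y1 + Ry; have E00 : 0 < E0 by rewrite addr_gt0.
have [L [Q0 [L0 Q00 LF QB]]] := plant_bounds (Rc + 2) (E0 + 1 + Ry).
have [ph ph0 phB] := compact_support_bounded (loclip_continuous lphic) phic_supp.
have [m [Q [B' [al [al0 QB' HQ]]]]] := observer_lyapunov d0 kap0 hc.
set G := gainG c kappa in HQ; set F := observer_mx G in HQ.
pose Q1 := Q0 + Ly; have Q10 : 0 < Q1 by rewrite addr_gt0.
(* Bounds the forcing of the filtered state while [good] holds; neither [k] nor the size of [xi]
   enters. *)
pose V1 := 4 * ((E0 + 1) ^+ 2 * enorm2 (G *m F *m Q) + ph ^+ 2 * enorm2 (last_row R d *m Q) + Q1 ^+ 2 * enorm2 (G *m Q)).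
have V10 : 0 <= V1.
  by rewrite mulr_ge0// addr_ge0 ?addr_ge0// mulr_ge0 ?sqr_ge0 ?enorm2_ge0.
have [KB KB0 HKB] := enorm2_mulmx B'; have [KQ KQ0 HKQ] := enorm2_mulmx Q.
pose C' := V1 / al ^+ 2; have C'0 : 0 <= C' by rewrite divr_ge0// sqr_ge0.
have xiB (x : 'rV[R]_d) (e D : R) : enorm2 (x *m Q) <= D -> `|e| <= E0 + 1 ->
    `|x + e *: G| <= 1 + KB * D + (E0 + 1) * `|G|.
  move=> xD eE; apply: le_trans (ler_normD _ _) _; rewrite normrZ; apply: lerD; last exact: ler_wpM2r.
  have H1 : `|x| ^+ 2 <= KB * D.
    apply: le_trans (norm_le_enorm2 x) _; rewrite -{1}[x]mulmx1 -QB' mulmxA.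
    by apply: le_trans (HKB _) _; rewrite ler_pM2l.
  exact: le_1Dsqr.
(* The second term bounds [xi] once the filtered state is within 1 of its ultimate level [C']. As
   [C'] does not depend on [X1], the choice is not circular; [D0] and [V2] below depend on [X1]. *)
pose X1 := Num.max X0 (1 + KB * (1 + C') + (E0 + 1) * `|G|).
have X10 : 0 < X1 by rewrite lt_max X00.
pose D0 := KQ * (d%:R * (X1 + E0 * `|G|) ^+ 2).
have D00 : 0 <= D0 by rewrite mulr_ge0 ?(ltW KQ0)// mulr_ge0 ?sqr_ge0.
pose V2 := D0 + C' + 1.
pose X2 := 1 + KB * V2 + (E0 + 1) * `|G|.
have X20 : 0 < X2.
  rewrite /X2 -addrA ltr_pwDl// addr_ge0 ?mulr_ge0 ?(ltW KB0)//; last by rewrite addr_ge0 ?(ltW E00).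
  by rewrite /V2 addr_ge0// addr_ge0.
pose Bb := Q1 + X2; have Bb0 : 0 < Bb by rewrite addr_gt0.
pose eps2 := Num.min 1 ((d1 / 2) ^+ 2).
have eps20 : 0 < eps2 by rewrite lt_min ltr01 exprn_gt0// divr_gt0.
have eps21 : eps2 <= 1 by rewrite ge_min lexx.
have eps2d : eps2 <= (d1 / 2) ^+ 2 by rewrite ge_min lexx orbT.
pose dim : R := (p + r + n)%:R.
have dim0 : 0 <= dim by rewrite ler0n.
(* Attraction is obtained in the maximum norm while [xdist] is Euclidean; the factor [dim + 1]
   covers the passage from one to the other. *)
have epsA0 : 0 < d1 / 2 / (dim + 1) by rewrite !divr_gt0// ltr_wpDl.
have [h h0 Hh] := omega_limit_attracts (zero_field s yr f : zstate R p r n -> _) (P `*` W `*` Z) cC epsA0.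
have hatt x : solution (zero_field s yr f : zstate R p r n -> _) +oo%E x -> (P `*` W `*` Z) (x 0) ->
  (forall t, 0 <= t -> C (x t)) -> forall t, h <= t ->
  exists2 x', omega_limit (zero_field s yr f) (P `*` W `*` Z) x' &
    (p + r + n)%:R * `|x t - x'| ^+ 2 <= (d1 / 2) ^+ 2.
  move=> sx x0 Cx t ht; have [x' Ax' Hx'] := Hh x sx x0 Cx t ht; exists x' => //.
  move: Hx'; rewrite ler_pdivlMr ?ltr_wpDl// -/dim => H.
  apply: le_trans (_ : (`|x t - x'| * (dim + 1)) ^+ 2 <= _).
    exact: mul_sqr_le.
  by rewrite lerXn2r ?nnegrE ?mulr_ge0 ?addr_ge0// ltW// divr_gt0.
pose a1 := 3 * n%:R * L + 1; pose a2 := n%:R * L.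
have a10 : 0 < a1 by rewrite ltr_wpDl// -mulrA mulr_ge0// mulr_ge0// ltW.
have a20 : 0 <= a2 by rewrite mulr_ge0// ltW.
pose Kc := expR (a1 * (2 * h)) * (a2 * (E0 + 1) ^+ 2 + a2 * Bb ^+ 2 / a1).
have Kc0 : 0 <= Kc.
  apply: mulr_ge0 (expR_ge0 _) (addr_ge0 (mulr_ge0 a20 (sqr_ge0 _)) _).
  exact: divr_ge0 (mulr_ge0 a20 (sqr_ge0 _)) (ltW a10).
(* Time [h] brings [z] back to [Z]; time [D0 / al] brings the transient of the filtered state below
   1, by [le_expRN_mul]. *)
pose Ts := h + D0 / al.
have Dal0 : 0 <= D0 / al by rewrite divr_ge0// ltW.
have Ts0 : 0 < Ts by rewrite ltr_pwDl.
have Tsh : h <= Ts by rewrite lerDl.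
have ETs0 : 0 <= 2 * E0 ^+ 2 / Ts by rewrite divr_ge0 ?mulr_ge0 ?sqr_ge0// ltW.
have Keps0 : 0 <= Kc / eps2 by rewrite divr_ge0// ltW.
(* The summands ensure in turn [k >= 1] for [scaled_error_small], a residual tracking error of at
   most 1/2, the decay of the initial tracking error within time [Ts], and a comparison error of at
   most [eps2]. *)
pose ks := 1 + 2 * Bb + 2 * E0 ^+ 2 / Ts + Kc / eps2.
have [ks1 ks2 ks3 ks4] := add4_ge ler01 (mulr_ge0 (ler0n _ 2) (ltW Bb0)) ETs0 Keps0.
rewrite -/ks in ks1 ks2 ks3 ks4.
exists Ts, ks, X1, Y1, (Rc + 2 + (E0 + 1 + Ry) + X2); split => //.
- exact: lt_le_trans ks1.
- by move=> y /YB H; rewrite le_max H.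
- by move=> xi /XB H; rewrite le_max H.
move=> k ksk mu Pmu psi dpsi Wpsi t0 t1 z y xi t01 CL Zt0 yt0 xit0.
have k1 : 1 <= k by exact: le_trans ksk.
have k0 : 0 < k by exact: lt_le_trans k1.
have [ce cet de det] := closed_loop_error hyr dpsi CL.
have [cz cy cxi D] := CL.
pose e := track yr psi y; pose et := filt yr c kappa psi y xi.
have yE u : y u = yr (psi u) + e u by rewrite /e /track addrC subrK.
have xiE u : xi u = et u + e u *: G by rewrite /et /filt subrK.
have et0 : `|e t0| <= E0.
  by apply: le_trans (ler_normB _ _) _; apply: lerD => //; exact: yrR.
have Dt0 : enorm2 (et t0 *m Q) <= D0.
  apply: le_trans (HKQ _) _; rewrite ler_pM2l//; apply: le_trans (enorm2_le_norm _) _.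
  rewrite ler_wpM2l// lerXn2r ?nnegrE//; first by rewrite addr_ge0 ?mulr_ge0 ?(ltW X10) ?(ltW E00).
  apply: le_trans (ler_normB _ _) _; apply: lerD => //.
  by rewrite normrZ ler_wpM2r.
have yB u : `|e u| <= E0 + 1 -> `|y u| <= E0 + 1 + Ry.
  by move=> eE; rewrite yE addrC; apply: le_trans (ler_normD _ _) _; apply: lerD => //; exact: yrR.
have rhoB u : `|z u| <= Rc + 2 -> `|e u| <= E0 + 1 -> `|track_input s yr q mu psi z y u| <= Q1.
  move=> zR eE; apply: le_trans (ler_normB _ _) _; apply: lerD; last exact: LyB.
  by apply: QB => //; exact: yB.
have de' u : t0 < u -> u < t1 -> is_derive u (1 : R) e
     (- k * e u + (track_input s yr q mu psi z y u + (Gamma R d *m (xi u)^T) ord0 ord0)) /\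
  ([/\ `|z u| < Rc + 2, `|e u| < E0 + 1 & enorm2 (et u *m Q) < V2] ->
    `|track_input s yr q mu psi z y u + (Gamma R d *m (xi u)^T) ord0 ord0| <= Bb).
  move=> u0 u1; split; first exact: de.
  move=> [/ltW g1 /ltW g2 /ltW g3]; apply: le_trans (ler_normD _ _) _; apply: lerD; first exact: rhoB.
  by apply: le_trans (Gamma_norm _) _; rewrite xiE; exact: xiB.
have det' u : t0 < u -> u < t1 -> is_derive u (1 : R) et (et u *m F + (e u *: (G *m F) - phic (xi u) *: last_row R d - track_input s yr q mu psi z y u *: G)) /\
  ([/\ `|z u| < Rc + 2, `|e u| < E0 + 1 & enorm2 (et u *m Q) < V2] ->
    enorm2 ((e u *: (G *m F) - phic (xi u) *: last_row R d - track_input s yr q mu psi z y u *: G) *m Q) <= V1).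
  move=> u0 u1; split; first exact: det.
  move=> [/ltW g1 /ltW g2 /ltW g3]; rewrite !mulmxBl -!scalemxAl.
  by apply: enorm2_comb => //; exact: rhoB.
have dz u : t0 < u -> u < t1 -> is_derive u (1 : R) z (f (z u) (yr (psi u) + e u) mu).
  by move=> u0 u1; rewrite -yE; have [] := D u u0 u1.
have kB : (Bb / k) ^+ 2 <= 1 / 4.
  have H : 0 <= Bb / k <= 1 / 2.
    rewrite (divr_ge0 (ltW Bb0) (ltW k0)) /= ler_pdivrMr//.
    by rewrite mulrC mul1r ler_pdivlMr// mulrC (le_trans ks2 ksk).
  by move: H => /andP[]; exact: sqr_le_quarter.
have DV : D0 + V1 / al ^+ 2 < V2 by rewrite /V2 -/C' ltrDl.
have small : expR (a1 * (2 * h)) * (a2 / k * (E0 + 1) ^+ 2 + a2 * (Bb / k) ^+ 2 / a1) <= eps2.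
  apply: le_trans (scaled_error_small _ _ (expR_ge0 _) a20 a10 k1) _.
  rewrite -/Kc ler_pdivrMr// mulrC -ler_pdivrMr//.
  exact: le_trans ks4 ksk.
have core := core_conclusion ls hC CR d10 hd1 h0 hatt yrR eps21 eps2d Pmu dpsi Wpsi k0 (ltW L0) (ltW E00)
  (fun x x' y y' => @LF mu x x' y y' Pmu) al0 V10 HQ cz ce cet dz de' det' kB DV
  (erefl a1) (erefl a2) small Zt0 et0 Dt0.
have main t : t0 <= t -> t <= t1 -> [/\ `|z t| <= Rc + 2, `|e t| <= E0 + 1 & `|xi t| <= X2].
  move=> t0t tt1; have [[/ltW g1 /ltW g2 /ltW g3] _ _ _] := core t t0t tt1.
  by split => //; rewrite xiE; exact: xiB.
split=> [t t0t tt1|hT].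
  have [g1 g2 g3] := main t t0t tt1; have g2' := yB t g2.
  have : 0 <= E0 + 1 + Ry by exact: le_trans g2'.
  have Rc20 : 0 <= Rc + 2 by exact: le_trans g1.
  by move=> E0'; split; apply: le_sum3 => //; rewrite ?(ltW X20)//; tauto.
have [_ HZ He HD] := core t1 t01 (lexx _).
have e1 : `|e t1| <= 1.
  rewrite -(@ler_sqr R) ?nnegrE// expr1n real_normK ?num_real//.
  have x1 : 2 * E0 ^+ 2 <= k * (t1 - t0).
    apply: le_trans (_ : k * Ts <= _); last by rewrite ler_pM2l// lerBrDl.
    rewrite -ler_pdivrMr//.
    exact: le_trans ks3 ksk.
  have := le_expRN_mul x1 (mulr_ge0 (ler0n _ 2) (sqr_ge0 E0)); rewrite -mulNr.
  exact: le_one_of_decay He.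
have D1 : enorm2 (et t1 *m Q) <= 1 + C'.
  apply: le_trans HD _; rewrite lerD2r mulNr; apply: le_expRN_mul => //.
  rewrite -ler_pdivrMl// mulrC lerBrDl; apply: le_trans hT; rewrite lerD2l /Ts.
  by rewrite lerDr ltW.
split.
- by apply: HZ; apply: le_trans hT; rewrite lerD2l.
- rewrite yE addrC; apply: le_trans (ler_normD _ _) _; apply: le_trans Y1r; rewrite addrC.
  by apply: lerD => //; exact: yrR.
- rewrite xiE le_max; apply/orP; right; apply: xiB => //.
  by apply: le_trans e1 _; rewrite lerDr ltW.
Qed.

End Interval.

(** * Prolongation of trajectories *)

Section Continuation.
Variable R : realType.

(** Values at times tending to [b] accumulate at some [p] in [K]. The life span given by [picard] is
    uniform near [p], so a solution restarted late enough passes [b], and uniqueness identifies it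
    with [x] before [b]. *)
Lemma ode_continue (V : normedModType R) (F : V -> V) (K : set V) (x : R -> V) (a b : R) :
  geo_complete V -> has_primitives V -> locally_lipschitz F -> compact K -> a < b ->
  (forall t, a < t -> t < b -> is_derive t (1 : R) x (F (x t)) /\ K (x t)) ->
  exists (t0 de : R) (xt : R -> V), [/\ a < t0, t0 < b, b < t0 + de,
    forall t, `|t - t0| < de -> is_derive t (1 : R) xt (F (xt t)) &
    forall t, t0 <= t -> t < b -> x t = xt t].
Proof.
move=> gV pV lF cK ab H.
(* The shift to [i.+2] keeps even the first time strictly after [a]. *)
pose ti (i : nat) : R := b - (b - a) / i.+2%:R.
have ba : 0 < b - a by rewrite subr_gt0.
have tib i : ti i < b by rewrite gtrBl divr_gt0.
have tia i : a < ti i.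
  rewrite ltrBrDr -ltrBrDl ltr_pdivrMr//; apply: lt_le_trans (_ : (b - a) * 2%:R <= _).
    by rewrite ltr_pMr// ltr1n.
  by rewrite ler_pM2l// ler_nat.
have xK : ((x \o ti) @ \oo) K by exists 0%N => // i _; have [] := H _ (tia i) (tib i).
have [p [Kp clp]] := cK ((x \o ti) @ \oo) _ xK.
have [rho [de [rho0 de0 Hp]]] := picard gV pV lF p.
have [m _ Hm] : \forall i \near \oo, i.+1%:R^-1 < de / (b - a) :> R.
  have e0 : 0 < de / (b - a) by rewrite divr_gt0.
  exact: (near_infty_natSinv_lt (PosNum e0)).
have A1 : ((x \o ti) @ \oo) [set (x \o ti) i | i in [set i | (m <= i)%N]] by exists m => // i /= mi; exists i.
have [v [[i /= mi <-] hv]] := clp _ _ A1 (nbhsx_ballx p _ rho0).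
have hv' : `|x (ti i) - p| < rho by rewrite distrC; move: hv; rewrite -ball_normE.
have [y [y0 dy]] := Hp _ hv'.
have bde : b < ti i + de.
  rewrite /ti addrAC -addrA ltrDl subr_gt0 ltr_pdivrMr//.
  have := Hm i mi; rewrite /= ltr_pdivlMr// mulrC ltr_pdivrMr// => h1.
  by apply: lt_trans h1 _; rewrite ltr_pM2l// ltr_nat.
pose xt t := y (t - ti i).
have dxt t : `|t - ti i| < de -> is_derive t (1 : R) xt (F (xt t)).
  by move=> td; apply: is_derive_shiftl; exact: dy.
exists (ti i), de, xt; split => // t t0t tb.
have near_t u : ti i <= u -> u <= t -> `|u - ti i| < de.
  by move=> u0 ut; rewrite ger0_norm ?subr_ge0// ltrBlDl (le_lt_trans ut)// (lt_trans tb).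
have C1 : {within `[ti i, t], continuous x}.
  apply: derivable_within_continuous => u; rewrite in_itv /= => /andP[u0 ut].
  by have [[]] := H u (lt_le_trans (tia i) u0) (le_lt_trans ut tb).
have C2 : {within `[ti i, t], continuous xt}.
  apply: derivable_within_continuous => u; rewrite in_itv /= => /andP[u0 ut].
  by have [] := dxt u (near_t u u0 ut).
apply: (ode_unique lF C1 C2) => //.
- by move=> u u0 ut; have [] := H u (lt_trans (tia i) u0) (lt_trans ut tb).
- by move=> u u0 ut; apply: dxt; apply: near_t; exact: ltW.
- by rewrite /xt subrr.
Qed.

Lemma upto_contP (V : normedModType R) (g : R -> V) (b : \bar R) :
  {within upto b, continuous g} <->
  (forall t, upto b t -> forall e, 0 < e -> exists2 d, 0 < d &
     forall s, upto b s -> `|s - t| < d -> `|g s - g t| < e).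
Proof.
split=> [/subspace_continuousP H t tb e e0|H].
  have /cvgrPdist_lt/(_ _ e0)/nbhs_ballP [d d0 Hd] := H t tb.
  by exists d => // u ub ut; rewrite distrC; apply: Hd => //; rewrite /ball /= distrC.
apply/subspace_continuousP => t tb; apply/cvgrPdist_lt => e e0.
have [d d0 Hd] := H t tb e e0.
apply/nbhs_ballP; exists d => // u; rewrite /ball /= => ut ub.
by rewrite distrC; apply: Hd => //; rewrite distrC.
Qed.

Lemma continuous_atP (V : normedModType R) (g : R -> V) (t : R) : {for t, continuous g} ->
  forall e, 0 < e -> exists2 d, 0 < d & forall s, `|s - t| < d -> `|g s - g t| < e.
Proof.
move=> /cvgrPdist_lt H e /H /nbhs_ballP [d d0 Hd]; exists d => // s st.
by rewrite distrC; apply: Hd; rewrite /ball /= distrC.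
Qed.

Definition splice (V : Type) (b : R) (g1 g2 : R -> V) (t : R) : V := if t < b then g1 t else g2 t.

Lemma splice_lt (V : Type) b (g1 g2 : R -> V) t : t < b -> splice b g1 g2 t = g1 t.
Proof. by rewrite /splice => ->. Qed.

Lemma splice_ge (V : Type) b (g1 g2 : R -> V) t : b <= t -> splice b g1 g2 t = g2 t.
Proof. by rewrite /splice ltNge => ->. Qed.

(** The auxiliary [gt] coincides with [g] just before [b] and is continuous at [b]; it supplies the
    left limit of [g] there. *)
Lemma splice_continuous (V : normedModType R) (g gt g2 : R -> V) (t0 b b' : R) :
  t0 < b -> {within upto b%:E, continuous g} -> (forall t, t0 <= t -> t < b -> g t = gt t) ->
  {for b, continuous gt} -> (forall t, b <= t -> t < b' -> {for t, continuous g2}) ->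
  g2 b = gt b -> {within upto b'%:E, continuous (splice b g g2)}.
Proof.
move=> t0b /upto_contP cg ggt cgt cg2 E; apply/upto_contP => t [t00 tb'] e e0.
have [tb|bt] := ltP t b.
  have [d d0 Hd] := cg t (conj t00 (ltac:(by rewrite lte_fin) : (t%:E < b%:E)%E)) e e0.
  exists (Num.min d (b - t)); first by rewrite lt_min d0 subr_gt0.
  move=> u [u0 _]; rewrite lt_min => /andP[ud ub].
  have ub' : u < b by have := le_lt_trans (ler_norm _) ub; lra.
  by rewrite !splice_lt//; apply: Hd => //; split => //; rewrite lte_fin.
rewrite lte_fin in tb'; have [d d0 Hd] := continuous_atP (cg2 t bt tb') e0.
have [bt'|tb] := ltP b t.
  exists (Num.min d (t - b)); first by rewrite lt_min d0 subr_gt0.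
  move=> u _; rewrite lt_min => /andP[ud ub].
  have ub' : b <= u by move: ub; rewrite distrC => ub; have := le_lt_trans (ler_norm _) ub; lra.
  by rewrite !splice_ge//; apply: Hd.
have tE : t = b by apply/eqP; rewrite eq_le tb bt.
subst t; have [d' d'0 Hd'] := continuous_atP cgt e0.
exists (Num.min (Num.min d d') (b - t0)); first by rewrite !lt_min d0 d'0 subr_gt0.
move=> u _; rewrite !lt_min => /andP[/andP[ud ud'] ub]; rewrite (splice_ge _ _ (lexx b)).
have [ub'|bu] := ltP u b; last by rewrite splice_ge//; exact: Hd.
rewrite splice_lt// ggt ?E//; first exact: Hd'.
by move: ub; rewrite distrC => ub; have := le_lt_trans (ler_norm _) ub; lra.
Qed.

End Continuation.

(** * The loop between samples as an autonomous equation *)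

Section LoopField.
Variable R : realType.
Variables (r n p d : nat).
Variables (s : 'rV[R]_r -> 'rV[R]_r) (yr : 'rV[R]_r -> R)
  (f : 'rV[R]_n -> R -> 'rV[R]_p -> 'rV[R]_n) (q : 'rV[R]_n -> R -> 'rV[R]_p -> R)
  (phic : 'rV[R]_d -> R) (c : 'I_d -> R) (kappa k : R) (mu : 'rV[R]_p).

(** Including [wd_] makes the field autonomous, as [picard] requires. The exosystem state acts on
    the loop only through the resets and is kept apart. *)
Definition loop_state : normedModType R := ('rV[R]_r * 'rV[R]_n * R * 'rV[R]_d)%type.

Definition loop_field (x : loop_state) : loop_state :=
  (s x.1.1.1, f x.1.1.2 x.1.2 mu,
   q x.1.1.2 x.1.2 mu + (Gamma R d *m (x.2)^T) ord0 ord0 - k * (x.1.2 - yr x.1.1.1),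
   PhiC phic x.2 - (k * (x.1.2 - yr x.1.1.1)) *: gainG c kappa).

Definition loop_flow (wd : R -> 'rV[R]_r) (z : R -> 'rV[R]_n) (y : R -> R) (xi : R -> 'rV[R]_d)
    (t : R) : Prop :=
  [/\ is_derive t (1 : R) wd (s (wd t)),
      is_derive t (1 : R) z (f (z t) (y t) mu),
      is_derive t (1 : R) y (q (z t) (y t) mu + (Gamma R d *m (xi t)^T) ord0 ord0
             - k * (y t - yr (wd t))) &
      is_derive t (1 : R) xi (PhiC phic (xi t) - (k * (y t - yr (wd t))) *: gainG c kappa)].

Lemma loop_flow_pair wd z y xi t : loop_flow wd z y xi t ->
  is_derive t (1 : R) (fun u => (wd u, z u, y u, xi u) : loop_state) (loop_field (wd t, z t, y t, xi t)).
Proof. by move=> [d1 d2 d3 d4]; exact: (is_derive_pr (is_derive_pr (is_derive_pr d1 d2) d3) d4). Qed.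

Lemma loop_flow_proj (x : R -> loop_state) t : is_derive t (1 : R) x (loop_field (x t)) ->
  loop_flow (fun u => (x u).1.1.1) (fun u => (x u).1.1.2) (fun u => (x u).1.2) (fun u => (x u).2) t.
Proof.
move=> D; have D1 := is_derive_fst D; have D2 := is_derive_snd D.
have D11 := is_derive_fst D1; have D12 := is_derive_snd D1.
have D111 := is_derive_fst D11; have D112 := is_derive_snd D11.
by split.
Qed.

Lemma loop_flow_ext wd z y xi wd' z' y' xi' t de : 0 < de ->
  (forall u, `|u - t| < de -> [/\ wd' u = wd u, z' u = z u, y' u = y u & xi' u = xi u]) ->
  loop_flow wd z y xi t -> loop_flow wd' z' y' xi' t.
Proof.
move=> de0 H [d1 d2 d3 d4].
have nb (Q : R -> Prop) : (forall u, `|u - t| < de -> Q u) -> \forall u \near t, Q u.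
  by move=> HQ; apply/nbhs_ballP; exists de => // u; rewrite /ball /= distrC; exact: HQ.
have [E1 E2 E3 E4] := H t ltac:(by rewrite subrr normr0).
rewrite /loop_flow E1 E2 E3 E4; split.
- by apply: is_derive_ext d1; apply: nb => u /H [->].
- by apply: is_derive_ext d2; apply: nb => u /H [_ ->].
- by apply: is_derive_ext d3; apply: nb => u /H [_ _ ->].
- by apply: is_derive_ext d4; apply: nb => u /H [_ _ _ ->].
Qed.

Lemma PhiC_loclip : locally_lipschitz phic -> locally_lipschitz (PhiC phic).
Proof.
move=> lp; apply: loclip_row => i.
case E : (insub i.+1 : option 'I_d) => [j|].
  have -> : (fun x : 'rV[R]_d => PhiC phic x ord0 i) = (fun x => x ord0 j).
    by apply/funext => x; rewrite mxE E.
  exact: loclip_coord.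
have -> : (fun x : 'rV[R]_d => PhiC phic x ord0 i) = (fun x => - phic x).
  by apply/funext => x; rewrite mxE E.
exact: loclip_opp.
Qed.

Lemma loop_field_loclip : locally_lipschitz s -> C1 yr ->
  C1 (fun x : 'rV[R]_n * R * 'rV[R]_p => f x.1.1 x.1.2 x.2) ->
  C1 (fun x : 'rV[R]_n * R * 'rV[R]_p => q x.1.1 x.1.2 x.2) ->
  locally_lipschitz phic -> locally_lipschitz loop_field.
Proof.
move=> ls hyr hf hq lp.
have fc : fin_coords ('rV[R]_n * R * 'rV[R]_p)%type.
  apply: fin_coords_prod; last exact: fin_coords_rV.
  by apply: fin_coords_prod; [exact: fin_coords_rV|exact: fin_coords_R].
have lf := C1_locally_lipschitz fc hf; have lq := C1_locally_lipschitz fc hq.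
have lyr := C1_locally_lipschitz (@fin_coords_rV R r) hyr.
have p1 : locally_lipschitz (fun x : loop_state => x.1) by exact: loclip_fst.
have pxi : locally_lipschitz (fun x : loop_state => x.2) by exact: loclip_snd.
have p11 : locally_lipschitz (fun x : loop_state => x.1.1) := loclip_comp p1 (@loclip_fst R _ _).
have py : locally_lipschitz (fun x : loop_state => x.1.2) := loclip_comp p1 (@loclip_snd R _ _).
have pw : locally_lipschitz (fun x : loop_state => x.1.1.1) := loclip_comp p11 (@loclip_fst R _ _).
have pz : locally_lipschitz (fun x : loop_state => x.1.1.2) := loclip_comp p11 (@loclip_snd R _ _).
have pzy : locally_lipschitz (fun x : loop_state => (x.1.1.2, x.1.2, mu) : 'rV[R]_n * R * 'rV[R]_p).
  by apply: loclip_pair; [exact: loclip_pair|exact: loclip_cst].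
have pe : locally_lipschitz (fun x : loop_state => k * (x.1.2 - yr x.1.1.1)).
  apply: (loclip_scale k (F := fun x : loop_state => x.1.2 - yr x.1.1.1)).
  by apply: loclip_add => //; apply: loclip_opp; exact: (loclip_comp pw lyr).
have pG : locally_lipschitz (fun x : loop_state => (Gamma R d *m (x.2)^T) ord0 ord0).
  have -> : (fun x : loop_state => (Gamma R d *m (x.2)^T) ord0 ord0) =
     (fun x : loop_state => if insub 0%N is Some i then x.2 ord0 i else 0).
    apply/funext => x; rewrite mxE -sum_nat_delta.
    by apply: eq_bigr => i _; rewrite !mxE mulrC.
  case: insubP => [i _ _|_]; last exact: loclip_cst.
  exact: (loclip_comp pxi (@loclip_coord R d i)).
apply: loclip_pair; last first.
  apply: loclip_add; first exact: (loclip_comp pxi (PhiC_loclip lp)).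
  by apply: loclip_opp; exact: loclip_scaleV.
apply: loclip_pair; last first.
  apply: loclip_add; last exact: loclip_opp.
  by apply: loclip_add => //; exact: (loclip_comp pzy lq).
by apply: loclip_pair; [exact: (loclip_comp pw ls)|exact: (loclip_comp pzy lf)].
Qed.

Lemma loop_state_complete : geo_complete loop_state.
Proof.
apply: geo_complete_prod; last exact: geo_complete_rV.
apply: geo_complete_prod; last exact: geo_complete_R.
by apply: geo_complete_prod; exact: geo_complete_rV.
Qed.

Lemma loop_state_primitives : has_primitives loop_state.
Proof.
apply: has_primitives_prod; last exact: has_primitives_rV.
apply: has_primitives_prod; last exact: has_primitives_R.
by apply: has_primitives_prod; exact: has_primitives_rV.
Qed.

End LoopField.

(** * Gluing a continuation to a trajectory *)

Section Extension.
Variable R : realType.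
Variables (r n p d N : nat).
Variables (s : 'rV[R]_r -> 'rV[R]_r) (yr : 'rV[R]_r -> R)
  (f : 'rV[R]_n -> R -> 'rV[R]_p -> 'rV[R]_n) (q : 'rV[R]_n -> R -> 'rV[R]_p -> R)
  (phic : 'rV[R]_d -> R) (c : 'I_d -> R) (lev : nat -> R) (T kappa k : R) (mu : 'rV[R]_p).
Let traj := trajectory s yr f q phic c N lev T kappa k mu.
Let fld := loop_field s yr f q phic c kappa k mu.
Hypothesis T0 : 0 < T.

Lemma at_right_eq (V : normedModType R) (g g' : R -> V) (t b : R) (l : V) : t < b ->
  (forall u, t < u -> u < b -> g' u = g u) -> g u @[u --> t^'+] --> l -> g' u @[u --> t^'+] --> l.
Proof.
move=> tb H; apply: cvg_trans; apply: near_eq_cvg; near=> u; apply/esym; apply: H.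
  by near: u; exact: nbhs_right_gt.
by near: u; exact: nbhs_right_lt.
Unshelve. all: by end_near. Qed.

Lemma at_left_eq (V : normedModType R) (g g' : R -> V) (t a : R) (l : V) : a < t ->
  (forall u, a < u -> u < t -> g' u = g u) -> g u @[u --> t^'-] --> l -> g' u @[u --> t^'-] --> l.
Proof.
move=> tb H; apply: cvg_trans; apply: near_eq_cvg; near=> u; apply/esym; apply: H.
  by near: u; exact: nbhs_left_gt.
by near: u; exact: nbhs_left_lt.
Unshelve. all: by end_near. Qed.

Variables (b b' t0 : R) (j : nat) (X : signals R r n d) (om : R -> 'rV[R]_r).
Variables (xt x2 : R -> loop_state R r n d).
(* If [b] is a sampling time, the left limit of [wd_] there is read off [xt]. *)
Let wdm' (i : nat) := if i == j.+1 then (xt b).1.1.1 else wdm_ X i.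
Let X' : signals R r n d := Signals om (splice b (wd_ X) (fun t => (x2 t).1.1.1)) wdm'
  (splice b (z_ X) (fun t => (x2 t).1.1.2)) (splice b (y_ X) (fun t => (x2 t).1.2))
  (splice b (xi_ X) (fun t => (x2 t).2)).

(** Either [b] precedes the next sample and a single solution runs through [b], or [b] is that
    sample and [x2] starts from the reset value. The bound [b' <= j.+2%:R * T] excludes any further
    sampling time before [b']. *)
Lemma splice_trajectory :
  traj b%:E X -> (forall t, is_derive t (1 : R) om (s (om t))) ->
  (forall t, upto b%:E t -> w_ X t = om t) ->
  j%:R * T < t0 -> t0 < b -> b < b' -> b <= j.+1%:R * T -> b' <= j.+2%:R * T ->
  is_derive b (1 : R) xt (fld (xt b)) ->
  (forall t, t0 <= t -> t < b ->
     [/\ wd_ X t = (xt t).1.1.1, z_ X t = (xt t).1.1.2, y_ X t = (xt t).1.2 & xi_ X t = (xt t).2]) ->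
  (forall t, b <= t -> t < b' -> is_derive t (1 : R) x2 (fld (x2 t))) ->
  [/\ (x2 b).1.1.2 = (xt b).1.1.2, (x2 b).1.2 = (xt b).1.2 & (x2 b).2 = (xt b).2] ->
  (b < j.+1%:R * T /\ b' <= j.+1%:R * T /\ x2 = xt) \/
  (b = j.+1%:R * T /\ (x2 b).1.1.1 = (xt b).1.1.1 + (lev j.+1 / N%:R) *:
      \row_(i < r) quantize N (lev j.+1) (om b ord0 i - (xt b).1.1.1 ord0 i)) ->
  traj b'%:E X' /\ agree_upto b%:E X X'.
Proof.
move=> tr dom wom jt0 t0b bb' bj1 b'j2 dxt Xxt dx2 [E2 E3 E4] cases.
have b0 : 0 < b by have := traj_dom tr; rewrite lte_fin.
have jb : j%:R * T < b by exact: lt_trans t0b.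
have leT (i i' : nat) : (i%:R * T < i'%:R * T) = (i < i')%N by rewrite ltr_pM2r// ltr_nat.
(* A sampling time before [b'] is either an old one, before [b], or the one numbered [j.+1], which
   then equals [b]. *)
have idx (i : nat) : ((i%:R * T)%:E < b'%:E)%E ->
    i%:R * T < b /\ i != j.+1 \/ [/\ i = j.+1, b = j.+1%:R * T &
      (x2 b).1.1.1 = (xt b).1.1.1 + (lev j.+1 / N%:R) *:
      \row_(i < r) quantize N (lev j.+1) (om b ord0 i - (xt b).1.1.1 ord0 i)].
  rewrite lte_fin => ib'; have [ib|bi] := ltP (i%:R * T) b.
    left; split => //; apply: contraTneq ib => ->; by rewrite -leNgt.
  right; have ij : (j < i)%N by rewrite -leT; exact: lt_le_trans bi.
  have ij2 : (i < j.+2)%N by rewrite -leT; exact: lt_le_trans b'j2.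
  have iE : i = j.+1 by apply/eqP; rewrite eqn_leq ij -ltnS ij2.
  subst i; have [[_ [b'j _]]|[bE rE]] := cases; last by split.
  by move: ib'; rewrite ltNge b'j.
have cx t : b <= t -> t < b' -> {for t, continuous x2}.
  by move=> bt tb; exact: is_derive_cont (dx2 t bt tb).
have cxt : {for b, continuous xt} by exact: is_derive_cont dxt.
have c1 : continuous (fun x : loop_state R r n d => x.1) := loclip_continuous (@loclip_fst R _ _).
have c2 : continuous (fun x : loop_state R r n d => x.2) := loclip_continuous (@loclip_snd R _ _).
have c1' : continuous (fun x : 'rV[R]_r * 'rV[R]_n * R => x.1) := loclip_continuous (@loclip_fst R _ _).
have c2' : continuous (fun x : 'rV[R]_r * 'rV[R]_n * R => x.2) := loclip_continuous (@loclip_snd R _ _).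
have c1'' : continuous (fun x : 'rV[R]_r * 'rV[R]_n => x.1) := loclip_continuous (@loclip_fst R _ _).
have c2'' : continuous (fun x : 'rV[R]_r * 'rV[R]_n => x.2) := loclip_continuous (@loclip_snd R _ _).
have k1 (x : R -> loop_state R r n d) t : {for t, continuous x} -> {for t, continuous (fun t => (x t).1)}.
  by move=> H; exact: (cvg_comp _ _ H (c1 _)).
have k2 (x : R -> loop_state R r n d) t : {for t, continuous x} -> {for t, continuous (fun t => (x t).2)}.
  by move=> H; exact: (cvg_comp _ _ H (c2 _)).
have k12 (x : R -> loop_state R r n d) t : {for t, continuous x} -> {for t, continuous (fun t => (x t).1.2)}.
  by move=> H; exact: (cvg_comp _ _ (k1 _ _ H) (c2' _)).
have k11 (x : R -> loop_state R r n d) t : {for t, continuous x} -> {for t, continuous (fun t => (x t).1.1)}.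
  by move=> H; exact: (cvg_comp _ _ (k1 _ _ H) (c1' _)).
have k112 (x : R -> loop_state R r n d) t : {for t, continuous x} -> {for t, continuous (fun t => (x t).1.1.2)}.
  by move=> H; exact: (cvg_comp _ _ (k11 _ _ H) (c2'' _)).
have k111 (x : R -> loop_state R r n d) t : {for t, continuous x} -> {for t, continuous (fun t => (x t).1.1.1)}.
  by move=> H; exact: (cvg_comp _ _ (k11 _ _ H) (c1'' _)).
split; last first.
  split; first by rewrite /X' /wdm'.
  move=> t /[dup] tb [t00]; rewrite lte_fin => tb' /=.
  by rewrite !splice_lt// (wom t tb).
constructor => /=.
- by rewrite lte_fin; exact: lt_trans bb'.
- split=> [|t _ _]; last exact: dom.
  by apply: continuous_subspaceT => t; exact: is_derive_cont (dom t).
- move=> i i0 /[dup] ib /idx [[ib' ij]|[iE bE _]].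
    rewrite /wdm' (negPf ij).
    apply: (at_left_eq (g := wd_ X) (a := 0)); first by rewrite mulr_gt0// ltr0n.
      by move=> u _ ui; rewrite splice_lt// (lt_trans ui).
    by apply: (traj_wd_left tr i0); rewrite lte_fin.
  rewrite iE -bE /wdm' eqxx.
  apply: (at_left_eq (g := fun t => (xt t).1.1.1) (a := t0)) => //.
    by move=> u u0 ub; rewrite splice_lt//; have [] := Xxt u (ltW u0) ub.
  by apply: cvg_at_left_filter; exact: k111.
- move=> i /idx [[ib' ij]|[iE bE rE]].
    rewrite /wdm' (negPf ij) splice_lt// (traj_wd_reset tr) ?lte_fin//.
    by rewrite wom//; split; [rewrite mulr_ge0// ?ler0n// ltW|rewrite lte_fin].
  by rewrite iE -bE /wdm' eqxx splice_ge.
- move=> i /idx [[ib' ij]|[iE bE rE]].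
    rewrite (splice_lt _ _ ib'); apply: (at_right_eq (g := wd_ X) ib').
      by move=> u _ ub; rewrite splice_lt.
    by apply: (traj_wd_right tr); rewrite lte_fin.
  rewrite iE -bE (splice_ge _ _ (lexx b)).
  apply: (at_right_eq (g := fun t => (x2 t).1.1.1) bb').
    by move=> u bu _; rewrite splice_ge// ltW.
  by apply: cvg_at_right_filter; apply: k111; exact: cx.
- have [cz cy cxi] := traj_cont tr; split.
  + have X1 t : t0 <= t -> t < b -> z_ X t = (xt t).1.1.2 by move=> t0t tb; have [] := Xxt t t0t tb.
    exact: (@splice_continuous R _ (z_ X) (fun t => (xt t).1.1.2) (fun t => (x2 t).1.1.2) t0 b b'
      t0b cz X1 (k112 _ _ cxt) (fun t bt tb => k112 _ _ (cx t bt tb)) E2).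
  + have X1 t : t0 <= t -> t < b -> y_ X t = (xt t).1.2 by move=> t0t tb; have [] := Xxt t t0t tb.
    exact: (@splice_continuous R _ (y_ X) (fun t => (xt t).1.2) (fun t => (x2 t).1.2) t0 b b'
      t0b cy X1 (k12 _ _ cxt) (fun t bt tb => k12 _ _ (cx t bt tb)) E3).
  + have X1 t : t0 <= t -> t < b -> xi_ X t = (xt t).2 by move=> t0t tb; have [] := Xxt t t0t tb.
    exact: (@splice_continuous R _ (xi_ X) (fun t => (xt t).2) (fun t => (x2 t).2) t0 b b'
      t0b cxi X1 (k2 _ _ cxt) (fun t bt tb => k2 _ _ (cx t bt tb)) E4).
- move=> t t00; rewrite lte_fin => tb' nT.
  have [tb|bt] := ltP t b.
    have := traj_flow tr t00 (ltac:(by rewrite lte_fin) : (t%:E < b%:E)%E) nT.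
    apply: (loop_flow_ext (de := b - t)); first by rewrite subr_gt0.
    move=> u ut; have ub : u < b by have := le_lt_trans (ler_norm _) ut; lra.
    by rewrite !splice_lt.
  have [bt'|tb] := ltP b t.
    have := loop_flow_proj (dx2 t bt tb').
    apply: (loop_flow_ext (de := t - b)); first by rewrite subr_gt0.
    move=> u; rewrite distrC => ut; have ub : b <= u by have := le_lt_trans (ler_norm _) ut; lra.
    by rewrite !splice_ge.
  have tE : t = b by apply/eqP; rewrite eq_le tb bt.
  have [[_ [_ x2E]]|[bE _]] := cases; last by case: (nT j.+1); rewrite tE.
  (* At [t = b], not a sampling time here, the derivative is two-sided: [xt] represents the glued
     signals on both sides. *)
  rewrite tE; have := loop_flow_proj dxt.
  apply: (loop_flow_ext (de := b - t0)); first by rewrite subr_gt0.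
  move=> u; rewrite distrC => ut; have t0u : t0 <= u by have := le_lt_trans (ler_norm _) ut; lra.
  have [ub|bu] := ltP u b; last by rewrite !splice_ge// x2E.
  by rewrite !splice_lt//; have [] := Xxt u t0u ub.
Qed.

End Extension.

(** * Boundedness *)

Section Prolongation.
Variable R : realType.
Variables (r n p d N : nat).
Variables (s : 'rV[R]_r -> 'rV[R]_r) (yr : 'rV[R]_r -> R)
  (f : 'rV[R]_n -> R -> 'rV[R]_p -> 'rV[R]_n) (q : 'rV[R]_n -> R -> 'rV[R]_p -> R)
  (phic : 'rV[R]_d -> R) (c : 'I_d -> R) (lev : nat -> R) (T kappa k : R) (mu : 'rV[R]_p).

Lemma norm_le_enorm m (x : 'rV[R]_m) : `|x| <= enorm x.
Proof.
rewrite enormE -[leLHS]ger0_norm// -sqrtr_sqr ler_sqrt ?enorm2_ge0//.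
exact: norm_le_enorm2.
Qed.

(** Open on the left, so that an end [b] which is a sampling time is assigned to the interval
    preceding it. *)
Lemma sampling_index_lt (b : R) : 0 < T -> 0 < b -> exists j : nat, j%:R * T < b /\ b <= j.+1%:R * T.
Proof.
move=> T0 b0; have ex : exists i : nat, b <= i%:R * T.
  have [i _ Hi] := nbhs_infty_ger (b / T); exists i.
  by have := Hi i (leqnn i); rewrite /= ler_pdivrMr.
case: (ex_minnP ex) => -[|j] bj jmin; first by move: bj; rewrite mul0r leNgt b0.
exists j; split => //; rewrite ltNge; apply/negP => /jmin.
by rewrite ltnn.
Qed.

Lemma sampling_index_le (t : R) : 0 < T -> 0 <= t -> exists j : nat, j%:R * T <= t /\ t < j.+1%:R * T.
Proof.
move=> T0 t0; have [->|ne] := eqVneq t 0.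
  by exists 0%N; rewrite mul0r mul1r.
have [j [jt tj]] := sampling_index_lt T0 (ltac:(by rewrite lt_neqAle eq_sym ne) : 0 < t).
have [tj'|tj'] := ltP t (j.+1%:R * T); first by exists j; rewrite ltW.
exists j.+1; split => //; apply: le_lt_trans tj _.
by rewrite ltr_pM2r// ltr_nat.
Qed.

(** Boundedness confines the state to a compact box, so [ode_continue] carries the flow past [b]. If
    [b] is a sampling time, the continued flow only provides the left limit, and a new solution
    starts after the reset. *)
Lemma prolong_trajectory (b : R) (X : signals R r n d) (om : R -> 'rV[R]_r) :
  0 < T -> locally_lipschitz s -> C1 yr ->
  C1 (fun x : 'rV[R]_n * R * 'rV[R]_p => f x.1.1 x.1.2 x.2) ->
  C1 (fun x : 'rV[R]_n * R * 'rV[R]_p => q x.1.1 x.1.2 x.2) ->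
  locally_lipschitz phic ->
  trajectory s yr f q phic c N lev T kappa k mu b%:E X ->
  (forall t, is_derive t (1 : R) om (s (om t))) ->
  (forall t, upto b%:E t -> w_ X t = om t) -> bounded_upto b%:E X ->
  exists (b' : R) (X' : signals R r n d), [/\ b < b',
    trajectory s yr f q phic c N lev T kappa k mu b'%:E X' & agree_upto b%:E X X'].
Proof.
move=> T0 ls hyr hf hq lp tr dom wom [B HB].
have b0 : 0 < b by have := traj_dom tr; rewrite lte_fin.
have [j [jb bj]] := sampling_index_lt T0 b0.
have jT0 : 0 <= j%:R * T by rewrite mulr_ge0// ltW.
have lF := loop_field_loclip c kappa k mu ls hyr hf hq lp.
have gV := @loop_state_complete R r n d; have pV := @loop_state_primitives R r n d.
pose K : set (loop_state R r n d) := box B `*` box B `*` `[- B, B]%classic `*` box B.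
have cK : compact K.
  apply: compact_setX; last exact: compact_box.
  apply: compact_setX; last exact: segment_compact.
  by apply: compact_setX; exact: compact_box.
pose x t : loop_state R r n d := (wd_ X t, z_ X t, y_ X t, xi_ X t).
have Hx t : j%:R * T < t -> t < b ->
    is_derive t (1 : R) x (loop_field s yr f q phic c kappa k mu (x t)) /\ K (x t).
  move=> jt tb; have t0 : 0 < t by exact: le_lt_trans jt.
  have tb' : (t%:E < b%:E)%E by rewrite lte_fin.
  split.
    apply: loop_flow_pair; apply: (traj_flow tr t0 tb').
    by apply: (no_sampling_between T0 jt); exact: lt_le_trans bj.
  have [_ h2 h3 h4 h5] := HB t (conj (ltW t0) tb').
  split=> /=; last by apply: boxP; exact: le_trans (norm_le_enorm _) h5.
  split=> /=; last by rewrite in_itv /= -ler_norml.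
  by split=> /=; apply: boxP; [exact: le_trans (norm_le_enorm _) h2|exact: le_trans (norm_le_enorm _) h3].
have [t0 [de [xt [jt0 t0b bde dxt xxt]]]] := ode_continue gV pV lF cK jb Hx.
have near_t t : t0 <= t -> t < t0 + de -> `|t - t0| < de.
  by move=> h1 h2; rewrite ger0_norm ?subr_ge0// ltrBlDl.
have dxtb := dxt b (near_t b (ltW t0b) bde).
have Xxt t : t0 <= t -> t < b ->
     [/\ wd_ X t = (xt t).1.1.1, z_ X t = (xt t).1.1.2, y_ X t = (xt t).1.2 & xi_ X t = (xt t).2].
  by move=> h1 h2; rewrite -xxt.
have jj : j.+1%:R * T < j.+2%:R * T by rewrite ltr_pM2r// ltr_nat.
have [bj'|bj'] := ltP b (j.+1%:R * T).
  pose b' := Num.min (t0 + de) (j.+1%:R * T).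
  have bb' : b < b' by rewrite lt_min bde.
  have b'j : b' <= j.+1%:R * T by rewrite ge_min lexx orbT.
  have dx2 t : b <= t -> t < b' -> is_derive t (1 : R) xt (loop_field s yr f q phic c kappa k mu (xt t)).
    move=> bt; rewrite lt_min => /andP[td _]; apply: dxt; apply: near_t => //.
    exact: le_trans (ltW t0b) bt.
  have Ex : [/\ (xt b).1.1.2 = (xt b).1.1.2, (xt b).1.2 = (xt b).1.2 & (xt b).2 = (xt b).2] by [].
  have [H1 H2] := splice_trajectory T0 tr dom wom jt0 t0b bb' bj (le_trans b'j (ltW jj)) dxtb Xxt dx2 Ex
    (or_introl (conj bj' (conj b'j erefl))).
  by exists b'; eexists; split; [exact: bb'|exact: H1|exact: H2].
have bE : b = j.+1%:R * T by apply/eqP; rewrite eq_le bj bj'.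
(* State just after the reset at [b]: only the first component jumps. *)
pose x0 : loop_state R r n d := ((xt b).1.1.1 + (lev j.+1 / N%:R) *:
      \row_(i < r) quantize N (lev j.+1) (om b ord0 i - (xt b).1.1.1 ord0 i),
   (xt b).1.1.2, (xt b).1.2, (xt b).2).
have [rho [d2 [rho0 d20 Hp]]] := picard gV pV lF x0.
have [y [y0 dy]] := Hp x0 ltac:(by rewrite subrr normr0).
pose x2 t := y (t - b).
pose b' := Num.min (b + d2) (j.+2%:R * T).
have bb' : b < b' by rewrite lt_min ltrDl d20 bE.
have b'j : b' <= j.+2%:R * T by rewrite ge_min lexx orbT.
have dx2 t : b <= t -> t < b' -> is_derive t (1 : R) x2 (loop_field s yr f q phic c kappa k mu (x2 t)).
  move=> bt; rewrite lt_min => /andP[td _]; apply: is_derive_shiftl; apply: dy.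
  by rewrite ger0_norm ?subr_ge0// ltrBlDl.
have x2b : x2 b = x0 by rewrite /x2 subrr.
have Ex : [/\ (x2 b).1.1.2 = (xt b).1.1.2, (x2 b).1.2 = (xt b).1.2 & (x2 b).2 = (xt b).2].
  by rewrite x2b.
have Er : (x2 b).1.1.1 = (xt b).1.1.1 + (lev j.+1 / N%:R) *:
      \row_(i < r) quantize N (lev j.+1) (om b ord0 i - (xt b).1.1.1 ord0 i) by rewrite x2b.
have [H1 H2] := splice_trajectory T0 tr dom wom jt0 t0b bb' bj b'j dxtb Xxt dx2 Ex
    (or_intror (conj bE Er)).
by exists b'; eexists; split; [exact: bb'|exact: H1|exact: H2].
Qed.

End Prolongation.

(** * Induction over the samples *)

Section Boundedness.
Variable R : realType.
Variables (r n p d N : nat).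
Variables (s : 'rV[R]_r -> 'rV[R]_r) (yr : 'rV[R]_r -> R)
  (f : 'rV[R]_n -> R -> 'rV[R]_p -> 'rV[R]_n) (q : 'rV[R]_n -> R -> 'rV[R]_p -> R)
  (phic : 'rV[R]_d -> R) (c : 'I_d -> R) (lev : nat -> R) (T kappa k : R) (mu : 'rV[R]_p)
  (b : \bar R) (X : signals R r n d).

(** Replacing [wd_] by [psi] removes the jump at the right end, so the closed interval up to and
    including the next sample is covered. *)
Lemma closed_loop_segment (j : nat) (psi : R -> 'rV[R]_r) (t1 : R) : 0 < T ->
  locally_lipschitz s -> trajectory s yr f q phic c N lev T kappa k mu b X ->
  (forall t, is_derive t (1 : R) psi (s (psi t))) -> psi (j%:R * T) = wd_ X (j%:R * T) ->
  j%:R * T <= t1 -> t1 <= j.+1%:R * T -> (t1%:E < b)%E ->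
  closed_loop yr f q phic c kappa k mu psi (j%:R * T) t1 (z_ X) (y_ X) (xi_ X).
Proof.
move=> T0 ls tr dpsi psi0 jt1 t1j t1b.
have jT0 : 0 <= j%:R * T by rewrite mulr_ge0// ltW.
have jb : ((j%:R * T)%:E < b)%E by apply: le_lt_trans t1b; rewrite lee_fin.
have [cz cy cxi] := traj_cont tr.
split; [exact: upto_within cz jT0 t1b|exact: upto_within cy jT0 t1b|exact: upto_within cxi jT0 t1b|].
move=> t jt tt1; have tj := lt_le_trans tt1 t1j.
have tb : (t%:E < b)%E by apply: lt_trans t1b; rewrite lte_fin.
rewrite -(traj_segment T0 tr ls jb dpsi (esym psi0) (ltW jt) tj tb).
by have [] := traj_flow tr (le_lt_trans jT0 jt) tb (no_sampling_between T0 jt tj).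
Qed.

End Boundedness.

Theorem proposition2 (R : realType) (r n p d Nb N : nat)
  (s : 'rV[R]_r -> 'rV[R]_r) (yr : 'rV[R]_r -> R)
  (f : 'rV[R]_n -> R -> 'rV[R]_p -> 'rV[R]_n)
  (q : 'rV[R]_n -> R -> 'rV[R]_p -> R)
  (W0 W : set 'rV[R]_r) (M : R -> R)
  (P : set 'rV[R]_p) (Z : set 'rV[R]_n) (Y : set R)
  (phi phic : 'rV[R]_d -> R) (c : 'I_d -> R) (Xi : set 'rV[R]_d)
  (A0 := omega_limit (zero_field s yr f)
           (P `*` W `*` Z : set (zstate R p r n)))
  (hN : channel_levels r Nb N)
  (hP : compact P) (hZ : compact Z) (hY : compact Y) (hXi : compact Xi)
  (hs : C1 s) (hyr : C1 yr)
  (hf : C1 (fun x : 'rV[R]_n * R * 'rV[R]_p => f x.1.1 x.1.2 x.2))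
  (hq : C1 (fun x : 'rV[R]_n * R * 'rV[R]_p => q x.1.1 x.1.2 x.2))
  (htau : forall i : nat, (i < d)%N ->
     C1 (tau_comp s yr f q i : zstate R p r n -> R))
  (hA0 : assumption_A0 s W0)
  (hA1 : assumption_A1 s W0 W N)
  (hM : divergence_bound s W M)
  (hA2 : assumption_A2 s yr f P W Z)
  (hA3 : assumption_A3 s yr f q A0 phi)
  (hphic : locally_lipschitz phic)
  (hphic_supp : compact_support phic)
  (hphic_eq : forall x, A0 x ->
     phic (tau d s yr f q x) = phi (tau d s yr f q x))
  (hc : Hurwitz (char_poly_of c)) :
  exists2 kappa_star : R, 0 < kappa_star &
  forall kappa : R, kappa_star <= kappa ->
  exists T_star k_star : R, [/\ 0 < T_star, 0 < k_star &
  forall T : R, T_star < T -> Num.sqrt r%:R * M T < N%:R ->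
  forall k : R, k_star <= k ->
  forall mu : 'rV[R]_p, P mu ->
  let traj := trajectory s yr f q phic c N
                (chan_range r N (M T) (initial_range W0)) T kappa k mu in
  forall (b : \bar R) (X : signals R r n d),
    traj b X -> starts_in W0 Z Y Xi X ->
    bounded_upto b X /\ (maximal_traj traj b X -> b = +oo%E)].
Proof.
(* The filter matrix has its spectrum in the left half plane for every positive [kappa], so 1 serves
   as threshold. *)
exists 1 => // kappa kap1; have kap0 : 0 < kappa by exact: lt_le_trans kap1.
have [d0 _ _] := hA3; have [N0 _ _] := hN.
have [ls cW0 invW0] := hA0; have [cW W0W invW _] := hA1.
have hin : C1 (zero_input s yr q : zstate R p r n -> R) := htau 0%N d0.
have [Ts [ks [X1 [Y1 [Bd [Ts0 ks0 YB XB main]]]]]] :=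
  sampling_interval d0 hP hY hXi cW ls hyr hf hq hin hphic hphic_supp hc hA2 kap0.
exists Ts, ks; split => // T TsT MT k kk mu Pmu traj b X tr [w0 wd0 z0 y0 xi0].
have T0 : 0 < T by exact: lt_trans TsT.
have Wwd := encoder_invariant N0 hA0 hA1 hM T0 MT tr w0 wd0.
have [om [om0 dom Wom]] := invariant_solution 0 invW0 w0.
have wom : forall t, upto b t -> w_ X t = om t := solution_unique ls (traj_w tr) dom (esym om0).
have segment (j : nat) (t : R) : Z (z_ X (j%:R * T)) -> `|y_ X (j%:R * T)| <= Y1 ->
    `|xi_ X (j%:R * T)| <= X1 -> j%:R * T <= t -> t <= j.+1%:R * T -> (t%:E < b)%E ->
    [/\ `|z_ X t| <= Bd, `|y_ X t| <= Bd & `|xi_ X t| <= Bd] /\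
    (j%:R * T + Ts <= t -> [/\ Z (z_ X t), `|y_ X t| <= Y1 & `|xi_ X t| <= X1]).
  move=> zj yj xij jt tj tb.
  have jb : ((j%:R * T)%:E < b)%E by apply: le_lt_trans tb; rewrite lee_fin.
  have [psi [psi0 dpsi Wpsi]] := invariant_solution (j%:R * T) invW (Wwd j jb).
  have CL := closed_loop_segment T0 ls tr dpsi psi0 jt tj tb.
  have [H1 H2] := main k kk mu Pmu psi dpsi Wpsi _ _ _ _ _ jt CL zj yj xij.
  by split => //; apply: H1.
(* Since [T > Ts], a full sampling interval is long enough for [z], [y] and [xi] to return to the
   sets in which the next interval may start. *)
have sample (j : nat) : ((j%:R * T)%:E < b)%E ->
    [/\ Z (z_ X (j%:R * T)), `|y_ X (j%:R * T)| <= Y1 & `|xi_ X (j%:R * T)| <= X1].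
  elim: j => [_|j IH jb]; first by rewrite mul0r; split; [|exact: YB|exact: XB].
  have jj : j.+1%:R * T = j%:R * T + T by rewrite -natr1 mulrDl mul1r.
  have jle : j%:R * T <= j.+1%:R * T by rewrite jj lerDl ltW.
  have jb' : ((j%:R * T)%:E < b)%E by apply: le_lt_trans jb; rewrite lee_fin.
  have [zj yj xij] := IH jb'.
  by apply: (segment j _ zj yj xij jle (lexx _) jb).2; rewrite jj lerD2l ltW.
have [B1 B10 HB1] := compact_norm_bound cW.
have bounded : bounded_upto b X.
  pose B := `|B1| + `|Bd|.
  exists (Num.sqrt r%:R * B + (Num.sqrt n%:R * B + (B + Num.sqrt d%:R * B))) => t tb.
  have [t0 tb'] := tb; have [j [jt tj]] := sampling_index_le T0 t0.
  have jb : ((j%:R * T)%:E < b)%E by apply: le_lt_trans tb'; rewrite lee_fin.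
  have [zj yj xij] := sample j jb.
  have [[hz hy hxi] _] := segment j t zj yj xij jt (ltW tj) tb'.
  have [psi [psi0 dpsi Wpsi]] := invariant_solution (j%:R * T) invW (Wwd j jb).
  have wdE := traj_segment T0 tr ls jb dpsi (esym psi0) jt tj tb'.
  have B0 : 0 <= B by rewrite addr_ge0.
  have leB1 : B1 <= B by rewrite /B (le_trans (ler_norm _))// lerDl.
  have leBd : Bd <= B by rewrite /B (le_trans (ler_norm _))// lerDr.
  have enB m (v : 'rV[R]_m) : `|v| <= B -> enorm v <= Num.sqrt m%:R * B.
    by move=> vB; apply: enorm_le_coord => // i; exact: le_trans (norm_rV_coord _ _) vB.
  have s0 m : 0 <= Num.sqrt m%:R * B by rewrite mulr_ge0// sqrtr_ge0.
  have sr := s0 r; have sn := s0 n; have sd := s0 d.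
  have hw : enorm (w_ X t) <= Num.sqrt r%:R * B.
    by apply: enB; rewrite wom//; apply: le_trans leB1; apply: HB1; exact: W0W.
  have hwd : enorm (wd_ X t) <= Num.sqrt r%:R * B.
    by apply: enB; rewrite wdE; apply: le_trans leB1; exact: HB1.
  have hz' := enB _ _ (le_trans hz leBd); have hxi' := enB _ _ (le_trans hxi leBd).
  have hy' := le_trans hy leBd.
  split.
  - by apply: le_trans hw _; rewrite lerDl !addr_ge0.
  - by apply: le_trans hwd _; rewrite lerDl !addr_ge0.
  - by apply: le_trans hz' _; rewrite addrCA lerDl !addr_ge0.
  - by apply: le_trans hy' _; rewrite addrA addrCA lerDl !addr_ge0.
  - by apply: le_trans hxi' _; rewrite !addrA lerDr !addr_ge0.
(* A finite end is excluded because the bounded trajectory can be prolonged beyond it, and the end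
   [-oo] by [traj_dom]. *)
split=> // -[_ maxb]; case: b => [b||] // in tr wom segment sample bounded maxb Wwd *.
  have [b' [X' [bb' tr' agr]]] := prolong_trajectory T0 ls hyr hf hq hphic tr dom wom bounded.
  by have := maxb _ _ tr' agr; rewrite lee_fin leNgt bb'.
by have := traj_dom tr; rewrite ltNge leNye.
Qed.
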